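(* Let $k\ge 7$ be an odd integer. Up to rational multiples of $\zeta(k)$, the values $\{\zeta(r,s) : r \text{ even},\ 4\le r\le k-3,\ r+s=k\}$ satisfy at least $\dim S_{k-1}+\dim S_{k+1}$ linearly independent rational linear relations. That is, the $\mathbb{Q}$-vector space of families $(a_r)_{4\le r\le k-3,\ r\text{ even}}$ of rational numbers such that $$\sum_{\substack{4\le r\le k-3\\ r\text{ even}}}a_r\,\zeta(r,k-r)\in\mathbb{Q}\,\zeta(k)$$ has dimension at least $\dim S_{k-1}+\dim S_{k+1}$.
   Context: For integers $r\ge2$, $s\ge1$, the double zeta value is $\zeta(r,s)=\sum_{m>n>0}\frac{1}{m^r n^s}$ (sum over integers). $\zeta(k)$ is the Riemann zeta value. $S_i$ denotes the complex vector space of cusp forms of weight $i$ on $\mathrm{SL}_2(\mathbb{Z})$, and $\dim$ is its complex dimension. *)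

(* Defs.v *)
From HB Require Import structures.
From mathcomp Require Import all_boot all_order all_algebra complex.
From mathcomp Require Import all_classical all_reals all_analysis.

Set Implicit Arguments.
Unset Strict Implicit.
Unset Printing Implicit Defensive.

Import Order.TTheory GRing.Theory Num.Theory.
Import numFieldNormedType.Exports.

Local Open Scope classical_set_scope.
Local Open Scope ring_scope.
Local Open Scope complex_scope.

Definition zeta (R : realType) (s : nat) : R :=
  limn (fun N => \sum_(1 <= n < N) (n%:R ^- s : R)).

(* The sum of 1 / (m^r n^s) over m > n > 0; the terms are nonnegative, so that
   summing first over the finitely many n < m is no loss. *)
Definition double_zeta (R : realType) (r s : nat) : R :=
  limn (fun N =>
    \sum_(1 <= m < N) \sum_(1 <= n < m) (m%:R ^- r * n%:R ^- s : R)).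

Definition has_dim (K : fieldType) (V : lmodType K) (W : set V) (d : nat) :
    Prop :=
  exists e : 'I_d -> V,
    (forall c : 'I_d -> K, \sum_i c i *: e i = 0 -> forall i, c i = 0) /\
    W = [set v | exists c : 'I_d -> K, v = \sum_i c i *: e i].

Definition at_i_infty (R : realType) : set_system R[i] :=
  filter_from [set: R] (fun M => [set z : R[i] | M < complex.Im z]).
Arguments at_i_infty R : clear implicits.

(* A function on the upper half-plane is encoded as a function on the whole
   plane that is 0 off the upper half-plane, so that equality of functions is
   equality on the upper half-plane.  [derivable] is taken over the field
   [R[i]], hence is complex differentiability. *)
Definition cusp_forms (R : realType) (w : nat) : set (R[i] -> R[i]^o) :=
  [set f | [/\ forall z : R[i], complex.Im z <= 0 -> f z = 0,
               forall z : R[i], 0 < complex.Im z ->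
                 derivable (f : R[i]^o -> R[i]^o) z 1,
               forall (a b c d : int) (z : R[i]),
                 a * d - b * c = 1 -> 0 < complex.Im z ->
                 f ((a%:~R * z + b%:~R) / (c%:~R * z + d%:~R)) =
                 (c%:~R * z + d%:~R) ^+ w * f z
             & f z @[z --> at_i_infty R] --> (0 : R[i]^o)]].
Arguments cusp_forms R w : clear implicits.

Definition even_index (k : nat) : finType :=
  {r : 'I_k | (4 <= r <= k - 3)%N && ~~ odd r}.

Definition double_zeta_relation (R : realType) (k : nat)
    (a : {ffun even_index k -> rat^o}) : Prop :=
  exists q : rat,
    \sum_(r : even_index k) ratr (a r) * double_zeta R (val r) (k - val r) =
    ratr q * zeta R k.

(* Main.v *)
(* Put k = m + 2.  The stuffle and shuffle products evaluate zeta(j+1) zeta(m+1-j)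
   in two ways.  Hence a symmetric form p(X,Y) of degree m with p(0,1) = p(1,1) = 0
   such that p(X,Y) - p(X,X+Y) is odd in X yields a relation among the
   zeta(even, odd): its coefficients are those of p(X,Y) - p(X,X+Y), divided by
   binomial coefficients.  If q(X,Y) is even in X and
     q(X,X-Y) + q(Y,Y-X) + q(X,Y) = q(X-Y,Y),
   then p(X,Y) = q(X,X-Y) + q(Y,Y-X) is such a form, and it gives the zero relation
   only if q(x+1,1) = q(x-1,1), i.e. only if q is a multiple of Y^m.

   Period polynomials satisfy P(X,Y) = P(X+Y,Y) + P(X,X+Y) and P(-Y,X) = -P(X,Y).
   The odd part Q of the period polynomial of a cusp form of weight k-1 gives
   q = X Q; the even part P of that of a cusp form of weight k+1 gives q = dP/dY.
   If q = X Q + dP/dY is a multiple of Y^m, then Q = 0 and P is a multiple of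
   X^(m+1) - Y^(m+1).  So the relations of the two families are independent
   over the complex numbers once Q = 0, resp. P = c (X^(m+1) - Y^(m+1)), forces the
   cusp form to vanish; since the constraints on p are rational linear equations,
   the rank is the same over the rationals.

   This injectivity (part of the Eichler-Shimura isomorphism) is proved with the
   maximum principle.  If r is the period polynomial of f, of degree n, with
   r(z) + s r(-z) = K (z^n - 1), and E(z, x) is the Eichler integral of f, then
   Phi(z) = E(z, z) + s E(-z, -conj z) - K is 1-periodic and
   z^n Phi(-1/z) = Phi(z), so |Phi|^2 / y^n is invariant under SL_2(Z) and attains
   its maximum.  As Laplace(Phi) = -(2 i n / y) d Phi / d(conj z), this is
   impossible unless Phi = 0.  Then f = 0, because d Phi / d(conj z) is a nonzero
   multiple of y^n f(-conj z). *)

From Stdlib Require Reals Lra Lia ClassicalEpsilon Psatz ZArith.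
From Coquelicot Require Coquelicot.

(** * Complex analysis on the upper half-plane *)

Module HalfPlane.
Import Reals Lra Lia ClassicalEpsilon Psatz ZArith Coquelicot.
Open Scope R_scope.

(** Cauchy's formula, Fourier expansions and improper integrals are all avoided. A cusp form f is
    the bottom of a tower [F 0] = f, ([F j.+1])' = [F j] of periodic primitives tending to 0,
    provided by Goursat's theorem for rectangles. Every derivative that is needed is a lower storey
    of the tower, except that of f itself, which holomorphy gives; and integration by parts makes
    the Eichler integral a finite sum of terms (z - x)^(n-i) F_(i+1)(x). The obstacle is growth: at
    the point (-z, -conj z) the factor z - x has size 2 y, so Phi is bounded only if the primitives
    beat powers of y. An interior gradient estimate does this: each passage from a primitive to its
    derivative gains a factor 1/y, and a cuspidal function has primitives of every order. The finite
    dimension of the spaces of cusp forms is not presupposed. The rank inequality holds for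
    arbitrary linearly independent families, so with one family empty it bounds the size of the
    other, and the dimensions exist for that reason. *)

Definition cderiv (f : C -> C) (z l : C) : Prop :=
  forall eps, 0 < eps -> exists delta, 0 < delta /\
    forall h : C, Cmod h < delta ->
      Cmod (f (z + h) - f z - l * h)%C <= eps * Cmod h.

Lemma cderiv_ext (f g : C -> C) (z l : C) (r : R) :
  0 < r -> (forall h, Cmod h < r -> f (z + h)%C = g (z + h)%C) ->
  cderiv f z l -> cderiv g z l.
Proof.
intros Hr Hfg Hf eps Heps.
destruct (Hf eps Heps) as (d & Hd & H).
exists (Rmin d r); split; [now apply Rmin_pos|].
intros h Hh.
rewrite <- Hfg by (eapply Rlt_le_trans; [exact Hh|apply Rmin_r]).
replace (g z) with (f z).
- apply H; eapply Rlt_le_trans; [exact Hh|apply Rmin_l].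
- replace z with (z + 0)%C by ring. apply Hfg. now rewrite Cmod_0.
Qed.

Lemma cderiv_const (c z : C) : cderiv (fun _ => c) z 0.
Proof.
intros eps Heps; exists 1; split; [lra|]; intros h _.
replace (c - c - 0 * h)%C with (RtoC 0) by ring.
rewrite Cmod_0. apply Rmult_le_pos; [lra|apply Cmod_ge_0].
Qed.

Lemma cderiv_id (z : C) : cderiv (fun x => x) z 1.
Proof.
intros eps Heps; exists 1; split; [lra|]; intros h _.
replace (z + h - z - 1 * h)%C with (RtoC 0) by ring.
rewrite Cmod_0. apply Rmult_le_pos; [lra|apply Cmod_ge_0].
Qed.

Lemma cderiv_plus (f g : C -> C) (z l k : C) :
  cderiv f z l -> cderiv g z k -> cderiv (fun x => f x + g x)%C z (l + k)%C.
Proof.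
intros Hf Hg eps Heps.
destruct (Hf (eps / 2)) as (d & Hd & H); [lra|].
destruct (Hg (eps / 2)) as (e & He & H'); [lra|].
exists (Rmin d e); split; [now apply Rmin_pos|]; intros h Hh.
specialize (H h (Rlt_le_trans _ _ _ Hh (Rmin_l _ _))).
specialize (H' h (Rlt_le_trans _ _ _ Hh (Rmin_r _ _))).
replace (f (z + h) + g (z + h) - (f z + g z) - (l + k) * h)%C
  with ((f (z + h) - f z - l * h) + (g (z + h) - g z - k * h))%C by ring.
eapply Rle_trans; [apply Cmod_triangle|]. lra.
Qed.

Lemma cderiv_bound (f : C -> C) (z l : C) : cderiv f z l ->
  exists delta, 0 < delta /\ forall h, Cmod h < delta ->
    Cmod (f (z + h) - f z)%C <= (1 + Cmod l) * Cmod h.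
Proof.
intros Hf; destruct (Hf 1) as (d & Hd & H); [lra|].
exists d; split; [exact Hd|]; intros h Hh.
replace (f (z + h) - f z)%C with ((f (z + h) - f z - l * h) + l * h)%C by ring.
eapply Rle_trans; [apply Cmod_triangle|]. rewrite Cmod_mult.
specialize (H h Hh). lra.
Qed.

Lemma cderiv_cont (f : C -> C) (z l : C) : cderiv f z l ->
  forall eps, 0 < eps -> exists delta, 0 < delta /\
    forall h, Cmod h < delta -> Cmod (f (z + h) - f z)%C < eps.
Proof.
intros Hf eps Heps; destruct (cderiv_bound _ _ _ Hf) as (d & Hd & H).
assert (Hl := Cmod_ge_0 l).
exists (Rmin d (eps / (1 + Cmod l))); split.
- apply Rmin_pos; [exact Hd|]. apply Rdiv_lt_0_compat; lra.
- intros h Hh.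
  eapply Rle_lt_trans; [apply H; eapply Rlt_le_trans; [exact Hh|apply Rmin_l]|].
  apply Rlt_le_trans with ((1 + Cmod l) * (eps / (1 + Cmod l))).
  + apply Rmult_lt_compat_l; [lra|]. eapply Rlt_le_trans; [exact Hh|apply Rmin_r].
  + right; field; lra.
Qed.

Lemma cderiv_mult (f g : C -> C) (z l k : C) :
  cderiv f z l -> cderiv g z k ->
  cderiv (fun x => f x * g x)%C z (l * g z + f z * k)%C.
Proof.
intros Hf Hg eps Heps.
assert (Hgz := Cmod_ge_0 (g z)). assert (Hfz := Cmod_ge_0 (f z)).
assert (Hk := Cmod_ge_0 k).
set (a := eps / (3 * (1 + Cmod (g z)))).
set (b := eps / (3 * (1 + Cmod (f z)))).
set (c := eps / (3 * (1 + Cmod k))).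
assert (Ha : 0 < a) by (apply Rdiv_lt_0_compat; lra).
assert (Hb : 0 < b) by (apply Rdiv_lt_0_compat; lra).
assert (Hc : 0 < c) by (apply Rdiv_lt_0_compat; lra).
destruct (Hf a Ha) as (d1 & Hd1 & H1).
destruct (Hg b Hb) as (d2 & Hd2 & H2).
destruct (cderiv_cont _ _ _ Hf c Hc) as (d3 & Hd3 & H3).
destruct (cderiv_bound _ _ _ Hg) as (d4 & Hd4 & H4).
exists (Rmin (Rmin d1 d2) (Rmin d3 d4)); split; [repeat apply Rmin_pos; auto|].
intros h Hh.
assert (h1 : Cmod h < d1) by (eapply Rlt_le_trans; [exact Hh|]; eapply Rle_trans; [apply Rmin_l|apply Rmin_l]).
assert (h2 : Cmod h < d2) by (eapply Rlt_le_trans; [exact Hh|]; eapply Rle_trans; [apply Rmin_l|apply Rmin_r]).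
assert (h3 : Cmod h < d3) by (eapply Rlt_le_trans; [exact Hh|]; eapply Rle_trans; [apply Rmin_r|apply Rmin_l]).
assert (h4 : Cmod h < d4) by (eapply Rlt_le_trans; [exact Hh|]; eapply Rle_trans; [apply Rmin_r|apply Rmin_r]).
specialize (H1 h h1). specialize (H2 h h2). specialize (H3 h h3). specialize (H4 h h4).
replace (f (z + h) * g (z + h) - f z * g z - (l * g z + f z * k) * h)%C
  with ((f (z + h) - f z - l * h) * g z
        + (f z * (g (z + h) - g z - k * h)
           + (f (z + h) - f z) * (g (z + h) - g z)))%C by ring.
assert (Hh0 := Cmod_ge_0 h).
eapply Rle_trans; [apply Cmod_triangle|].
eapply Rle_trans; [apply Rplus_le_compat_l, Cmod_triangle|].
rewrite !Cmod_mult.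
assert (E1 : Cmod (f (z + h) - f z - l * h)%C * Cmod (g z) <= eps / 3 * Cmod h).
{ apply Rle_trans with (a * Cmod h * (1 + Cmod (g z))).
  - apply Rmult_le_compat; try apply Cmod_ge_0; lra.
  - right; unfold a; field; lra. }
assert (E2 : Cmod (f z) * Cmod (g (z + h) - g z - k * h)%C <= eps / 3 * Cmod h).
{ apply Rle_trans with ((1 + Cmod (f z)) * (b * Cmod h)).
  - apply Rmult_le_compat; try apply Cmod_ge_0; lra.
  - right; unfold b; field; lra. }
assert (E3 : Cmod (f (z + h) - f z)%C * Cmod (g (z + h) - g z)%C <= eps / 3 * Cmod h).
{ apply Rle_trans with (c * ((1 + Cmod k) * Cmod h)).
  - apply Rmult_le_compat; try apply Cmod_ge_0; lra.
  - right; unfold c; field; lra. }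
lra.
Qed.

Lemma cderiv_scal (c : C) (f : C -> C) (z l : C) :
  cderiv f z l -> cderiv (fun x => c * f x)%C z (c * l)%C.
Proof.
intros Hf. replace (c * l)%C with (0 * f z + c * l)%C by ring.
apply (cderiv_mult (fun _ => c)); [apply cderiv_const|exact Hf].
Qed.

Lemma cderiv_comp (f g : C -> C) (z l k : C) :
  cderiv f (g z) l -> cderiv g z k -> cderiv (fun x => f (g x)) z (l * k)%C.
Proof.
intros Hf Hg eps Heps.
assert (Hk := Cmod_ge_0 k). assert (Hl := Cmod_ge_0 l).
set (a := eps / (2 * (1 + Cmod k))). set (b := eps / (2 * (1 + Cmod l))).
assert (Ha : 0 < a) by (apply Rdiv_lt_0_compat; lra).
assert (Hb : 0 < b) by (apply Rdiv_lt_0_compat; lra).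
destruct (Hf a Ha) as (d1 & Hd1 & H1).
destruct (Hg b Hb) as (d2 & Hd2 & H2).
destruct (cderiv_cont _ _ _ Hg d1 Hd1) as (d3 & Hd3 & H3).
destruct (cderiv_bound _ _ _ Hg) as (d4 & Hd4 & H4).
exists (Rmin d2 (Rmin d3 d4)); split; [repeat apply Rmin_pos; auto|].
intros h Hh.
assert (h2 : Cmod h < d2) by (eapply Rlt_le_trans; [exact Hh|apply Rmin_l]).
assert (h3 : Cmod h < d3) by (eapply Rlt_le_trans; [exact Hh|]; eapply Rle_trans; [apply Rmin_r|apply Rmin_l]).
assert (h4 : Cmod h < d4) by (eapply Rlt_le_trans; [exact Hh|]; eapply Rle_trans; [apply Rmin_r|apply Rmin_r]).
specialize (H2 h h2). specialize (H3 h h3). specialize (H4 h h4).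
specialize (H1 (g (z + h) - g z)%C H3).
replace (g z + (g (z + h) - g z))%C with (g (z + h)%C) in H1 by ring.
replace (f (g (z + h)) - f (g z) - l * k * h)%C with
  ((f (g (z + h)) - f (g z) - l * (g (z + h) - g z))
   + l * (g (z + h) - g z - k * h))%C by ring.
assert (Hh0 := Cmod_ge_0 h).
eapply Rle_trans; [apply Cmod_triangle|]. rewrite Cmod_mult.
assert (E1 : a * Cmod (g (z + h) - g z)%C <= eps / 2 * Cmod h).
{ apply Rle_trans with (a * ((1 + Cmod k) * Cmod h)).
  - apply Rmult_le_compat_l; lra.
  - right; unfold a; field; lra. }
assert (E2 : Cmod l * Cmod (g (z + h) - g z - k * h)%C <= eps / 2 * Cmod h).
{ apply Rle_trans with ((1 + Cmod l) * (b * Cmod h)).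
  - apply Rmult_le_compat; try apply Cmod_ge_0; lra.
  - right; unfold b; field; lra. }
lra.
Qed.

Lemma Cmod_ge_sub (x y : C) : Cmod x - Cmod y <= Cmod (x + y)%C.
Proof.
assert (H := Cmod_triangle (x + y) (- y)). rewrite Cmod_opp in H.
replace (x + y + - y)%C with x in H by ring. lra.
Qed.

Lemma cderiv_inv (z : C) : z <> 0 -> cderiv (fun x => / x)%C z (- (/ z * / z))%C.
Proof.
intros Hz eps Heps.
assert (Mz := Cmod_gt_0 z). assert (mz : 0 < Cmod z) by (now apply Mz).
assert (m3 : 0 < Cmod z * Cmod z * Cmod z) by (repeat apply Rmult_lt_0_compat; auto).
exists (Rmin (Cmod z / 2) (eps * (Cmod z * Cmod z * Cmod z) / 2)); split.
- apply Rmin_pos; [lra|]. apply Rdiv_lt_0_compat; [|lra]. apply Rmult_lt_0_compat; lra.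
- intros h Hh.
  assert (h1 : Cmod h < Cmod z / 2) by (eapply Rlt_le_trans; [exact Hh|apply Rmin_l]).
  assert (h2 := Rlt_le_trans _ _ _ Hh (Rmin_r _ _)).
  assert (G := Cmod_ge_sub z h).
  assert (Hzh : (z + h)%C <> 0).
  { intros E; rewrite E, Cmod_0 in G; lra. }
  assert (mzh : 0 < Cmod (z + h)) by (now apply Cmod_gt_0).
  replace (/ (z + h) - / z - - (/ z * / z) * h)%C
    with (h * h * (/ z * / z * / (z + h)))%C.
  2:{ field. split; auto. }
  rewrite !Cmod_mult, !Cmod_inv by auto.
  assert (Hh0 := Cmod_ge_0 h).
  apply Rle_trans with (Cmod h * Cmod h * (/ Cmod z * / Cmod z * / (Cmod z / 2))).
  + apply Rmult_le_compat_l; [now apply Rmult_le_pos|].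
    apply Rmult_le_compat_l.
    { apply Rmult_le_pos; apply Rlt_le, Rinv_0_lt_compat; auto. }
    apply Rinv_le_contravar; lra.
  + replace (Cmod h * Cmod h * (/ Cmod z * / Cmod z * / (Cmod z / 2)))
      with (Cmod h * (2 / (Cmod z * Cmod z * Cmod z)) * Cmod h) by (field; lra).
    apply Rmult_le_compat_r; [auto|].
    apply Rle_trans with ((eps * (Cmod z * Cmod z * Cmod z) / 2) * (2 / (Cmod z * Cmod z * Cmod z))).
    * apply Rmult_le_compat_r; [|lra]. apply Rlt_le, Rdiv_lt_0_compat; lra.
    * right; field. lra.
Qed.

(** * Derivatives and integrals along lines *)

Definition rderiv (g : R -> C) (t : R) (l : C) : Prop :=
  is_derive (fun s => fst (g s)) t (fst l) /\
  is_derive (fun s => snd (g s)) t (snd l).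

Lemma Rabs_fst_le (z : C) : Rabs (fst z) <= Cmod z.
Proof. eapply Rle_trans; [apply Rmax_l|apply Rmax_Cmod]. Qed.
Lemma Rabs_snd_le (z : C) : Rabs (snd z) <= Cmod z.
Proof. eapply Rle_trans; [apply Rmax_r|apply Rmax_Cmod]. Qed.
Lemma Cmod_le_abs (z : C) : Cmod z <= Rabs (fst z) + Rabs (snd z).
Proof.
destruct z as [x y]; simpl.
replace (x, y) with (RtoC x + RtoC y * Ci)%C.
- eapply Rle_trans; [apply Cmod_triangle|]. rewrite Cmod_mult, !Cmod_R.
  replace (Cmod Ci) with 1; [lra|]. unfold Cmod; simpl. rewrite <- sqrt_1 at 1. f_equal; ring.
- unfold RtoC, Ci, Cplus, Cmult; simpl. f_equal; ring.
Qed.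

Lemma is_derive_eps (f : R -> R) (x l : R) :
  (forall eps, 0 < eps -> exists delta, 0 < delta /\
    forall h, Rabs h < delta -> Rabs (f (x + h) - f x - l * h) <= eps * Rabs h) ->
  is_derive f x l.
Proof.
intros H. apply is_derive_Reals. intros eps Heps.
destruct (H (eps / 2)) as (d & Hd & K); [lra|].
exists (mkposreal d Hd). intros h h0 Hh; simpl in Hh.
specialize (K h Hh).
replace ((f (x + h) - f x) / h - l) with ((f (x + h) - f x - l * h) / h) by (field; auto).
unfold Rdiv; rewrite Rabs_mult, Rabs_inv.
assert (0 < Rabs h) by (now apply Rabs_pos_lt).
apply Rle_lt_trans with (eps / 2 * Rabs h * / Rabs h).
- apply Rmult_le_compat_r; [|exact K]. now apply Rlt_le, Rinv_0_lt_compat.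
- replace (eps / 2 * Rabs h * / Rabs h) with (eps / 2) by (field; lra). lra.
Qed.

Lemma cderiv_line (f : C -> C) (z e l : C) (t : R) :
  cderiv f (z + t * e)%C l -> rderiv (fun s => f (z + s * e)%C) t (l * e)%C.
Proof.
intros Hf.
assert (K : forall eps, 0 < eps -> exists delta, 0 < delta /\ forall h : R, Rabs h < delta ->
   Cmod (f (z + (t + h)%R * e) - f (z + t * e) - (l * e) * h)%C <= eps * Rabs h).
{ intros eps Heps. assert (He := Cmod_ge_0 e).
  destruct (Hf (eps / (1 + Cmod e))) as (d & Hd & H); [apply Rdiv_lt_0_compat; lra|].
  exists (d / (1 + Cmod e)); split; [apply Rdiv_lt_0_compat; lra|]. intros h Hh.
  assert (E : Cmod (h * e) <= Rabs h * (1 + Cmod e)).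
  { rewrite Cmod_mult, Cmod_R. apply Rmult_le_compat_l; [apply Rabs_pos|lra]. }
  specialize (H (h * e)%C). rewrite RtoC_plus.
  replace (z + (t + h) * e)%C with (z + t * e + h * e)%C by ring.
  replace (l * e * h)%C with (l * (h * e))%C by ring.
  eapply Rle_trans; [apply H|].
  - eapply Rle_lt_trans; [exact E|].
    apply Rlt_le_trans with (d / (1 + Cmod e) * (1 + Cmod e)).
    + apply Rmult_lt_compat_r; lra.
    + right; field; lra.
  - apply Rle_trans with (eps / (1 + Cmod e) * (Rabs h * (1 + Cmod e))).
    + apply Rmult_le_compat_l; [|exact E]. apply Rlt_le, Rdiv_lt_0_compat; lra.
    + right; field; lra. }
split; apply is_derive_eps; intros eps Heps; destruct (K eps Heps) as (d & Hd & H);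
  exists d; split; auto; intros h Hh; specialize (H h Hh);
  (eapply Rle_trans; [|exact H]).
- eapply Rle_trans; [|apply Rabs_fst_le]. right; f_equal; simpl; ring.
- eapply Rle_trans; [|apply Rabs_snd_le]. right; f_equal; simpl; ring.
Qed.

Definition up (z : C) : Prop := 0 < snd z.

Lemma up_segment (z w : C) (t : R) : up z -> up w -> 0 <= t <= 1 -> up (z + t * (w - z))%C.
Proof.
unfold up; simpl; intros. nra.
Qed.

(** The half-plane is convex: on the segment from z to w both real components have derivative 0. *)
Lemma cderiv0_const (f : C -> C) :
  (forall z, up z -> cderiv f z 0) -> forall z w, up z -> up w -> f z = f w.
Proof.
intros H z w Hz Hw.
assert (K : forall t, 0 <= t <= 1 -> rderiv (fun s => f (z + s * (w - z))%C) t 0).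
{ intros t Ht. replace (RtoC 0) with (0 * (w - z))%C by ring.
  apply cderiv_line, H, up_segment; auto. }
replace (f z) with (f (z + 0 * (w - z))%C) by (f_equal; ring).
replace (f w) with (f (z + 1 * (w - z))%C) by (f_equal; ring).
apply injective_projections.
- apply (eq_is_derive (fun s => fst (f (z + s * (w - z))%C)) 0 1); [|lra].
  intros t Ht; apply (K t Ht).
- apply (eq_is_derive (fun s => snd (f (z + s * (w - z))%C)) 0 1); [|lra].
  intros t Ht; apply (K t Ht).
Qed.

Definition holomorphic (f : C -> C) : Prop := forall z, up z -> exists l, cderiv f z l.

Lemma rderiv_h (f : C -> C) (y t : R) (l : C) :
  cderiv f (t, y) l -> rderiv (fun s => f (s, y)) t l.
Proof.
intros Hf. assert (E : forall s : R, ((0, y) + s * 1)%C = (s, y)).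
{ intros s; apply injective_projections; simpl; ring. }
assert (H : rderiv (fun s => f ((0, y) + s * 1)%C) t (l * 1)%C).
{ apply cderiv_line. now rewrite E. }
replace (l * 1)%C with l in H by ring. destruct H as [H1 H2].
split; eapply is_derive_ext; try eassumption; intros s; simpl; now rewrite E.
Qed.

Lemma rderiv_v (f : C -> C) (x t : R) (l : C) :
  cderiv f (x, t) l -> rderiv (fun s => f (x, s)) t (Ci * l)%C.
Proof.
intros Hf. assert (E : forall s : R, ((x, 0) + s * Ci)%C = (x, s)).
{ intros s; apply injective_projections; simpl; ring. }
assert (H : rderiv (fun s => f ((x, 0) + s * Ci)%C) t (l * Ci)%C).
{ apply cderiv_line. now rewrite E. }
replace (l * Ci)%C with (Ci * l)%C in H by ring. destruct H as [H1 H2].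
split; eapply is_derive_ext; try eassumption; intros s; simpl; now rewrite E.
Qed.

Definition rcontinuous (g : R -> C) (a b : R) : Prop :=
  forall t, Rmin a b <= t <= Rmax a b ->
    continuous (fun s => fst (g s)) t /\ continuous (fun s => snd (g s)) t.

Lemma rderiv_rcont (g dg : R -> C) (a b : R) :
  (forall t, Rmin a b <= t <= Rmax a b -> exists l, rderiv g t l) -> rcontinuous g a b.
Proof.
intros H t Ht; destruct (H t Ht) as (l & H1 & H2).
split; refine (ex_derive_continuous _ _ (ex_intro _ _ _)); eassumption.
Qed.

Lemma hol_rcont_h (f : C -> C) (y a b : R) : holomorphic f -> 0 < y -> rcontinuous (fun s => f (s, y)) a b.
Proof.
intros Hf Hy; apply rderiv_rcont; [exact (fun _ => 0%C)|]; intros t _.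
destruct (Hf (t, y)) as (l & Hl); [exact Hy|]. exists l. now apply rderiv_h.
Qed.

Lemma hol_rcont_v (f : C -> C) (x c d : R) : holomorphic f -> 0 < c -> 0 < d -> rcontinuous (fun s => f (x, s)) c d.
Proof.
intros Hf Hc Hd; apply rderiv_rcont; [exact (fun _ => 0%C)|]; intros t Ht.
assert (0 < t) by (eapply Rlt_le_trans; [|apply Ht]; now apply Rmin_pos).
destruct (Hf (x, t)) as (l & Hl); [assumption|]. exists (Ci * l)%C. now apply rderiv_v.
Qed.

Definition CI (g : R -> C) (a b : R) : C :=
  (RInt (fun s => fst (g s)) a b, RInt (fun s => snd (g s)) a b).

Lemma rcont_ex1 g a b : rcontinuous g a b -> ex_RInt (fun s => fst (g s)) a b.
Proof. intros H; apply (ex_RInt_continuous (V := R_CompleteNormedModule)); intros t Ht; apply (H t Ht). Qed.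
Lemma rcont_ex2 g a b : rcontinuous g a b -> ex_RInt (fun s => snd (g s)) a b.
Proof. intros H; apply (ex_RInt_continuous (V := R_CompleteNormedModule)); intros t Ht; apply (H t Ht). Qed.

Lemma rcont_minus g h a b : rcontinuous g a b -> rcontinuous h a b -> rcontinuous (fun s => g s - h s)%C a b.
Proof.
intros Hg Hh t Ht; destruct (Hg t Ht), (Hh t Ht); split.
- apply (continuous_ext (fun s => minus (fst (g s)) (fst (h s)))); [reflexivity|].
  now apply (continuous_minus (V := R_NormedModule)).
- apply (continuous_ext (fun s => minus (snd (g s)) (snd (h s)))); [reflexivity|].
  now apply (continuous_minus (V := R_NormedModule)).
Qed.

Lemma rcont_const c a b : rcontinuous (fun _ => c) a b.
Proof. intros t _; split; apply continuous_const. Qed.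

Lemma CI_Chasles g a b c : rcontinuous g a b -> rcontinuous g b c -> (CI g a b + CI g b c = CI g a c)%C.
Proof.
intros H1 H2; unfold CI.
rewrite <- (RInt_Chasles (V := R_CompleteNormedModule) (fun s => fst (g s)) a b c
    (rcont_ex1 _ _ _ H1) (rcont_ex1 _ _ _ H2)).
rewrite <- (RInt_Chasles (V := R_CompleteNormedModule) (fun s => snd (g s)) a b c
    (rcont_ex2 _ _ _ H1) (rcont_ex2 _ _ _ H2)).
reflexivity.
Qed.

Lemma rcont_swap g a b : rcontinuous g a b -> rcontinuous g b a.
Proof. intros H t Ht; apply H. now rewrite Rmin_comm, Rmax_comm. Qed.

Lemma CI_swap g a b : rcontinuous g a b -> CI g b a = (- CI g a b)%C.
Proof.
intros H. unfold CI.
rewrite <- (opp_RInt_swap (V := R_CompleteNormedModule) _ _ _ (rcont_ex1 _ _ _ H)),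
  <- (opp_RInt_swap (V := R_CompleteNormedModule) _ _ _ (rcont_ex2 _ _ _ H)).
reflexivity.
Qed.

Lemma CI_minus g h a b : rcontinuous g a b -> rcontinuous h a b ->
  CI (fun s => g s - h s)%C a b = (CI g a b - CI h a b)%C.
Proof.
intros Hg Hh; unfold CI.
assert (E1 := RInt_minus (V := R_CompleteNormedModule) _ _ _ _ (rcont_ex1 _ _ _ Hg) (rcont_ex1 _ _ _ Hh)).
assert (E2 := RInt_minus (V := R_CompleteNormedModule) _ _ _ _ (rcont_ex2 _ _ _ Hg) (rcont_ex2 _ _ _ Hh)).
unfold minus, plus, opp in E1, E2; simpl in E1, E2.
unfold Cminus, Cplus, Copp; cbn [fst snd]. now rewrite E1, E2.
Qed.

Lemma CI_const c a b : CI (fun _ => c) a b = ((b - a)%R * c)%C.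
Proof.
unfold CI. rewrite !RInt_const. unfold scal; simpl; unfold mult; simpl.
apply injective_projections; simpl; ring.
Qed.

(** The factor 2 is the price of bounding real and imaginary parts separately. *)
Lemma CI_bound g a b M : rcontinuous g a b ->
  (forall t, Rmin a b <= t <= Rmax a b -> Cmod (g t) <= M) ->
  Cmod (CI g a b) <= 2 * M * Rabs (b - a).
Proof.
assert (K : forall a b, a <= b -> rcontinuous g a b ->
  (forall t, Rmin a b <= t <= Rmax a b -> Cmod (g t) <= M) ->
  Cmod (CI g a b) <= 2 * M * Rabs (b - a)).
{ clear a b; intros a b Hab Hc HM.
  rewrite Rabs_pos_eq by lra.
  rewrite -> Rmin_left, Rmax_right in HM by lra.
  assert (HM1 : forall t, a <= t <= b -> Rabs (fst (g t)) <= M).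
  { intros t Ht; eapply Rle_trans; [apply Rabs_fst_le|auto]. }
  assert (HM2 : forall t, a <= t <= b -> Rabs (snd (g t)) <= M).
  { intros t Ht; eapply Rle_trans; [apply Rabs_snd_le|auto]. }
  eapply Rle_trans; [apply Cmod_le_abs|]. simpl.
  assert (I1 := abs_RInt_le_const _ _ _ _ Hab (rcont_ex1 _ _ _ Hc) HM1).
  assert (I2 := abs_RInt_le_const _ _ _ _ Hab (rcont_ex2 _ _ _ Hc) HM2).
  lra. }
intros Hc HM. destruct (Rle_dec a b) as [H|H].
- now apply K.
- rewrite CI_swap, Cmod_opp, Rabs_minus_sym by (now apply rcont_swap). apply K.
  + lra.
  + now apply rcont_swap.
  + intros t Ht. apply HM. now rewrite Rmin_comm, Rmax_comm.
Qed.

Lemma CI_derive (G g : R -> C) (a b : R) :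
  (forall t, Rmin a b <= t <= Rmax a b -> rderiv G t (g t)) -> rcontinuous g a b ->
  CI g a b = (G b - G a)%C.
Proof.
intros HG Hg; unfold CI, Cminus, Cplus, Copp; cbn [fst snd]; f_equal; apply (is_RInt_unique (V := R_CompleteNormedModule)).
- apply (is_RInt_derive (V := R_CompleteNormedModule) (fun s => fst (G s))); intros t Ht; [apply (HG t Ht)|apply (Hg t Ht)].
- apply (is_RInt_derive (V := R_CompleteNormedModule) (fun s => snd (G s))); intros t Ht; [apply (HG t Ht)|apply (Hg t Ht)].
Qed.

(** * Goursat's theorem for rectangles *)

(** The contour integral of f(z) dz, counter-clockwise around [a,b] x [c,d]; on the vertical sides
    dz = i dy. *)
Definition Rect (f : C -> C) (a b c d : R) : C :=
  (CI (fun s => f (s, c)) a b + Ci * CI (fun s => f (b, s)) c d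
   - CI (fun s => f (s, d)) a b - Ci * CI (fun s => f (a, s)) c d)%C.

Lemma Rect_split_x f a m b c d : holomorphic f -> 0 < c -> 0 < d ->
  (Rect f a m c d + Rect f m b c d = Rect f a b c d)%C.
Proof.
intros Hf Hc Hd; unfold Rect.
rewrite <- (CI_Chasles (fun s => f (s, c)) a m b), <- (CI_Chasles (fun s => f (s, d)) a m b)
  by (now apply hol_rcont_h).
ring.
Qed.

Lemma Rect_split_y f a b c m d : holomorphic f -> 0 < c -> 0 < m -> 0 < d ->
  (Rect f a b c m + Rect f a b m d = Rect f a b c d)%C.
Proof.
intros Hf Hc Hm Hd; unfold Rect.
rewrite <- (CI_Chasles (fun s => f (a, s)) c m d), <- (CI_Chasles (fun s => f (b, s)) c m d)
  by (now apply hol_rcont_v).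
ring.
Qed.

(** Nested rectangles: [Q x y s] is a property of the rectangle with lower left corner (x, y) and
    sides w s, h s. It is kept abstract because it serves twice, for Goursat's theorem and for the
    maximum of a continuous function on a box. *)
Lemma bisection (w h : R) (Q : R -> R -> R -> Prop) (x0 y0 : R) :
  0 <= w -> 0 <= h -> Q x0 y0 1 ->
  (forall x y s, 0 < s -> Q x y s ->
     exists x' y', Q x' y' (s / 2) /\
       x <= x' /\ x' + w * (s / 2) <= x + w * s /\
       y <= y' /\ y' + h * (s / 2) <= y + h * s) ->
  exists X Y, x0 <= X <= x0 + w /\ y0 <= Y <= y0 + h /\
   forall eps, 0 < eps -> exists x y s, 0 < s < eps /\ Q x y s /\
     x <= X <= x + w * s /\ y <= Y <= y + h * s /\
     x0 <= x /\ x + w * s <= x0 + w /\ y0 <= y /\ y + h * s <= y0 + h.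
Proof.
intros Hw Hh H0 Hstep.
set (T := {p : R * R * R | 0 < snd p /\ Q (fst (fst p)) (snd (fst p)) (snd p)}).
assert (step : forall p : T, {q : T | let '(x, y, s) := proj1_sig p in
   let '(x', y', s') := proj1_sig q in s' = s / 2 /\
       x <= x' /\ x' + w * (s / 2) <= x + w * s /\
       y <= y' /\ y' + h * (s / 2) <= y + h * s}).
{ intros [[[x y] s] [Hs HQ]]. apply constructive_indefinite_description.
  destruct (Hstep x y s Hs HQ) as (x' & y' & HQ' & H).
  assert (P : 0 < snd (x', y', s / 2) /\ Q (fst (fst (x', y', s/2))) (snd (fst (x', y', s/2))) (snd (x', y', s/2))).
  { simpl in *; split; [lra|exact HQ']. }
  exists (exist _ (x', y', s / 2) P). simpl. auto. }
assert (P0 : 0 < snd (x0, y0, 1) /\ Q (fst (fst (x0, y0, 1))) (snd (fst (x0, y0, 1))) (snd (x0, y0, 1))).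
{ simpl; split; [lra|exact H0]. }
set (seq := fix u (n : nat) : T := match n with O => exist _ (x0, y0, 1) P0
                                   | S n => proj1_sig (step (u n)) end).
set (xs n := fst (fst (proj1_sig (seq n)))).
set (ys n := snd (fst (proj1_sig (seq n)))).
set (ss n := snd (proj1_sig (seq n))).
assert (Hs : forall n, ss (S n) = ss n / 2 /\ xs n <= xs (S n) /\
   xs (S n) + w * ss (S n) <= xs n + w * ss n /\ ys n <= ys (S n) /\
   ys (S n) + h * ss (S n) <= ys n + h * ss n).
{ intros n; unfold xs, ys, ss; simpl. destruct (step (seq n)) as [q Hq]; simpl.
  destruct (proj1_sig (seq n)) as [[x y] s]; destruct (proj1_sig q) as [[x' y'] s']; simpl in *.
  destruct Hq as (-> & Hq). tauto. }
assert (Hss : forall n, ss n = / 2 ^ n).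
{ induction n as [|n IH]; [unfold ss; simpl; lra|].
  rewrite (proj1 (Hs n)), IH; simpl. field. apply pow_nonzero; lra. }
assert (HQn : forall n, Q (xs n) (ys n) (ss n)).
{ intros n; unfold xs, ys, ss. apply (proj2 (proj2_sig (seq n))). }
assert (Hsp : forall n, 0 < ss n).
{ intros n; apply (proj1 (proj2_sig (seq n))). }
assert (x00 : xs O = x0) by reflexivity. assert (y00 : ys O = y0) by reflexivity.
assert (s00 : ss O = 1) by reflexivity.
assert (mx : forall n m, (n <= m)%nat -> xs n <= xs m /\ xs m + w * ss m <= xs n + w * ss n /\
   ys n <= ys m /\ ys m + h * ss m <= ys n + h * ss n).
{ intros n m Hnm; induction Hnm as [|m Hnm IH]; [lra|]. destruct (Hs m); lra. }
clearbody xs ys ss. clear seq step P0 T.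
(* The limit point is the supremum of the lower left corners; every upper right corner bounds them
   from above. *)
destruct (completeness (fun r => exists n, r = xs n)) as [X [HX1 HX2]].
{ exists (x0 + w). intros r [n ->]. destruct (mx O n) as (A & B & _); [lia|].
  specialize (Hsp n). nra. }
{ exists (xs O); now exists O. }
destruct (completeness (fun r => exists n, r = ys n)) as [Y [HY1 HY2]].
{ exists (y0 + h). intros r [n ->]. destruct (mx O n) as (_ & _ & A & B); [lia|].
  specialize (Hsp n). nra. }
{ exists (ys O); now exists O. }
assert (bX : forall n, xs n <= X <= xs n + w * ss n).
{ intros n; split; [apply HX1; now exists n|].
  apply HX2; intros r [m ->]. destruct (Nat.le_ge_cases n m) as [L|L].
  - destruct (mx n m L) as (A & B & _). specialize (Hsp m). nra.
  - destruct (mx m n L) as (A & B & _). specialize (Hsp n). nra. }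
assert (bY : forall n, ys n <= Y <= ys n + h * ss n).
{ intros n; split; [apply HY1; now exists n|].
  apply HY2; intros r [m ->]. destruct (Nat.le_ge_cases n m) as [L|L].
  - destruct (mx n m L) as (_ & _ & A & B). specialize (Hsp m). nra.
  - destruct (mx m n L) as (_ & _ & A & B). specialize (Hsp n). nra. }
exists X, Y. split; [|split].
- specialize (bX O). rewrite x00, s00 in bX. lra.
- specialize (bY O). rewrite y00, s00 in bY. lra.
- intros eps Heps.
  destruct (pow_lt_1_zero (/ 2)) with (y := eps) as [N HN].
  { rewrite Rabs_pos_eq; lra. } { exact Heps. }
  specialize (HN N (le_n N)). rewrite pow_inv in HN.
  exists (xs N), (ys N), (ss N).
  destruct (mx O N) as (A & B & A' & B'); [lia|]. rewrite x00, y00, s00 in *.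
  assert (C1 := bX N). assert (C2 := bY N). assert (C3 := Hsp N).
  assert (ss N < eps).
  { rewrite Hss. eapply Rle_lt_trans; [apply Rle_abs|exact HN]. }
  repeat split; auto; try lra.
Qed.

Lemma Rect_bound f a b c d M : a <= b -> 0 < c <= d ->
  rcontinuous (fun s => f (s, c)) a b -> rcontinuous (fun s => f (s, d)) a b ->
  rcontinuous (fun s => f (a, s)) c d -> rcontinuous (fun s => f (b, s)) c d ->
  (forall x y, a <= x <= b -> c <= y <= d -> Cmod (f (x, y)) <= M) ->
  Cmod (Rect f a b c d) <= 4 * M * ((b - a) + (d - c)).
Proof.
intros Hab Hcd h1 h2 h3 h4 HM.
assert (mI : Cmod Ci = 1).
{ unfold Cmod; simpl. transitivity (sqrt 1); [f_equal; ring|apply sqrt_1]. }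
assert (I1 : Cmod (CI (fun s => f (s, c)) a b) <= 2 * M * Rabs (b - a)).
{ apply CI_bound; auto. intros t Ht; apply HM; [|lra]. now rewrite -> Rmin_left, Rmax_right in Ht by lra. }
assert (I2 : Cmod (CI (fun s => f (s, d)) a b) <= 2 * M * Rabs (b - a)).
{ apply CI_bound; auto. intros t Ht; apply HM; [|lra]. now rewrite -> Rmin_left, Rmax_right in Ht by lra. }
assert (I3 : Cmod (CI (fun s => f (a, s)) c d) <= 2 * M * Rabs (d - c)).
{ apply CI_bound; auto. intros t Ht; apply HM; [lra|]. now rewrite -> Rmin_left, Rmax_right in Ht by lra. }
assert (I4 : Cmod (CI (fun s => f (b, s)) c d) <= 2 * M * Rabs (d - c)).
{ apply CI_bound; auto. intros t Ht; apply HM; [lra|]. now rewrite -> Rmin_left, Rmax_right in Ht by lra. }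
rewrite -> Rabs_pos_eq in I1, I2, I3, I4 by lra.
unfold Rect, Cminus.
eapply Rle_trans; [apply Cmod_triangle|].
eapply Rle_trans; [apply Rplus_le_compat_r, Cmod_triangle|].
eapply Rle_trans; [apply Rplus_le_compat_r, Rplus_le_compat_r, Cmod_triangle|].
rewrite !Cmod_opp, !Cmod_mult, !mI. lra.
Qed.

Lemma rcont_mulI g a b : rcontinuous g a b -> rcontinuous (fun s => Ci * g s)%C a b.
Proof.
intros H t Ht; destruct (H t Ht) as [H1 H2]; split.
- apply (continuous_ext (fun s => opp (snd (g s)))).
  + intros s; unfold opp; simpl; ring.
  + now apply (continuous_opp (V := R_NormedModule)).
- apply (continuous_ext (fun s => fst (g s))); [|exact H1].
  intros s; simpl; ring.
Qed.

Lemma CI_mulI g a b : rcontinuous g a b -> CI (fun s => Ci * g s)%C a b = (Ci * CI g a b)%C.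
Proof.
intros H. unfold CI.
assert (E := RInt_opp (V := R_CompleteNormedModule) _ _ _ (rcont_ex2 _ _ _ H)).
unfold opp in E; simpl in E.
rewrite (RInt_ext (fun s => fst (Ci * g s)%C) (fun s => - snd (g s))).
2:{ intros s _; simpl; ring. }
rewrite (RInt_ext (fun s => snd (Ci * g s)%C) (fun s => fst (g s))).
2:{ intros s _; simpl; ring. }
rewrite E. unfold Cmult, Ci; cbn [fst snd].
assert (alg : forall u v : R, ((- u, v) : C) = (0 * v - 1 * u, 0 * u + 1 * v)).
{ intros; f_equal; ring. }
apply alg.
Qed.

Lemma Rect_primitive f F a b c d :
  (forall z, cderiv F z (f z)) -> holomorphic f -> 0 < c -> 0 < d -> Rect f a b c d = 0.
Proof.
intros HF Hf Hc Hd; unfold Rect.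
assert (Hh : forall y, 0 < y -> CI (fun s => f (s, y)) a b = (F (b, y) - F (a, y))%C).
{ intros y Hy. apply (CI_derive (fun s => F (s, y))).
  - intros t _; apply rderiv_h, HF.
  - now apply hol_rcont_h. }
assert (Hv : forall x, (Ci * CI (fun s => f (x, s)) c d = F (x, d) - F (x, c))%C).
{ intros x. rewrite <- (CI_derive (fun s => F (x, s)) (fun s => Ci * f (x, s))%C).
  - symmetry; apply CI_mulI. now apply hol_rcont_v.
  - intros t _; apply rderiv_v, HF.
  - apply rcont_mulI. now apply hol_rcont_v. }
rewrite !Hh, !Hv by auto. ring.
Qed.

Lemma cderiv_affine (a l z0 z : C) : cderiv (fun x => a + l * (x - z0))%C z l.
Proof.
intros eps Heps; exists 1; split; [lra|]; intros h _.
replace (a + l * (z + h - z0) - (a + l * (z - z0)) - l * h)%C with (RtoC 0) by ring.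
rewrite Cmod_0. apply Rmult_le_pos; [lra|apply Cmod_ge_0].
Qed.

(** One of the four quarters carries at least a quarter of the integral, so nested rectangles of
    size s keep an integral of at least K s^2. Near their common point f is affine up to o(s),
    affine functions have a primitive, and the perimeter is O(s): the integral is o(s^2). *)
Lemma goursat_rect (f : C -> C) (a b c d : R) :
  holomorphic f -> a < b -> 0 < c < d -> Rect f a b c d = 0.
Proof.
intros Hf Hab Hcd. apply Cmod_eq_0. apply NNPP; intros Hne.
set (K := Cmod (Rect f a b c d)) in *.
assert (HK : 0 < K).
{ assert (A := Cmod_ge_0 (Rect f a b c d)). fold K in A. lra. }
set (w := b - a). set (h := d - c).
set (Q x y s := K * (s * s) <= Cmod (Rect f x (x + w * s) y (y + h * s)) /\ 0 < y).
destruct (bisection w h Q a c) as (X & Y & HX & HY & HQ).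
- unfold w; lra.
- unfold h; lra.
- unfold Q. replace (a + w * 1) with b by (unfold w; ring).
  replace (c + h * 1) with d by (unfold h; ring). fold K. lra.
- intros x y s Hs [HQ Hy].
  assert (Hw : 0 < w) by (unfold w; lra). assert (Hh : 0 < h) by (unfold h; lra).
  set (x1 := x + w * (s / 2)). set (y1 := y + h * (s / 2)).
  assert (Hy1 : 0 < y1) by (unfold y1; nra).
  assert (Ex : x + w * s = x1 + w * (s / 2)) by (unfold x1; field).
  assert (Ey : y + h * s = y1 + h * (s / 2)) by (unfold y1; field).
  assert (Hx1 : x <= x1) by (unfold x1; nra). assert (Hyy1 : y <= y1) by (unfold y1; nra).
  apply NNPP; intros Hno.
  assert (N : forall x' y', 0 < y' -> x <= x' -> x' + w * (s / 2) <= x + w * s ->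
       y <= y' -> y' + h * (s / 2) <= y + h * s ->
       Cmod (Rect f x' (x' + w * (s / 2)) y' (y' + h * (s / 2))) < K * (s / 2 * (s / 2))).
  { intros x' y' Hy' p1 p2 p3 p4. apply Rnot_le_lt; intros L. apply Hno.
    exists x', y'. unfold Q. auto. }
  assert (N1 := N x y Hy). assert (N2 := N x1 y Hy).
  assert (N3 := N x y1 Hy1). assert (N4 := N x1 y1 Hy1).
  specialize (N1 ltac:(lra) ltac:(nra) ltac:(lra) ltac:(nra)).
  specialize (N2 ltac:(lra) ltac:(nra) ltac:(lra) ltac:(nra)).
  specialize (N3 ltac:(lra) ltac:(nra) ltac:(lra) ltac:(nra)).
  specialize (N4 ltac:(lra) ltac:(nra) ltac:(lra) ltac:(nra)).
  rewrite Ex, Ey in HQ.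
  assert (Hys : 0 < y1 + h * (s / 2)) by nra.
  rewrite <- (Rect_split_x f x x1 (x1 + w * (s / 2)) y (y1 + h * (s / 2)) Hf Hy Hys) in HQ.
  rewrite <- (Rect_split_y f x x1 y y1 (y1 + h * (s / 2)) Hf Hy Hy1 Hys) in HQ.
  rewrite <- (Rect_split_y f x1 (x1 + w * (s / 2)) y y1 (y1 + h * (s / 2)) Hf Hy Hy1 Hys) in HQ.
  fold x1 in N1, N3. fold y1 in N1, N2.
  assert (T1 := Cmod_triangle (Rect f x x1 y y1 + Rect f x x1 y1 (y1 + h * (s / 2)))%C
     (Rect f x1 (x1 + w * (s / 2)) y y1 + Rect f x1 (x1 + w * (s / 2)) y1 (y1 + h * (s / 2)))%C).
  assert (T2 := Cmod_triangle (Rect f x x1 y y1) (Rect f x x1 y1 (y1 + h * (s / 2)))).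
  assert (T3 := Cmod_triangle (Rect f x1 (x1 + w * (s / 2)) y y1) (Rect f x1 (x1 + w * (s / 2)) y1 (y1 + h * (s / 2)))).
  lra.
- assert (Hup : up (X, Y)) by (unfold up; simpl; lra).
  destruct (Hf _ Hup) as (l & Hl).
  assert (Hw : 0 < w) by (unfold w; lra). assert (Hh : 0 < h) by (unfold h; lra).
  (* Chosen so that [Rect_bound], with error eps (w+h) s and half-perimeter (w+h) s, yields K s^2 /
     2. *)
  set (eps := K / (8 * ((w + h) * (w + h)))).
  assert (Heps : 0 < eps) by (apply Rdiv_lt_0_compat; [lra|]; nra).
  destruct (Hl eps Heps) as (dl & Hdl & HD).
  destruct (HQ (dl / (w + h))) as (x & y & s & Hs & [HQs Hy] & HX' & HY' & _).
  { apply Rdiv_lt_0_compat; lra. }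
  assert (Hsd : (w + h) * s < dl).
  { apply Rlt_le_trans with ((w + h) * (dl / (w + h))); [|right; field; lra].
    apply Rmult_lt_compat_l; lra. }
  set (aff := (fun z => f (X, Y) + l * (z - (X, Y)))%C).
  set (P := (fun z => f (X, Y) * z + (l * / 2) * ((z - (X, Y)) * (z - (X, Y))))%C).
  assert (HP : forall z, cderiv P z (aff z)).
  { intros z. unfold P, aff.
    replace (f (X, Y) + l * (z - (X, Y)))%C with
      (f (X, Y) * 1 + (l * / 2) * (1 * (z - (X, Y)) + (z - (X, Y)) * 1))%C.
    2:{ field. }
    apply (cderiv_plus (fun z => f (X, Y) * z)%C).
    - apply cderiv_scal, cderiv_id.
    - apply (cderiv_scal (l * / 2) (fun z => (z - (X, Y)) * (z - (X, Y)))%C).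
      assert (A : cderiv (fun x => x - (X, Y))%C z 1).
      { replace (RtoC 1) with (1 + 0)%C by ring.
        apply (cderiv_plus (fun x => x) (fun _ => - (X, Y))%C); [apply cderiv_id|apply cderiv_const]. }
      apply (cderiv_mult (fun z => z - (X, Y))%C (fun z => z - (X, Y))%C); exact A. }
  assert (Haff : holomorphic aff).
  { intros z _; exists l. apply cderiv_affine. }
  set (r := (fun z => f z - aff z)%C).
  assert (ws : 0 < w * s) by nra. assert (hs : 0 < h * s) by nra.
  assert (HR : Rect f x (x + w * s) y (y + h * s) = Rect r x (x + w * s) y (y + h * s)).
  { transitivity (Rect f x (x + w * s) y (y + h * s) - Rect aff x (x + w * s) y (y + h * s))%C.
    - rewrite (Rect_primitive aff P) by (auto; lra). ring.
    - unfold Rect, r. rewrite !CI_minus; try (apply hol_rcont_h; auto; lra);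
        try (apply hol_rcont_v; auto; lra). ring. }
  assert (Hb : Cmod (Rect r x (x + w * s) y (y + h * s)) <=
     4 * (eps * ((w + h) * s)) * ((x + w * s - x) + (y + h * s - y))).
  { apply Rect_bound; try lra; unfold r;
      try (apply rcont_minus; (apply hol_rcont_h || apply hol_rcont_v); auto; lra).
    intros x' y' Hx' Hy'.
    set (k := ((x', y') - (X, Y))%C).
    assert (Hk : Cmod k <= (w + h) * s).
    { eapply Rle_trans; [apply Cmod_le_abs|]. unfold k; simpl.
      assert (Rabs (x' + - X) <= w * s) by (apply Rabs_le; lra).
      assert (Rabs (y' + - Y) <= h * s) by (apply Rabs_le; lra). lra. }
    specialize (HD k). replace ((X, Y) + k)%C with ((x', y') : C) in HD.
    2:{ unfold k; apply injective_projections; simpl; ring. }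
    unfold aff. fold k.
    replace (f (x', y') - (f (X, Y) + l * k))%C with (f (x', y') - f (X, Y) - l * k)%C by ring.
    eapply Rle_trans; [apply HD; lra|]. apply Rmult_le_compat_l; lra. }
  rewrite HR in HQs.
  assert (E : 4 * (eps * ((w + h) * s)) * ((x + w * s - x) + (y + h * s - y)) = K / 2 * (s * s)).
  { unfold eps. field. lra. }
  rewrite E in Hb.
  assert (0 < K * (s * s)) by (repeat apply Rmult_lt_0_compat; lra). lra.
Qed.

(** Degenerate and reversed rectangles are included because the primitive has to be compared at
    points lying in any direction from each other; [Rect] changes sign when a pair of opposite sides
    is exchanged. *)
Lemma goursat (f : C -> C) (a b c d : R) :
  holomorphic f -> 0 < c -> 0 < d -> Rect f a b c d = 0.
Proof.
intros Hf Hc Hd.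
assert (K : forall a b c d, 0 < c -> 0 < d -> a < b -> Rect f a b c d = 0).
{ clear a b c d Hc Hd. intros a b c d Hc Hd Hab. destruct (total_order_T c d) as [[H|H]|H].
  - apply goursat_rect; auto.
  - subst d. unfold Rect.
    replace (CI (fun s => f (b, s)) c c) with (RtoC 0).
    2:{ unfold CI; now rewrite !RInt_point. }
    replace (CI (fun s => f (a, s)) c c) with (RtoC 0).
    2:{ unfold CI; now rewrite !RInt_point. }
    ring.
  - replace (Rect f a b c d) with (- Rect f a b d c)%C.
    + rewrite goursat_rect by auto. ring.
    + unfold Rect. rewrite (CI_swap (fun s => f (a, s)) d c), (CI_swap (fun s => f (b, s)) d c) by (apply hol_rcont_v; auto). ring. }
destruct (total_order_T a b) as [[H|H]|H].
- now apply K.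
- subst b. unfold Rect.
  replace (CI (fun s => f (s, c)) a a) with (RtoC 0).
  2:{ unfold CI; now rewrite !RInt_point. }
  replace (CI (fun s => f (s, d)) a a) with (RtoC 0).
  2:{ unfold CI; now rewrite !RInt_point. }
  ring.
- replace (Rect f a b c d) with (- Rect f b a c d)%C.
  + rewrite K by auto. ring.
  + unfold Rect. rewrite (CI_swap (fun s => f (s, c)) b a), (CI_swap (fun s => f (s, d)) b a) by (apply hol_rcont_h; auto). ring.
Qed.

(** * Holomorphic primitives *)

(** The integral of f from the point i, first along the imaginary axis, then horizontally. *)
Definition prim (f : C -> C) (z : C) : C :=
  (Ci * CI (fun s => f (0, s)%R) 1 (snd z) + CI (fun s => f (s, snd z)) 0 (fst z))%C.

(** Goursat on [0,x'] x [y,y'] exchanges the order of the horizontal and the vertical leg, so that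
    the base point drops out. *)
Lemma prim_diff (f : C -> C) (x y x' y' : R) : holomorphic f -> 0 < y -> 0 < y' ->
  (prim f (x', y') - prim f (x, y) =
   CI (fun s => f (s, y)) x x' + Ci * CI (fun s => f (x', s)) y y')%C.
Proof.
intros Hf Hy Hy'. unfold prim; simpl.
assert (G := goursat f 0 x' y y' Hf Hy Hy'). unfold Rect in G.
rewrite <- (CI_Chasles (fun s => f (0, s)) 1 y y') by (apply hol_rcont_v; auto; lra).
rewrite <- (CI_Chasles (fun s => f (s, y)) 0 x x') in G by (apply hol_rcont_h; auto; lra).
revert G.
generalize (CI (fun s => f (0, s)) 1 y) (CI (fun s => f (0, s)) y y')
  (CI (fun s => f (s, y')) 0 x') (CI (fun s => f (s, y)) 0 x) (CI (fun s => f (s, y)) x x')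
  (CI (fun s => f (x', s)) y y').
intros a b c d e g G.
transitivity (e + Ci * g - (d + e + Ci * g - c - Ci * b))%C; [ring|].
rewrite G; ring.
Qed.

Lemma prim_cderiv (f : C -> C) (z : C) : holomorphic f -> up z -> cderiv (prim f) z (f z).
Proof.
intros Hf Hz eps Heps. destruct z as [x y]. unfold up in Hz; simpl in Hz.
destruct (Hf (x, y) Hz) as (l & Hl).
(* [CI_bound] doubles the error on each leg, and |h1| + |h2| is at most 2 |h|: hence eps / 4. The
   same sum explains dl / 2 below, and the bound y keeps y + h2 positive. *)
destruct (cderiv_cont _ _ _ Hl (eps / 4)) as (dl & Hdl & HD); [lra|].
exists (Rmin (dl / 2) y); split; [apply Rmin_pos; lra|].
intros [h1 h2] Hh.
assert (Hh1 := Rlt_le_trans _ _ _ Hh (Rmin_l _ _)).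
assert (Hh2 := Rlt_le_trans _ _ _ Hh (Rmin_r _ _)).
assert (A1 := Rabs_fst_le (h1, h2)). assert (A2 := Rabs_snd_le (h1, h2)). simpl in A1, A2.
assert (Hyh : 0 < y + h2).
{ assert (B := Rle_abs (- h2)). rewrite Rabs_Ropp in B. lra. }
replace ((x, y) + (h1, h2))%C with ((x + h1, y + h2) : C) by reflexivity.
rewrite prim_diff by auto.
assert (Hr1 := hol_rcont_h f y x (x + h1) Hf Hz).
assert (Hr2 := hol_rcont_v f (x + h1) y (y + h2) Hf Hz Hyh).
set (c := f (x, y)) in *.
replace (CI (fun s => f (s, y)) x (x + h1) + Ci * CI (fun s => f ((x + h1)%R, s)) y (y + h2) - c * (h1, h2))%C
 with (CI (fun s => f (s, y) - c)%C x (x + h1)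
      + Ci * CI (fun s => f ((x + h1)%R, s) - c)%C y (y + h2))%C.
2:{ rewrite !CI_minus by (auto; apply rcont_const). rewrite !CI_const.
    replace ((x + h1 - x)%R) with h1 by ring. replace ((y + h2 - y)%R) with h2 by ring.
    replace ((h1, h2) : C) with (h1 + Ci * h2)%C.
    - ring.
    - apply injective_projections; simpl; ring. }
assert (near : forall s t, Rabs s <= Rabs h1 -> Rabs t <= Rabs h2 ->
   Cmod (f ((x + s)%R, (y + t)%R) - c)%C <= eps / 4).
{ intros s t Hs Ht. apply Rlt_le.
  replace ((x + s, y + t) : C) with ((x, y) + (s, t))%C by reflexivity.
  apply HD. eapply Rle_lt_trans; [apply Cmod_le_abs|]. simpl. lra. }
assert (I1 : Cmod (CI (fun s => f (s, y) - c)%C x (x + h1)) <= 2 * (eps / 4) * Rabs (x + h1 - x)).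
{ apply CI_bound.
  - apply rcont_minus; auto. apply rcont_const.
  - intros t Ht. replace ((t, y) : C) with (((x + (t - x))%R, (y + 0)%R) : C) by (f_equal; ring).
    apply near; [|rewrite Rabs_R0; apply Rabs_pos].
    revert Ht. unfold Rmin, Rmax, Rabs; destruct (Rle_dec x (x + h1));
      destruct (Rcase_abs (t - x)); destruct (Rcase_abs h1); lra. }
assert (I2 : Cmod (CI (fun s => f ((x + h1)%R, s) - c)%C y (y + h2)) <= 2 * (eps / 4) * Rabs (y + h2 - y)).
{ apply CI_bound.
  - apply rcont_minus; auto. apply rcont_const.
  - intros t Ht. replace (((x + h1)%R, t) : C) with (((x + h1)%R, (y + (t - y))%R) : C) by (f_equal; ring).
    apply near; [lra|].
    revert Ht. unfold Rmin, Rmax, Rabs; destruct (Rle_dec y (y + h2));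
      destruct (Rcase_abs (t - y)); destruct (Rcase_abs h2); lra. }
assert (mI : Cmod Ci = 1).
{ unfold Cmod; simpl. transitivity (sqrt 1); [f_equal; ring|apply sqrt_1]. }
eapply Rle_trans; [apply Cmod_triangle|]. rewrite Cmod_mult, mI.
replace (x + h1 - x) with h1 in I1 by ring. replace (y + h2 - y) with h2 in I2 by ring.
nra.
Qed.

(** * Cuspidal functions and their primitives *)

Definition periodic (f : C -> C) : Prop := forall z, up z -> f (z + 1)%C = f z.

(** What remains of a cusp form when the behaviour under z -> -1/z is dropped. Unlike modularity,
    these properties pass to a suitable primitive, so they can be iterated. *)
Definition cuspidal (f : C -> C) : Prop :=
  holomorphic f /\ periodic f /\
  forall eps, 0 < eps -> exists Y, 0 < Y /\ forall z, Y < snd z -> Cmod (f z) < eps.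

Lemma periodic_Z (f : C -> C) (x y : R) (n : Z) : periodic f -> 0 < y ->
  f (x + IZR n, y) = f (x, y).
Proof.
intros Hf Hy.
assert (K : forall x, f (x + 1, y) = f (x, y)).
{ intros x'. rewrite <- (Hf (x', y)) by exact Hy. f_equal.
  apply injective_projections; simpl; ring. }
assert (N : forall m : nat, forall x, f (x + INR m, y) = f (x, y)).
{ induction m as [|m IH]; intros x'.
  - simpl. now rewrite Rplus_0_r.
  - rewrite S_INR, <- Rplus_assoc, K. apply IH. }
destruct (Z.le_gt_cases 0 n) as [H|H].
- replace (IZR n) with (INR (Z.to_nat n)); [apply N|].
  now rewrite INR_IZR_INZ, Z2Nat.id.
- rewrite <- (N (Z.to_nat (- n)) (x + IZR n)).
  rewrite INR_IZR_INZ, Z2Nat.id by lia. rewrite opp_IZR. f_equal. f_equal; ring.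
Qed.

Lemma frac_range (x : R) : 0 <= x + IZR (- Int_part x) <= 1.
Proof. destruct (base_Int_part x). rewrite opp_IZR. lra. Qed.

Lemma hol_of_deriv (F f : C -> C) : (forall z, up z -> cderiv F z (f z)) -> holomorphic F.
Proof. intros H z Hz; exists (f z); auto. Qed.

(** In Goursat's theorem on a rectangle of width 1 the vertical sides cancel by periodicity. *)
Lemma mean_const (f : C -> C) (x y d : R) : holomorphic f -> periodic f -> 0 < y -> 0 < d ->
  CI (fun s => f (s, y)) x (x + 1) = CI (fun s => f (s, d)) x (x + 1).
Proof.
intros Hf Hp Hy Hd.
assert (G := goursat f x (x + 1) y d Hf Hy Hd). unfold Rect in G.
assert (E : CI (fun s => f (x + 1, s)) y d = CI (fun s => f (x, s)) y d).
{ assert (P : forall s, Rmin y d < s < Rmax y d -> f (x + 1, s) = f (x, s)).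
  { intros s Hs. apply (periodic_Z f x s 1 Hp).
    eapply Rlt_trans; [|apply Hs]. now apply Rmin_pos. }
  unfold CI. f_equal; apply RInt_ext; intros s Hs; now rewrite P. }
rewrite E in G. revert G.
generalize (CI (fun s => f (s, y)) x (x + 1)) (CI (fun s => f (s, d)) x (x + 1))
  (CI (fun s => f (x, s)) y d). intros a b c G.
transitivity (b + (a + Ci * c - b - Ci * c))%C; [ring|rewrite G; ring].
Qed.

Lemma Cmod_lt_all (z : C) : (forall eps, 0 < eps -> Cmod z <= eps) -> z = 0.
Proof.
intros H. apply Cmod_eq_0. apply Rle_antisym; [|apply Cmod_ge_0].
apply Rnot_lt_le. intros L. specialize (H (Cmod z / 2)). lra.
Qed.

Lemma cuspidal_mean (f : C -> C) (x y : R) : cuspidal f -> 0 < y -> CI (fun s => f (s, y)) x (x + 1) = 0.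
Proof.
intros (Hf & Hp & Hl) Hy. apply Cmod_lt_all. intros eps Heps.
destruct (Hl (eps / 2)) as (Y & HY & H); [lra|].
rewrite (mean_const f x y (Y + 1)) by (auto; lra).
eapply Rle_trans; [apply (CI_bound _ _ _ (eps / 2))|].
- apply hol_rcont_h; auto; lra.
- intros t _. apply Rlt_le, H. simpl; lra.
- replace (x + 1 - x) with 1 by ring. rewrite Rabs_R1. lra.
Qed.

Lemma CI_point g a : CI g a a = 0.
Proof. unfold CI; now rewrite !RInt_point. Qed.

(** [prim f] is periodic because f has mean 0 over a period. Subtracting its own mean c makes it
    tend to 0: its value at (x, y) is then the average over s of the differences [prim f (x, y)] -
    [prim f (s, y)], which are integrals of f at height y over paths of length at most 1. *)
Lemma cuspidal_prim (f : C -> C) : cuspidal f ->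
  exists F, cuspidal F /\ forall z, up z -> cderiv F z (f z).
Proof.
intros Hf. assert (HPP := Hf). destruct Hf as (Hh & Hp & Hl).
assert (D0 : forall z, up z -> cderiv (prim f) z (f z)).
{ intros z Hz; now apply prim_cderiv. }
assert (H0 := hol_of_deriv _ _ D0).
assert (P0 : periodic (prim f)).
{ intros [x y] Hz. unfold up in Hz; simpl in Hz.
  replace ((x, y) + 1)%C with ((x + 1, y) : C) by (apply injective_projections; simpl; ring).
  assert (E := prim_diff f x y (x + 1) y Hh Hz Hz).
  rewrite cuspidal_mean, CI_point in E by auto.
  transitivity (prim f (x, y) + (prim f ((x + 1)%R, y) - prim f (x, y)))%C; [ring|].
  rewrite E. ring. }
set (c := CI (fun s => prim f (s, 1)) 0 1).
exists (fun z => prim f z - c)%C.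
assert (D : forall z, up z -> cderiv (fun z => prim f z - c)%C z (f z)).
{ intros z Hz. replace (f z) with (f z + 0)%C by ring.
  apply (cderiv_plus (prim f) (fun _ => - c)%C); [now apply D0|apply cderiv_const]. }
split; [|exact D]. split; [exact (hol_of_deriv _ _ D)|]. split.
{ intros z Hz. now rewrite P0. }
(* Two nested uses of [CI_bound] multiply this by 4, leaving eps / 2. *)
intros eps Heps. destruct (Hl (eps / 8)) as (Y & HY & H); [lra|].
exists Y; split; [exact HY|]. intros [x0 y] Hy; simpl in Hy.
assert (Hy0 : 0 < y) by lra.
set (x := x0 + IZR (- Int_part x0)). assert (Hx := frac_range x0). fold x in Hx.
rewrite <- (periodic_Z (prim f) x0 y (- Int_part x0)) by auto. fold x.
assert (Ec : c = CI (fun s => prim f (s, y)) 0 1).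
{ unfold c. assert (E := mean_const (prim f) 0 1 y H0 P0 Rlt_0_1 Hy0).
  now rewrite Rplus_0_l in E. }
assert (Hr := hol_rcont_h (prim f) y 0 1 H0 Hy0).
replace (prim f (x, y) - c)%C with (CI (fun s => prim f (x, y) - prim f (s, y))%C 0 1).
2:{ rewrite (CI_minus (fun _ => prim f (x, y))) by (auto; apply rcont_const).
    rewrite CI_const, <- Ec. rewrite Rminus_0_r. ring. }
eapply Rle_lt_trans; [apply (CI_bound _ _ _ (2 * (eps / 8)))|].
- apply (rcont_minus (fun _ => prim f (x, y))); auto. apply rcont_const.
- intros t Ht. rewrite -> Rmin_left, Rmax_right in Ht by lra.
  rewrite prim_diff, CI_point by auto.
  replace (CI (fun s => f (s, y)) t x + Ci * 0)%C with (CI (fun s => f (s, y)) t x) by ring.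
  eapply Rle_trans; [apply (CI_bound _ _ _ (eps / 8))|].
  + now apply hol_rcont_h.
  + intros s _. apply Rlt_le, H. exact Hy.
  + assert (Rabs (x - t) <= 1) by (apply Rabs_le; lra). nra.
- rewrite Rminus_0_r, Rabs_R1. lra.
Qed.

(** * Maxima, derivative tests and decay *)

(** By bisection: [Q] says that every value on the box is dominated by a value on the sub-box. If
    all four quarters failed, the largest of the four counterexamples would have no dominating point
    in their union. *)
Lemma box_max (B : R -> R -> R) (x0 y0 w h : R) : 0 < w -> 0 < h ->
  (forall x y, x0 <= x <= x0 + w -> y0 <= y <= y0 + h ->
     forall eps, 0 < eps -> exists delta, 0 < delta /\
       forall x' y', Rabs (x' - x) < delta -> Rabs (y' - y) < delta ->
         Rabs (B x' y' - B x y) < eps) ->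
  exists X Y, x0 <= X <= x0 + w /\ y0 <= Y <= y0 + h /\
    forall x y, x0 <= x <= x0 + w -> y0 <= y <= y0 + h -> B x y <= B X Y.
Proof.
intros Hw Hh HB.
set (Q x y s := forall u v, x0 <= u <= x0 + w -> y0 <= v <= y0 + h ->
   exists u' v', x <= u' <= x + w * s /\ y <= v' <= y + h * s /\ B u v <= B u' v').
destruct (bisection w h Q x0 y0) as (X & Y & HX & HY & HQ); try lra.
- intros u v Hu Hv. exists u, v. lra.
- intros x y s Hs HQ. apply NNPP; intros Hno.
  set (x1 := x + w * (s / 2)). set (y1 := y + h * (s / 2)).
  assert (ws : 0 < w * (s / 2)) by nra. assert (hs : 0 < h * (s / 2)) by nra.
  assert (Ew : w * s = w * (s / 2) + w * (s / 2)) by field.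
  assert (Eh : h * s = h * (s / 2) + h * (s / 2)) by field.
  assert (N : forall x' y', x <= x' -> x' + w * (s / 2) <= x + w * s ->
     y <= y' -> y' + h * (s / 2) <= y + h * s ->
     exists u v, x0 <= u <= x0 + w /\ y0 <= v <= y0 + h /\
       forall u' v', x' <= u' <= x' + w * (s / 2) -> y' <= v' <= y' + h * (s / 2) -> B u' v' < B u v).
  { intros x' y' p1 p2 p3 p4. apply NNPP; intros Hn. apply Hno. exists x', y'.
    split; [|auto]. intros u v Hu Hv. apply NNPP; intros Hn2. apply Hn. exists u, v.
    split; [exact Hu|split; [exact Hv|]]. intros u' v' Hu' Hv'. apply Rnot_le_lt; intros L.
    apply Hn2. exists u', v'; auto. }
  destruct (N x y) as (u1 & v1 & a1 & b1 & N1); try lra.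
  destruct (N x1 y) as (u2 & v2 & a2 & b2 & N2); try (unfold x1; lra).
  destruct (N x y1) as (u3 & v3 & a3 & b3 & N3); try (unfold y1; lra).
  destruct (N x1 y1) as (u4 & v4 & a4 & b4 & N4); try (unfold x1, y1; lra).
  assert (M : exists u v, x0 <= u <= x0 + w /\ y0 <= v <= y0 + h /\
     B u1 v1 <= B u v /\ B u2 v2 <= B u v /\ B u3 v3 <= B u v /\ B u4 v4 <= B u v).
  { destruct (Rle_dec (B u1 v1) (B u2 v2)), (Rle_dec (B u3 v3) (B u4 v4)).
    - destruct (Rle_dec (B u2 v2) (B u4 v4)); [exists u4, v4|exists u2, v2]; repeat split; lra.
    - destruct (Rle_dec (B u2 v2) (B u3 v3)); [exists u3, v3|exists u2, v2]; repeat split; lra.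
    - destruct (Rle_dec (B u1 v1) (B u4 v4)); [exists u4, v4|exists u1, v1]; repeat split; lra.
    - destruct (Rle_dec (B u1 v1) (B u3 v3)); [exists u3, v3|exists u1, v1]; repeat split; lra. }
  destruct M as (u & v & Hu & Hv & M1 & M2 & M3 & M4).
  destruct (HQ u v Hu Hv) as (u' & v' & Hu' & Hv' & L).
  destruct (Rle_dec u' x1) as [c1|c1], (Rle_dec v' y1) as [c2|c2].
  + specialize (N1 u' v'). unfold x1, y1 in *. lra.
  + specialize (N3 u' v'). unfold x1, y1 in *. lra.
  + specialize (N2 u' v'). unfold x1, y1 in *. lra.
  + specialize (N4 u' v'). unfold x1, y1 in *. lra.
- exists X, Y. split; [exact HX|split; [exact HY|]]. intros u v Hu Hv.
  apply Rnot_lt_le; intros L.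
  destruct (HB X Y HX HY (B u v - B X Y)) as (d & Hd & HD); [lra|].
  destruct (HQ (d / (w + h))) as (x & y & s & Hs & Hq & bX & bY & _).
  { apply Rdiv_lt_0_compat; lra. }
  destruct (Hq u v Hu Hv) as (u' & v' & Hu' & Hv' & L').
  assert (Hsd : (w + h) * s < d).
  { apply Rlt_le_trans with ((w + h) * (d / (w + h))); [|right; field; lra].
    apply Rmult_lt_compat_l; lra. }
  assert (0 < w * s) by nra. assert (0 < h * s) by nra.
  specialize (HD u' v').
  assert (A : Rabs (B u' v' - B X Y) < B u v - B X Y).
  { apply HD; apply Rabs_def1; lra. }
  assert (A' := Rle_abs (B u' v' - B X Y)). lra.
Qed.

Lemma first_test (phi : R -> R) (t0 a d : R) : 0 < d -> is_derive phi t0 a ->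
  (forall t, Rabs (t - t0) < d -> phi t <= phi t0) -> a = 0.
Proof.
intros Hd Ha Hm. apply is_derive_Reals in Ha.
set (pr := exist (fun l => derivable_pt_abs phi t0 l) a Ha : derivable_pt phi t0).
assert (E : derive_pt phi t0 pr = 0).
{ apply (deriv_maximum phi (t0 - d) (t0 + d)); try lra.
  intros x H1 H2. apply Hm. apply Rabs_def1; lra. }
exact E.
Qed.

(** Since [dphi t0] = 0, a positive second derivative would make [dphi] positive just to the right
    of t0; the mean value theorem then exceeds the maximum. *)
Lemma second_test (phi dphi : R -> R) (t0 a d : R) : 0 < d ->
  (forall t, Rabs (t - t0) < d -> is_derive phi t (dphi t)) ->
  is_derive dphi t0 a ->
  (forall t, Rabs (t - t0) < d -> phi t <= phi t0) -> a <= 0.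
Proof.
intros Hd H1 H2 Hm. apply Rnot_lt_le; intros Ha.
assert (E0 : dphi t0 = 0).
{ apply (first_test phi t0 _ d Hd); auto. apply H1. rewrite Rminus_diag, Rabs_R0; lra. }
apply is_derive_Reals in H2. destruct (H2 (a / 2)) as [e He]; [lra|].
set (h := Rmin e d / 2). assert (Hmin : 0 < Rmin e d) by (apply Rmin_pos; [apply cond_pos|lra]).
assert (L1 := Rmin_l e d). assert (L2 := Rmin_r e d).
destruct (MVT_cor2 phi dphi t0 (t0 + h)) as (c & E & Hc).
- unfold h; lra.
- intros t Ht. apply is_derive_Reals, H1. unfold h in Ht. apply Rabs_def1; lra.
- unfold h in Hc.
  assert (Hh : Rabs (c - t0) < e) by (apply Rabs_def1; lra).
  specialize (He (c - t0) ltac:(lra) Hh).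
  replace (t0 + (c - t0)) with c in He by ring. rewrite E0 in He.
  apply Rabs_def2 in He. rewrite Rminus_0_r in He.
  assert (P : a / 2 < dphi c / (c - t0)) by lra.
  assert (P2 : 0 < dphi c).
  { replace (dphi c) with (dphi c / (c - t0) * (c - t0)) by (field; lra).
    apply Rmult_lt_0_compat; lra. }
  assert (M := Hm (t0 + h)).
  assert (M2 : phi (t0 + h) <= phi t0) by (apply M; unfold h; apply Rabs_def1; lra).
  assert (0 < dphi c * (t0 + h - t0)) by (apply Rmult_lt_0_compat; unfold h; lra).
  lra.
Qed.

Definition dot (u v : C) : R := fst u * fst v + snd u * snd v.

Lemma dot_Cmod (u : C) : dot u u = Cmod u * Cmod u.
Proof. unfold dot, Cmod. rewrite sqrt_sqrt; [simpl; ring|]. nra. Qed.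

Lemma is_derive_Rmult (f g : R -> R) (x a b : R) :
  is_derive f x a -> is_derive g x b -> is_derive (fun t => f t * g t) x (a * g x + f x * b).
Proof. intros Hf Hg. apply (is_derive_mult f g); auto. intros; apply Rmult_comm. Qed.

Lemma is_derive_Rplus (f g : R -> R) (x a b : R) :
  is_derive f x a -> is_derive g x b -> is_derive (fun t => f t + g t) x (a + b).
Proof. intros Hf Hg. now apply (is_derive_plus f g). Qed.

Lemma rderiv_dot (g h : R -> C) (t : R) (l k : C) : rderiv g t l -> rderiv h t k ->
  is_derive (fun s => dot (g s) (h s)) t (dot l (h t) + dot (g t) k).
Proof.
intros [g1 g2] [h1 h2]. unfold dot.
replace (fst l * fst (h t) + snd l * snd (h t) + (fst (g t) * fst k + snd (g t) * snd k))
 with ((fst l * fst (h t) + fst (g t) * fst k) + (snd l * snd (h t) + snd (g t) * snd k)) by ring.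
apply is_derive_Rplus; now apply is_derive_Rmult.
Qed.

Lemma rderiv_mulI (g : R -> C) (t : R) (l : C) : rderiv g t l ->
  rderiv (fun s => Ci * g s)%C t (Ci * l)%C.
Proof.
intros [g1 g2]; split.
- apply (is_derive_ext (fun s => opp (snd (g s)))); [intros; unfold opp; simpl; ring|].
  replace (fst (Ci * l)%C) with (opp (snd l)) by (unfold opp; simpl; ring).
  now apply (is_derive_opp (fun s => snd (g s))).
- apply (is_derive_ext (fun s => fst (g s))); [intros; simpl; ring|].
  now replace (snd (Ci * l)%C) with (fst l) by (simpl; ring).
Qed.

Lemma is_derive_eqv (f : R -> R) (x a b : R) : is_derive f x a -> a = b -> is_derive f x b.
Proof. now intros H <-. Qed.

Lemma cont_box (f : C -> C) (x y : R) (l : C) : cderiv f (x, y) l ->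
  forall eps, 0 < eps -> exists delta, 0 < delta /\ forall x' y', Rabs (x' - x) < delta -> Rabs (y' - y) < delta ->
      Cmod (f (x', y') - f (x, y))%C < eps.
Proof.
intros Hf eps Heps. destruct (cderiv_cont _ _ _ Hf eps Heps) as (d & Hd & H).
exists (d / 2); split; [lra|]. intros x' y' Hx Hy.
replace ((x', y') : C) with ((x, y) + ((x' - x)%R, (y' - y)%R))%C
  by (apply injective_projections; simpl; ring).
apply H. eapply Rle_lt_trans; [apply Cmod_le_abs|]. simpl. lra.
Qed.

Definition cont2 (B : R -> R -> R) (x y : R) : Prop :=
  forall eps, 0 < eps -> exists delta, 0 < delta /\ forall x' y', Rabs (x' - x) < delta -> Rabs (y' - y) < delta ->
      Rabs (B x' y' - B x y) < eps.

Lemma cont2_continuous (B : R -> R -> R) (x y : R) :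
  cont2 B x y <-> continuous (fun p : R * R => B (fst p) (snd p)) (x, y).
Proof.
split.
- intros H. apply (filterlim_locally (fun p : R * R => B (fst p) (snd p))). intros [e He].
  destruct (H e He) as (d & Hd & K). exists (mkposreal d Hd). intros [x' y'] [b1 b2].
  simpl in *. apply K; [exact b1|exact b2].
- intros H e He. destruct (proj1 (filterlim_locally (fun p : R * R => B (fst p) (snd p)) _) H (mkposreal e He)) as [d Hd].
  exists d; split; [apply cond_pos|]. intros x' y' b1 b2. apply (Hd (x', y')). split; [exact b1|exact b2].
Qed.

Lemma cont2_plus A B x y : cont2 A x y -> cont2 B x y -> cont2 (fun u v => A u v + B u v) x y.
Proof.
rewrite !cont2_continuous; intros H1 H2.
now apply (continuous_plus (fun p : R * R => A (fst p) (snd p)) (fun p => B (fst p) (snd p))).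
Qed.

Lemma cont2_mult A B x y : cont2 A x y -> cont2 B x y -> cont2 (fun u v => A u v * B u v) x y.
Proof.
rewrite !cont2_continuous; intros H1 H2.
now apply (continuous_mult (fun p : R * R => A (fst p) (snd p)) (fun p => B (fst p) (snd p))).
Qed.

Lemma cont2_const c x y : cont2 (fun _ _ => c) x y.
Proof. rewrite cont2_continuous. apply continuous_const. Qed.

Lemma cont2_snd (g : R -> R) x y : continuous g y -> cont2 (fun _ v => g v) x y.
Proof.
rewrite cont2_continuous; intros H. apply (continuous_comp snd g); [apply continuous_snd|exact H].
Qed.

Lemma cont2_Re (f : C -> C) x y l : cderiv f (x, y) l -> cont2 (fun u v => fst (f (u, v))) x y.
Proof.
intros H e He. destruct (cont_box _ _ _ _ H e He) as (d & Hd & K). exists d; split; [exact Hd|].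
intros x' y' h1 h2. eapply Rle_lt_trans; [|apply (K x' y' h1 h2)].
apply (Rabs_fst_le (f (x', y') - f (x, y))%C).
Qed.

Lemma cont2_Im (f : C -> C) x y l : cderiv f (x, y) l -> cont2 (fun u v => snd (f (u, v))) x y.
Proof.
intros H e He. destruct (cont_box _ _ _ _ H e He) as (d & Hd & K). exists d; split; [exact Hd|].
intros x' y' h1 h2. eapply Rle_lt_trans; [|apply (K x' y' h1 h2)].
apply (Rabs_snd_le (f (x', y') - f (x, y))%C).
Qed.

Lemma cont2_dot (f : C -> C) x y l : cderiv f (x, y) l -> cont2 (fun u v => dot (f (u, v)) (f (u, v))) x y.
Proof.
intros H. apply cont2_plus; apply cont2_mult; solve [eapply cont2_Re; eassumption|eapply cont2_Im; eassumption].
Qed.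

(* Bernstein's trick: eta^2 |f|^2 + A |F|^2 is subharmonic for a suitable A,
   where eta is a cut-off in the strip. *)
Lemma gradient_bound (F f g : C -> C) (y0 M : R) :
  (forall z, up z -> cderiv F z (f z)) -> (forall z, up z -> cderiv f z (g z)) -> holomorphic g ->
  periodic F -> periodic f -> 0 < y0 ->
  (forall x y, y0 / 2 <= y <= 3 * y0 / 2 -> Cmod (F (x, y)) <= M) ->
  forall x, Cmod (f (x, y0)) <= 4 / y0 * M.
Proof.
intros HF Hf Hg F_cuspidal Pf Hy0 HM x.
set (r := y0 / 2). assert (Hr : 0 < r) by (unfold r; lra).
(* Makes 4 A = 16 / r^2 beat 2 eta'^2 + 4 eta / r^2, which is at most 12 / r^2 on the strip. Its
   square root 2 / r is the constant 4 / y0 of the conclusion. *)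
set (A := 4 / (r * r)). assert (HA : 0 < A) by (apply Rdiv_lt_0_compat; nra).
set (eta y := 1 - ((y - y0) / r) * ((y - y0) / r)).
set (B u v := (eta v * eta v) * dot (f (u, v)) (f (u, v)) + A * dot (F (u, v)) (F (u, v))).
assert (deta : forall y, is_derive eta y (- 2 * (y - y0) / (r * r))).
{ intros y. unfold eta. auto_derive; [auto|]. field; lra. }
destruct (box_max B 0 (y0 / 2) 1 y0) as (X & Y & HX & HY & Hmax); try lra.
{ intros u v Hu Hv. assert (Hup : up (u, v)) by (unfold up; simpl; lra).
  apply cont2_plus; apply cont2_mult.
  - assert (K : cont2 (fun _ w => eta w) u v).
    { apply cont2_snd. apply (ex_derive_continuous eta). eexists; apply deta. }
    now apply cont2_mult.
  - exact (cont2_dot f u v _ (Hf _ Hup)).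
  - apply cont2_const.
  - exact (cont2_dot F u v _ (HF _ Hup)). }
assert (HM0 : 0 <= M).
{ eapply Rle_trans; [apply Cmod_ge_0|apply (HM 0 y0); lra]. }
assert (Bper : forall u v, y0 / 2 <= v <= 3 * y0 / 2 -> B u v <= B X Y).
{ intros u v Hv. assert (E : B u v = B (u + IZR (- Int_part u)) v).
  { unfold B. rewrite !periodic_Z by (auto; lra). reflexivity. }
  rewrite E. apply Hmax; [assert (K := frac_range u); lra|lra]. }
assert (FXY : A * dot (F (X, Y)) (F (X, Y)) <= A * (M * M)).
{ apply Rmult_le_compat_l; [lra|]. rewrite dot_Cmod.
  apply Rmult_le_compat; try apply Cmod_ge_0; apply HM; lra. }
(* Either the term with [eta] vanishes at the maximum, as on the edges of the strip, and only A
   |F|^2 is left; or the maximum is interior, which the second derivative tests in x and y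
   refute. *)
assert (key : B X Y <= A * (M * M)).
{ destruct (Req_dec (eta Y * eta Y * dot (f (X, Y)) (f (X, Y))) 0) as [E0|E0].
  { unfold B. lra. }
  exfalso.
  assert (Hf0 : 0 < dot (f (X, Y)) (f (X, Y))).
  { destruct (Rle_lt_or_eq_dec 0 (dot (f (X, Y)) (f (X, Y)))) as [L|L]; auto.
    - rewrite dot_Cmod. apply Rmult_le_pos; apply Cmod_ge_0.
    - rewrite <- L in E0. lra. }
  set (tau := (Y - y0) / r).
  assert (Ht : -1 <= tau <= 1).
  { unfold tau; split.
    - apply Rmult_le_reg_r with r; [lra|]. field_simplify; unfold r in *; lra.
    - apply Rmult_le_reg_r with r; [lra|]. field_simplify; unfold r in *; lra. }
  assert (Eeta : eta Y = 1 - tau * tau) by reflexivity.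
  assert (Ht1 : tau * tau < 1).
  { apply Rnot_le_lt; intros L. apply E0. rewrite Eeta.
    replace (tau * tau) with 1 by nra. ring. }
  assert (HYi : y0 / 2 < Y < 3 * y0 / 2).
  { assert (-1 < tau < 1) by nra. assert (EY : Y = y0 + tau * r) by (unfold tau; field; lra).
    unfold r in EY. nra. }
  set (d := Rmin (Y - y0 / 2) (3 * y0 / 2 - Y)).
  assert (Hd : 0 < d) by (apply Rmin_pos; lra).
  assert (Hd1 : d <= Y - y0 / 2) by apply Rmin_l.
  assert (Hd2 : d <= 3 * y0 / 2 - Y) by apply Rmin_r.
  assert (HupY : up (X, Y)) by (unfold up; simpl; lra).
  destruct (Hg _ HupY) as (k & Hk).
  assert (upx : forall s, up (s, Y)) by (intros s; unfold up; simpl; lra).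
  assert (upy : forall s, Rabs (s - Y) < d -> up (X, s)).
  { intros s Hs. apply Rabs_def2 in Hs. unfold up; simpl; lra. }
  assert (Fx : forall s, rderiv (fun s => F (s, Y)) s (f (s, Y))).
  { intros s; apply rderiv_h, HF, upx. }
  assert (fx : forall s, rderiv (fun s => f (s, Y)) s (g (s, Y))).
  { intros s; apply rderiv_h, Hf, upx. }
  assert (gx : rderiv (fun s => g (s, Y)) X k) by (now apply rderiv_h).
  assert (T1 : eta Y * eta Y * (2 * (dot (g (X, Y)) (g (X, Y)) + dot (f (X, Y)) k))
       + A * (2 * (dot (f (X, Y)) (f (X, Y)) + dot (F (X, Y)) (g (X, Y)))) <= 0).
  { apply (second_test (fun s => B s Y)
    (fun s => eta Y * eta Y * (2 * dot (f (s, Y)) (g (s, Y))) + A * (2 * dot (F (s, Y)) (f (s, Y))))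
    X _ 1 Rlt_0_1).
    - intros t _. eapply is_derive_eqv.
      + apply is_derive_Rplus; (apply is_derive_Rmult; [apply is_derive_const|]); apply rderiv_dot;
        [apply fx|apply fx|apply Fx|apply Fx].
      + unfold zero, dot; simpl. ring.
    - eapply is_derive_eqv.
      + apply is_derive_Rplus; (apply is_derive_Rmult; [apply is_derive_const|]);
        (apply is_derive_Rmult; [apply is_derive_const|]); apply rderiv_dot;
        [apply fx|apply gx|apply Fx|apply fx].
      + unfold zero, dot; simpl. ring.
    - intros t _. apply Bper. lra. }
  assert (Fy : forall s, Rabs (s - Y) < d -> rderiv (fun s => F (X, s)) s (Ci * f (X, s))%C).
  { intros s Hs; apply rderiv_v, HF, upy, Hs. }
  assert (fy : forall s, Rabs (s - Y) < d -> rderiv (fun s => f (X, s)) s (Ci * g (X, s))%C).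
  { intros s Hs; apply rderiv_v, Hf, upy, Hs. }
  assert (gy : rderiv (fun s => Ci * g (X, s))%C Y (Ci * (Ci * k))%C).
  { apply rderiv_mulI. now apply rderiv_v. }
  set (de y := - 2 * (y - y0) / (r * r)).
  assert (dde : is_derive de Y (- 2 / (r * r))).
  { unfold de. auto_derive; [auto|]. field; lra. }
  assert (hY : Rabs (Y - Y) < d) by (rewrite Rminus_diag, Rabs_R0; lra).
  assert (T2 : 2 * (de Y * de Y + eta Y * (- 2 / (r * r))) * dot (f (X, Y)) (f (X, Y))
       + 8 * (eta Y * de Y) * dot (f (X, Y)) (Ci * g (X, Y))%C
       + eta Y * eta Y * (2 * (dot (Ci * g (X, Y))%C (Ci * g (X, Y))%C + dot (f (X, Y)) (Ci * (Ci * k))%C))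
       + A * (2 * (dot (Ci * f (X, Y))%C (Ci * f (X, Y))%C + dot (F (X, Y)) (Ci * (Ci * g (X, Y)))%C)) <= 0).
  { apply (second_test (fun s => B X s)
    (fun s => (2 * (eta s * de s)) * dot (f (X, s)) (f (X, s))
       + (eta s * eta s) * (2 * dot (f (X, s)) (Ci * g (X, s))%C)
       + A * (2 * dot (F (X, s)) (Ci * f (X, s))%C)) Y _ d Hd).
    - intros t Hts. eapply is_derive_eqv.
      + apply is_derive_Rplus; apply is_derive_Rmult.
        * apply is_derive_Rmult; apply deta.
        * apply rderiv_dot; now apply fy.
        * apply is_derive_const.
        * apply rderiv_dot; now apply Fy.
      + unfold zero, dot, de; simpl. ring.
    - eapply is_derive_eqv.
      + apply is_derive_Rplus; [apply is_derive_Rplus|]; apply is_derive_Rmult.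
        * apply is_derive_Rmult; [apply is_derive_const|].
          apply is_derive_Rmult; [apply deta|apply dde].
        * apply rderiv_dot; now apply fy.
        * apply is_derive_Rmult; apply deta.
        * apply is_derive_Rmult; [apply is_derive_const|].
          apply rderiv_dot; [now apply fy|apply gy].
        * apply is_derive_const.
        * apply is_derive_Rmult; [apply is_derive_const|].
          apply rderiv_dot; [now apply Fy|apply rderiv_mulI; now apply fy].
      + unfold zero, dot, de; simpl. ring.
    - intros t Hts. apply Bper. apply Rabs_def2 in Hts. lra. }
  set (f1 := fst (f (X, Y))) in *. set (f2 := snd (f (X, Y))) in *.
  set (g1 := fst (g (X, Y))) in *. set (g2 := snd (g (X, Y))) in *.
  (* The sum of the two tests. The second derivatives of f and F cancel by harmonicity, and the
     mixed term completes the square |eta i g + eta' f|^2. *)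
  assert (S : 4 * ((eta Y * - g2 + de Y * f1) * (eta Y * - g2 + de Y * f1)
                 + (eta Y * g1 + de Y * f2) * (eta Y * g1 + de Y * f2))
     + (4 * A - 2 * (de Y * de Y) - 4 * eta Y / (r * r)) * (f1 * f1 + f2 * f2) <= 0).
  { assert (T := Rplus_le_compat _ 0 _ 0 T1 T2). rewrite Rplus_0_r in T.
    eapply Rle_trans; [|exact T].
    right. unfold dot; simpl. fold f1 f2 g1 g2. field. lra. }
  assert (Sq : 0 <= 4 * ((eta Y * - g2 + de Y * f1) * (eta Y * - g2 + de Y * f1)
                 + (eta Y * g1 + de Y * f2) * (eta Y * g1 + de Y * f2))) by (apply Rmult_le_pos; [lra|]; apply Rplus_le_le_0_compat; apply Rle_0_sqr).
  assert (Pos : 0 < 4 * A - 2 * (de Y * de Y) - 4 * eta Y / (r * r)).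
  { replace (4 * A - 2 * (de Y * de Y) - 4 * eta Y / (r * r)) with
      ((16 - 8 * (tau * tau) - 4 * (1 - tau * tau)) / (r * r)).
    - apply Rdiv_lt_0_compat; nra.
    - rewrite Eeta. unfold A, de, tau. field. lra. }
  unfold dot in Hf0. fold f1 f2 in Hf0.
  assert (0 < (4 * A - 2 * (de Y * de Y) - 4 * eta Y / (r * r)) * (f1 * f1 + f2 * f2))
    by (apply Rmult_lt_0_compat; assumption).
  lra. }
assert (Bx : B x y0 <= A * (M * M)).
{ eapply Rle_trans; [apply Bper; lra|exact key]. }
assert (Ey0 : eta y0 = 1) by (unfold eta; field; lra).
assert (P1 : Cmod (f (x, y0)) * Cmod (f (x, y0)) <= A * (M * M)).
{ unfold B in Bx. rewrite Ey0, !dot_Cmod in Bx.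
  assert (0 <= A * (Cmod (F (x, y0)) * Cmod (F (x, y0)))).
  { apply Rmult_le_pos; [lra|]. apply Rmult_le_pos; apply Cmod_ge_0. }
  lra. }
replace (A * (M * M)) with ((4 / y0 * M) * (4 / y0 * M)) in P1 by (unfold A, r; field; lra).
assert (0 <= 4 / y0 * M).
{ apply Rmult_le_pos; [|exact HM0]. apply Rlt_le, Rdiv_lt_0_compat; lra. }
apply Rnot_lt_le; intros L. assert (C0 := Cmod_ge_0 (f (x, y0))). nra.
Qed.

(** The induction goes through a primitive F of f: if F is O(y^-N), [gradient_bound] on the strip
    around height y gives its derivative f one more factor 1/y. This replaces exponential decay read
    off from a q-expansion. *)
Lemma decay (N : nat) : forall f g, cuspidal f -> cuspidal g -> (forall z, up z -> cderiv f z (g z)) ->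
  exists K Y, 0 < Y /\ 0 <= K /\ forall z, Y < snd z -> Cmod (f z) * snd z ^ N <= K.
Proof.
induction N as [|N IH]; intros f g Hf Hg Hfg.
- destruct Hf as (_ & _ & Hl). destruct (Hl 1 Rlt_0_1) as (Y & HY & H).
  exists 1, Y. split; [exact HY|split; [lra|]]. intros z Hz. simpl. specialize (H z Hz). lra.
- destruct (cuspidal_prim f Hf) as (F & HF & DF).
  destruct (IH F f HF Hf DF) as (K & Y & HY & HK & H).
  (* The estimate at height y uses F at heights down to y / 2, hence 2 Y and 2^N; the 4 is that of
     [gradient_bound]. *)
  exists (4 * (K * 2 ^ N)), (2 * Y). assert (P2 : 0 < 2 ^ N) by (apply pow_lt; lra).
  split; [lra|split]. { apply Rmult_le_pos; [lra|]. apply Rmult_le_pos; lra. }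
  intros [x y] Hy; simpl in Hy. simpl snd.
  assert (py : 0 < (y / 2) ^ N) by (apply pow_lt; lra).
  assert (G := gradient_bound F f g y (K / (y / 2) ^ N)).
  assert (G1 : Cmod (f (x, y)) <= 4 / y * (K / (y / 2) ^ N)).
  { apply G; auto; try apply HF; try apply Hf; try apply Hg; try lra.
    intros x' y' Hy'. specialize (H (x', y')). simpl in H.
    apply Rmult_le_reg_r with ((y / 2) ^ N); [exact py|].
    replace (K / (y / 2) ^ N * (y / 2) ^ N) with K by (field; lra).
    eapply Rle_trans; [|apply H; lra].
    apply Rmult_le_compat_l; [apply Cmod_ge_0|]. apply pow_incr; lra. }
  apply Rle_trans with (4 / y * (K / (y / 2) ^ N) * y ^ S N).
  + apply Rmult_le_compat_r; [|exact G1]. apply pow_le; lra.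
  + right. unfold Rdiv at 3. rewrite Rpow_mult_distr, pow_inv. simpl.
    assert (0 < y ^ N) by (apply pow_lt; lra). field. repeat split; try lra.
Qed.

(** * The maximum principle for invariant functions *)

(** [X] and [Y] are Phi along the horizontal and vertical lines through a maximum of |Phi|^2 / y^n,
    at height y1 and with value p; a and b are its derivatives in z and conj z. The conditions of
    first and second order combine into a sum of squares plus n |p|^2 being at most 0. *)
Lemma laplace_max (n : nat) (y1 d : R) (X dX Y dY : R -> C) (ddX ddY a b p : C) :
  0 < y1 -> (0 < n)%nat -> 0 < d ->
  (forall t, Rabs t < d -> rderiv X t (dX t)) -> rderiv dX 0 ddX ->
  (forall t, Rabs t < d -> rderiv Y t (dY t)) -> rderiv dY 0 ddY ->
  X 0 = p -> Y 0 = p -> dX 0 = (a + b)%C -> dY 0 = (Ci * (a - b))%C ->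
  (ddX + ddY = - (2 * INR n / y1)%R * Ci * b)%C ->
  (forall t, Rabs t < d -> dot (X t) (X t) <= dot p p) ->
  (forall t, Rabs t < d -> dot (Y t) (Y t) * y1 ^ n <= dot p p * (y1 + t) ^ n) ->
  p = 0.
Proof.
intros Hy Hn Hd HX HdX HY HdY X0 Y0 dX0 dY0 Hlap MX MY.
assert (r0 : Rabs 0 < d) by (rewrite Rabs_R0; lra).
assert (E : forall t, Rabs (t - 0) < d -> Rabs t < d) by (intros t; now rewrite Rminus_0_r).
set (u := dot p p).
assert (Pn : 0 < y1 ^ n) by (apply pow_lt; lra).
set (phi := fun t => dot (X t) (X t)). set (dphi := fun t => 2 * dot (X t) (dX t)).
assert (Dphi : forall t, Rabs t < d -> is_derive phi t (dphi t)).
{ intros t Ht. eapply is_derive_eqv; [apply rderiv_dot; now apply HX|]. unfold dphi, dot; ring. }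
(* Maximality of |Phi|^2 / y^n with denominators cleared, so that no quotient is differentiated;
   [psi] vanishes at 0 and is nowhere positive. *)
set (psi := fun t => dot (Y t) (Y t) * y1 ^ n + - u * (y1 + t) ^ n).
set (dpsi := fun t => (2 * dot (Y t) (dY t)) * y1 ^ n + - u * (INR n * (y1 + t) ^ pred n)).
assert (Dpow : forall m t, is_derive (fun t => (y1 + t) ^ m) t (INR m * (y1 + t) ^ pred m)).
{ intros m t. auto_derive; [auto|]. ring. }
assert (Dpsi : forall t, Rabs t < d -> is_derive psi t (dpsi t)).
{ intros t Ht. eapply is_derive_eqv.
  - apply is_derive_Rplus; apply is_derive_Rmult.
    + apply rderiv_dot; now apply HY.
    + apply is_derive_const.
    + apply is_derive_const.
    + apply Dpow.
  - unfold dpsi, dot, zero; simpl. ring. }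
assert (Mpsi : forall t, Rabs t < d -> psi t <= psi 0).
{ intros t Ht. unfold psi. rewrite Y0, Rplus_0_r. fold u. specialize (MY t Ht). fold u in MY. lra. }
assert (F1 : dphi 0 = 0).
{ apply (first_test phi 0 _ d Hd); [now apply Dphi|]. intros t Ht. unfold phi. rewrite X0. apply MX, E, Ht. }
assert (F2 : dpsi 0 = 0).
{ apply (first_test psi 0 _ d Hd); [now apply Dpsi|]. intros t Ht. apply Mpsi, E, Ht. }
assert (S1 : 2 * (dot (dX 0) (dX 0) + dot (X 0) ddX) <= 0).
{ apply (second_test phi dphi 0 _ d Hd).
  - intros t Ht; apply Dphi, E, Ht.
  - eapply is_derive_eqv; [apply is_derive_Rmult; [apply is_derive_const|apply rderiv_dot; [now apply HX|exact HdX]]|].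
    unfold zero; simpl. ring.
  - intros t Ht. unfold phi. rewrite X0. apply MX, E, Ht. }
assert (S2 : (2 * (dot (dY 0) (dY 0) + dot (Y 0) ddY)) * y1 ^ n
    - u * (INR n * (INR (pred n) * y1 ^ pred (pred n))) <= 0).
{ apply (second_test psi dpsi 0 _ d Hd).
  - intros t Ht; apply Dpsi, E, Ht.
  - eapply is_derive_eqv.
    + apply is_derive_Rplus; apply is_derive_Rmult.
      * apply is_derive_Rmult; [apply is_derive_const|apply rderiv_dot; [now apply HY|exact HdY]].
      * apply is_derive_const.
      * apply is_derive_const.
      * apply is_derive_Rmult; [apply is_derive_const|apply Dpow].
    + unfold zero; simpl. rewrite !Rplus_0_r. ring.
  - intros t Ht; apply Mpsi, E, Ht. }
unfold dphi in F1. unfold dpsi in F2. rewrite X0, dX0 in F1. rewrite Y0, dY0, Rplus_0_r in F2.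
rewrite X0, dX0 in S1. rewrite Y0, dY0 in S2.

assert (F2' : 2 * y1 * dot p (Ci * (a - b))%C = INR n * u).
{ destruct n as [|m]; [lia|]. simpl pred in F2. apply Rmult_eq_reg_r with (y1 ^ m).
  - change (y1 ^ S m) with (y1 * y1 ^ m) in F2. lra.
  - apply Rgt_not_eq, pow_lt; lra. }
assert (S2' : 2 * (dot (Ci * (a - b))%C (Ci * (a - b))%C + dot p ddY) * (y1 * y1)
     <= u * (INR n * (INR n - 1))).
(* For n = 1 the exponent [pred (pred n)] is truncated, but its coefficient n - 1 is 0. *)
{ destruct n as [|[|l]]; [lia| |].
  - simpl in S2 |- *. rewrite Rmult_1_r in S2.
    replace (u * (1 * (1 - 1))) with 0 by ring.
    replace (u * (1 * (0 * 1))) with 0 in S2 by ring.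
    rewrite <- Rmult_assoc.
    replace 0 with (0 * y1) by ring. apply Rmult_le_compat_r; lra.
  - simpl pred in S2. apply Rmult_le_reg_r with (y1 ^ l); [apply pow_lt; lra|].
    change (y1 ^ S (S l)) with (y1 * (y1 * y1 ^ l)) in S2.
    rewrite (S_INR (S l)) in S2 |- *. lra. }
destruct p as [p1 p2], a as [a1 a2], b as [b1 b2], ddX as [x1 x2], ddY as [z1 z2].
injection Hlap as L1 L2.
unfold u, dot in *; simpl in *.
set (N := INR n) in *. assert (HN : 1 <= N).
{ unfold N. apply (le_INR 1). lia. }
assert (L1' : x1 + z1 = 2 * N / y1 * b2) by (rewrite L1; ring).
assert (L2' : x2 + z2 = - (2 * N / y1 * b1)) by (rewrite L2; ring).
(* Both second order tests, multiplied by y1^2, are added; 2 n times the first order condition in y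
   completes the squares. *)
assert (I : (2 * y1 * a1 - N * p2) * (2 * y1 * a1 - N * p2)
   + (2 * y1 * a2 + N * p1) * (2 * y1 * a2 + N * p1)
   + 4 * (y1 * y1) * (b1 * b1 + b2 * b2) + N * (p1 * p1 + p2 * p2) <= 0).
{ assert (Hyy : 0 < y1 * y1) by (apply Rmult_lt_0_compat; lra).
  assert (S1' : 2 * ((a1 + b1) * (a1 + b1) + (a2 + b2) * (a2 + b2) + (p1 * x1 + p2 * x2)) * (y1 * y1) <= 0) by nra.
  assert (Q : 2 * (p1 * (x1 + z1) + p2 * (x2 + z2)) * (y1 * y1)
     = 4 * N * y1 * (p1 * b2 - p2 * b1)).
  { rewrite L1', L2'. field. lra. }
  apply (f_equal (Rmult (2 * N))) in F2'. lra. }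
clear - I HN.
assert (0 <= p1 * p1 + p2 * p2) by nra.
assert (p1 * p1 + p2 * p2 = 0).
{ assert (0 <= (2 * y1 * a1 - N * p2) * (2 * y1 * a1 - N * p2)) by apply Rle_0_sqr.
  assert (0 <= (2 * y1 * a2 + N * p1) * (2 * y1 * a2 + N * p1)) by apply Rle_0_sqr.
  assert (0 <= 4 * (y1 * y1) * (b1 * b1 + b2 * b2)) by (apply Rmult_le_pos; nra).
  assert (0 <= (N - 1) * (p1 * p1 + p2 * p2)) by (apply Rmult_le_pos; lra).
  lra. }
unfold RtoC. f_equal; nra.
Qed.

(* [b] is the derivative of [Phi] with respect to the conjugate variable, and the
   last equation says that [Phi] is killed by the weight [-n] Laplacian. *)
Definition lap_at (n : nat) (Phi : C -> C) (x y : R) (b : C) : Prop :=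
  exists (d : R) (dX dY : R -> C) (ddX ddY a : C), 0 < d /\
  (forall t, Rabs t < d -> rderiv (fun s => Phi (x + s, y)%R) t (dX t)) /\ rderiv dX 0 ddX /\
  (forall t, Rabs t < d -> rderiv (fun s => Phi (x, y + s)%R) t (dY t)) /\ rderiv dY 0 ddY /\
  dX 0 = (a + b)%C /\ dY 0 = (Ci * (a - b))%C /\
  (ddX + ddY = - (2 * INR n / y)%R * Ci * b)%C.

Lemma snd_neg_inv (x y : R) : 0 < y -> snd (Copp (Cinv (x, y))) = y / (x * x + y * y) /\
   Cmod (x, y) * Cmod (x, y) = x * x + y * y.
Proof.
intros Hy. split.
- assert (0 < x * x + y * y) by (assert (0 <= x * x) by apply Rle_0_sqr; nra).
  unfold Copp, Cinv; cbn [fst snd]. field. simpl; lra.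
- rewrite <- dot_Cmod. reflexivity.
Qed.

(** Crude reduction theory suffices to confine the supremum of |Phi|^2 / y^n to a compact box: below
    height 1/2, after a translation to |x| <= 1/2, the map z -> -1/z at least doubles the height. At
    the top the boundedness of Phi makes the quotient small. *)
Lemma invariant_zero (n : nat) (Phi : C -> C) : (0 < n)%nat ->
  periodic Phi ->
  (forall z, up z -> Cmod z ^ n * Cmod (Phi (- / z)%C) = Cmod (Phi z)) ->
  (forall x y, 0 < y -> cont2 (fun u v => dot (Phi (u, v)) (Phi (u, v))) x y) ->
  (exists K Y, forall z, Y < snd z -> Cmod (Phi z) <= K) ->
  (forall x y, 0 < y -> exists b, lap_at n Phi x y b) ->
  forall z, up z -> Phi z = 0.
Proof.
intros Hn HT HS Hc (K & Y0 & HK) HL z1 Hz1. apply NNPP; intros Hne.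
set (N := fun x y => dot (Phi (x, y)) (Phi (x, y)) / y ^ n).
assert (NT : forall x y m, 0 < y -> N (x + IZR m) y = N x y).
{ intros x y m Hy. unfold N. now rewrite periodic_Z. }
assert (NS : forall x y, 0 < y -> exists x', N x' (y / (x * x + y * y)) = N x y).
{ intros x y Hy. exists (fst (Copp (Cinv (x, y)))).
  destruct (snd_neg_inv x y Hy) as [E1 E2].
  assert (S := HS (x, y) Hy).
  set (w := Copp (Cinv (x, y))) in *. rewrite <- E1.
  unfold N. replace ((fst w, snd w) : C) with w by (now destruct w).
  rewrite !dot_Cmod, <- S, E1.
  assert (0 < x * x + y * y) by (assert (0 <= x * x) by apply Rle_0_sqr; nra).
  set (q := x * x + y * y) in *.
  assert (Hp : 0 < y ^ n) by (now apply pow_lt).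
  assert (Hq : 0 < q ^ n) by (now apply pow_lt).
  unfold Rdiv. rewrite Rpow_mult_distr, pow_inv.
  replace (Cmod (x, y) ^ n * Cmod (Phi w) * (Cmod (x, y) ^ n * Cmod (Phi w)))
    with (q ^ n * (Cmod (Phi w) * Cmod (Phi w))).
  - field. lra.
  - rewrite <- E2, Rpow_mult_distr. ring. }
(* Induction on the number k of doublings that certainly lift y to height 1/2. *)
assert (red : forall k x y, 0 < y -> / 2 <= y * 2 ^ k ->
   exists x' y', 0 <= x' <= 1 /\ / 2 <= y' /\ N x' y' = N x y).
{ assert (base : forall x y, / 2 <= y -> exists x' y', 0 <= x' <= 1 /\ / 2 <= y' /\ N x' y' = N x y).
  { intros x y Hy. exists (x + IZR (- Int_part x)), y.
    split; [apply frac_range|split; [exact Hy|]]. apply NT; lra. }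
  induction k as [|k IH]; intros x y Hy Hk.
  - apply base. simpl in Hk; lra.
  - destruct (Rle_dec (/ 2) y) as [L|L]; [now apply base|].
    set (m := (- Int_part (x + / 2))%Z). set (x1 := x + IZR m).
    assert (Hx1 : - / 2 <= x1 <= / 2).
    { assert (F := frac_range (x + / 2)). fold m in F. unfold x1. lra. }
    destruct (NS x1 y Hy) as (x2 & E2).
    assert (Hxx : 0 <= x1 * x1 <= / 4) by nra.
    assert (Hyy : 0 < y * y <= / 4) by nra.
    assert (Hq : 0 < x1 * x1 + y * y) by lra.
    assert (Hy2 : 2 * y <= y / (x1 * x1 + y * y)).
    { apply Rmult_le_reg_r with (x1 * x1 + y * y); [exact Hq|].
      replace (y / (x1 * x1 + y * y) * (x1 * x1 + y * y)) with y by (field; lra). nra. }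
    destruct (IH x2 (y / (x1 * x1 + y * y))) as (x' & y' & A & B & D).
    + lra.
    + simpl in Hk. assert (0 < 2 ^ k) by (apply pow_lt; lra). nra.
    + exists x', y'. split; [exact A|split; [exact B|]]. rewrite D, E2. now apply NT. }
assert (red' : forall x y, 0 < y -> exists x' y', 0 <= x' <= 1 /\ / 2 <= y' /\ N x' y' = N x y).
{ intros x y Hy. destruct (Pow_x_infinity 2) with (b := / (2 * y)) as (k & Hk).
  { rewrite Rabs_pos_eq; lra. }
  specialize (Hk k (le_n k)). rewrite Rabs_pos_eq in Hk by (apply pow_le; lra).
  apply (red k); [exact Hy|]. apply Rge_le in Hk.
  apply Rmult_le_compat_l with (r := y) in Hk; [|lra].
  replace (y * / (2 * y)) with (/ 2) in Hk by (field; lra). exact Hk. }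
destruct z1 as [xa ya]. unfold up in Hz1; simpl in Hz1.
set (N1 := N xa ya).
assert (HN1 : 0 < N1).
{ unfold N1, N. apply Rdiv_lt_0_compat; [|now apply pow_lt]. rewrite dot_Cmod.
  apply Cmod_gt_0 in Hne. now apply Rmult_lt_0_compat. }
set (K' := Rabs K + 1). assert (HK' : 0 < K') by (unfold K'; assert (Q := Rabs_pos K); lra).
(* Above this height K'^2 / y^n is less than [N1], the value at the supposed nonzero point. *)
set (Y1 := Rmax (Rmax Y0 1) (K' * K' / N1 + 1)).
assert (HY1 : 1 <= Y1) by (unfold Y1; eapply Rle_trans; [|apply Rmax_l]; apply Rmax_r).
assert (HY1' : Y0 <= Y1) by (unfold Y1; eapply Rle_trans; [|apply Rmax_l]; apply Rmax_l).
assert (HY1'' : K' * K' / N1 + 1 <= Y1) by (unfold Y1; apply Rmax_r).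
assert (small : forall x y, Y1 < y -> N x y < N1).
{ intros x y Hy.
  assert (L1 : dot (Phi (x, y)) (Phi (x, y)) <= K' * K').
  { rewrite dot_Cmod. assert (A := HK (x, y) ltac:(simpl; lra)).
    assert (Q := Rle_abs K). assert (P := Cmod_ge_0 (Phi (x, y))).
    apply Rmult_le_compat; unfold K'; lra. }
  assert (L2 : y <= y ^ n).
  { destruct n as [|m]; [lia|]. simpl. assert (1 <= y ^ m) by (apply pow_R1_Rle; lra). nra. }
  assert (L3 : K' * K' < N1 * y).
  { assert (H : K' * K' / N1 < y) by lra. apply Rmult_lt_compat_l with (r := N1) in H; [|exact HN1].
    replace (N1 * (K' * K' / N1)) with (K' * K') in H by (field; lra). exact H. }
  unfold N. apply Rmult_lt_reg_r with (y ^ n); [apply pow_lt; lra|].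
  unfold Rdiv. rewrite Rmult_assoc, Rinv_l, Rmult_1_r by (apply Rgt_not_eq, pow_lt; lra).
  apply Rle_lt_trans with (1 := L1). apply Rlt_le_trans with (1 := L3).
  apply Rmult_le_compat_l; lra. }
destruct (box_max N 0 (/ 2) 1 Y1) as (X & Y & HX & HY & Hmax); try lra.
{ intros x y Hx Hy. apply cont2_mult.
  - apply Hc; lra.
  - apply (cont2_snd (fun y => / y ^ n)). apply (ex_derive_continuous (fun y => / y ^ n)).
    auto_derive. apply Rgt_not_eq, pow_lt; lra. }
assert (M1 : N1 <= N X Y).
{ destruct (red' xa ya Hz1) as (x' & y' & A & B & E). fold N1 in E.
  destruct (Rle_dec y' Y1) as [L|L].
  - rewrite <- E. apply Hmax; lra.
  - specialize (small x' y'). lra. }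
assert (M : forall x y, 0 < y -> N x y <= N X Y).
{ intros x y Hy. destruct (red' x y Hy) as (x' & y' & A & B & E). rewrite <- E.
  destruct (Rle_dec y' Y1) as [L|L].
  - apply Hmax; lra.
  - specialize (small x' y'). lra. }
assert (HYp : 0 < Y) by lra.
destruct (HL X Y HYp) as (b & d & dX & dY & ddX & ddY & a & Hd & H1 & H2 & H3 & H4 & H5 & H6 & H7).
assert (Hd' : 0 < Rmin d Y) by (apply Rmin_pos; lra).
assert (l1 : Rmin d Y <= d) by apply Rmin_l. assert (l2 : Rmin d Y <= Y) by apply Rmin_r.
assert (Z : Phi (X, Y) = 0).
{ apply (laplace_max n Y (Rmin d Y) (fun s => Phi (X + s, Y)%R) dX (fun s => Phi (X, Y + s)%R) dY
    ddX ddY a b); auto.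
  - intros t Ht; apply H1; lra.
  - intros t Ht; apply H3; lra.
  - now rewrite Rplus_0_r.
  - now rewrite Rplus_0_r.
  - intros t Ht. specialize (M (X + t) Y HYp). unfold N in M.
    apply Rmult_le_reg_r with (/ Y ^ n); [|exact M]. apply Rinv_0_lt_compat, pow_lt, HYp.
  - intros t Ht. apply Rabs_def2 in Ht. assert (Ht' : 0 < Y + t) by lra.
    specialize (M X (Y + t) Ht'). unfold N in M.
    assert (p1 : 0 < Y ^ n) by (now apply pow_lt). assert (p2 : 0 < (Y + t) ^ n) by (now apply pow_lt).
    apply Rmult_le_compat_r with (r := Y ^ n * (Y + t) ^ n) in M.
    2:{ apply Rmult_le_pos; lra. }
    replace (dot (Phi (X, (Y + t)%R)) (Phi (X, (Y + t)%R)) / (Y + t) ^ n * (Y ^ n * (Y + t) ^ n))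
     with (dot (Phi (X, (Y + t)%R)) (Phi (X, (Y + t)%R)) * Y ^ n) in M by (field; lra).
    replace (dot (Phi (X, Y)) (Phi (X, Y)) / Y ^ n * (Y ^ n * (Y + t) ^ n))
     with (dot (Phi (X, Y)) (Phi (X, Y)) * (Y + t) ^ n) in M by (field; lra).
    exact M. }
assert (NXY : N X Y = 0).
{ unfold N. rewrite Z. unfold dot; simpl. unfold Rdiv. ring. }
lra.
Qed.

Lemma rderiv_zero (g : R -> C) (l : C) (d : R) : 0 < d -> (forall t, Rabs t < d -> g t = 0) ->
  rderiv g 0 l -> l = 0.
Proof.
intros Hd Hg [H1 H2].
assert (L : locally 0 (fun t => g t = 0)).
{ exists (mkposreal d Hd). intros t Ht. apply Hg.
  replace t with (minus t 0) by (unfold minus, plus, opp; simpl; ring). exact Ht. }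
apply injective_projections.
- apply is_derive_unique in H1. rewrite <- H1.
  transitivity (Derive (fun _ => 0) 0); [|apply Derive_const].
  apply Derive_ext_loc. revert L; apply filter_imp. intros t E. now rewrite E.
- apply is_derive_unique in H2. rewrite <- H2.
  transitivity (Derive (fun _ => 0) 0); [|apply Derive_const].
  apply Derive_ext_loc. revert L; apply filter_imp. intros t E. now rewrite E.
Qed.

(** Both partial derivatives a + b and i (a - b) vanish, hence so does b, the one that carries the
    cusp form. *)
Lemma lap_zero (n : nat) (Phi : C -> C) (x y : R) (b : C) : 0 < y ->
  (forall z, up z -> Phi z = 0) -> lap_at n Phi x y b -> b = 0.
Proof.
intros Hy HZ (d & dX & dY & ddX & ddY & a & Hd & H1 & _ & H3 & _ & H5 & H6 & _).
assert (Z0 : Rabs 0 < d) by (rewrite Rabs_R0; exact Hd).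
assert (E1 : dX 0 = 0).
{ apply (rderiv_zero _ _ 1 Rlt_0_1 (fun t _ => HZ (x + t, y)%R Hy) (H1 0 Z0)). }
assert (E2 : dY 0 = 0).
{ apply (rderiv_zero (fun s => Phi (x, y + s)%R) _ y Hy); [|apply (H3 0 Z0)].
  intros t Ht. apply HZ. apply Rabs_def2 in Ht. unfold up; simpl; lra. }
rewrite H5 in E1. rewrite H6 in E2.
assert (Ii : (Ci * Ci = - (1))%C) by (apply injective_projections; simpl; ring).
assert (E3 : (a - b = 0)%C).
{ transitivity (- (Ci * Ci) * (a - b))%C; [rewrite Ii; ring|].
  transitivity (- Ci * (Ci * (a - b)))%C; [ring|rewrite E2; ring]. }
apply Cmod_eq_0.
assert (E4 : (2 * b = 0)%C) by (transitivity ((a + b) - (a - b))%C; [ring|rewrite E1, E3; ring]).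
apply (f_equal Cmod) in E4. rewrite Cmod_mult, Cmod_0, Cmod_R, Rabs_pos_eq in E4 by lra. lra.
Qed.

Lemma cderiv_real (f : C -> C) (t : R) (l : C) : cderiv f (RtoC t) l ->
  rderiv (fun s => f (RtoC s)) t l.
Proof.
intros H.
assert (E : forall s : R, (0 + s * 1)%C = RtoC s) by (intros; ring).
assert (K : rderiv (fun s => f (0 + s * 1)%C) t (l * 1)%C).
{ apply cderiv_line. now rewrite E. }
replace (l * 1)%C with l in K by ring. destruct K as [K1 K2].
split; eapply is_derive_ext; try eassumption; intros s; simpl; now rewrite E.
Qed.

Definition ccont (f : C -> C) (x y : R) : Prop :=
  cont2 (fun u v => fst (f (u, v))) x y /\ cont2 (fun u v => snd (f (u, v))) x y.

Lemma cont2_ext A B x y : (forall u v, A u v = B u v) -> cont2 A x y -> cont2 B x y.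
Proof.
intros E H e He; destruct (H e He) as (d & Hd & K); exists d; split; auto.
intros; rewrite <- !E; auto.
Qed.

Lemma ccont_plus f g x y : ccont f x y -> ccont g x y -> ccont (fun z => f z + g z)%C x y.
Proof. intros [f1 f2] [g1 g2]; split; now apply cont2_plus. Qed.

Lemma ccont_mult f g x y : ccont f x y -> ccont g x y -> ccont (fun z => f z * g z)%C x y.
Proof.
intros [f1 f2] [g1 g2]; split.
- apply (cont2_ext (fun u v => fst (f (u, v)) * fst (g (u, v)) + (-1) * (snd (f (u, v)) * snd (g (u, v))))).
  + intros; simpl; ring.
  + apply cont2_plus; [now apply cont2_mult|].
    apply cont2_mult; [apply cont2_const|now apply cont2_mult].
- apply cont2_plus; now apply cont2_mult.
Qed.

Lemma ccont_hol f x y l : cderiv f (x, y) l -> ccont f x y.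
Proof. intros H; split; [eapply cont2_Re|eapply cont2_Im]; eassumption. Qed.

Lemma ccont_reflect f x y l : cderiv f (- x, y) l -> ccont (fun z => f (- fst z, snd z)) x y.
Proof.
intros H; destruct (ccont_hol _ _ _ _ H) as [H1 H2]; split; intros e He;
  [destruct (H1 e He) as (d & Hd & K)|destruct (H2 e He) as (d & Hd & K)];
  exists d; split; auto; intros x' y' hx hy; simpl; apply K; auto;
  replace (- x' - - x) with (- (x' - x)) by ring; now rewrite Rabs_Ropp.
Qed.

Lemma ccont_dot f x y : ccont f x y -> cont2 (fun u v => dot (f (u, v)) (f (u, v))) x y.
Proof. intros [H1 H2]. apply cont2_plus; now apply cont2_mult. Qed.

(** The first factor is (-2 i y)^k, so this is [decay] at the reflected point -conj z. *)
Lemma decay_im (f g : C -> C) (k : nat) : cuspidal f -> cuspidal g -> (forall z, up z -> cderiv f z (g z)) ->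
  exists K Y, forall x y, Y < y ->
    Cmod (- (x, y) + (x, - y)%R)%C ^ k * Cmod (f (- x, y)%R) <= K.
Proof.
intros Hf Hg H. destruct (decay k f g Hf Hg H) as (K & Y & HY & HK & B).
exists (2 ^ k * K), Y. intros x y Hy.
replace (- (x, y) + (x, - y)%R)%C with (RtoC (- (2 * y)) * Ci)%C
  by (apply injective_projections; simpl; ring).
assert (mI : Cmod Ci = 1).
{ unfold Cmod; simpl. transitivity (sqrt 1); [f_equal; ring|apply sqrt_1]. }
rewrite Cmod_mult, mI, Cmod_R, Rabs_Ropp, Rabs_pos_eq, Rmult_1_r, Rpow_mult_distr by lra.
rewrite Rmult_assoc. apply Rmult_le_compat_l; [apply pow_le; lra|].
rewrite Rmult_comm. apply (B (- x, y)%R). exact Hy.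
Qed.

Lemma cuspidal_lin (a : C) (f g : C -> C) : cuspidal f -> cuspidal g -> cuspidal (fun z => a * f z + g z)%C.
Proof.
intros (hf & pf & lf) (hg & pg & lg). split; [|split].
- intros z Hz. destruct (hf z Hz) as [l Hl], (hg z Hz) as [k Hk].
  exists (a * l + k)%C. apply (cderiv_plus (fun z => a * f z)%C); [|exact Hk].
  now apply cderiv_scal.
- intros z Hz. now rewrite pf, pg.
- intros e He. assert (Ha := Cmod_ge_0 a).
  destruct (lf (e / (2 * (1 + Cmod a)))) as (Y & HY & H); [apply Rdiv_lt_0_compat; lra|].
  destruct (lg (e / 2)) as (Y' & HY' & H'); [lra|].
  exists (Rmax Y Y'). split; [eapply Rlt_le_trans; [exact HY|apply Rmax_l]|]. intros z Hz.
  specialize (H z (Rle_lt_trans _ _ _ (Rmax_l _ _) Hz)).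
  specialize (H' z (Rle_lt_trans _ _ _ (Rmax_r _ _) Hz)).
  eapply Rle_lt_trans; [apply Cmod_triangle|]. rewrite Cmod_mult.
  assert (Cmod a * Cmod (f z) <= e / 2).
  { apply Rle_trans with ((1 + Cmod a) * (e / (2 * (1 + Cmod a)))).
    - apply Rmult_le_compat; try apply Cmod_ge_0; lra.
    - right; field; lra. }
  lra.
Qed.

End HalfPlane.

Require Import Defs.
From HB Require Import structures.
From mathcomp Require Import all_boot all_order all_algebra complex ring zify.
From mathcomp Require Import all_classical all_reals all_analysis.
From mathcomp Require Import Rstruct.

Set Implicit Arguments.
Unset Strict Implicit.
Unset Printing Implicit Defensive.

Import Order.TTheory GRing.Theory Num.Theory.
Import numFieldNormedType.Exports.
Local Open Scope classical_set_scope.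
Local Open Scope ring_scope.

Lemma sum_triangle (V : nmodType) n (G : nat -> nat -> V) :
  \sum_(j < n.+1) \sum_(i < j.+1) G i j = \sum_(i < n.+1) \sum_(l < (n - i).+1) G i (l + i)%N.
Proof.
elim: n => [|n IH]; first by rewrite !big_ord1.
rewrite big_ord_recr /= IH [RHS]big_ord_recr /= subnn big_ord1 add0n.
rewrite [X in _ + X]big_ord_recr /= addrA -big_split; congr (_ + _); apply: eq_bigr => i _ /=.
have im : (i <= n)%N by rewrite -ltnS.
by rewrite subSn // [RHS]big_ord_recr /= addSn subnK.
Qed.

(** * Period polynomials and stuffle-shuffle forms *)

Section Forms.
Variable K : numFieldType.
Implicit Types (P Q q : {poly K}) (x y t : K).

(* The value at [(x, y)] of the form of degree [n] with dehomogenization [P]. *)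
Definition hom (n : nat) P x y : K := \sum_(i < n.+1) P`_i * x ^+ i * y ^+ (n - i).

Lemma hom1 n P x : (size P <= n.+1)%N -> hom n P x 1 = P.[x].
Proof.
move=> sP; rewrite (horner_coef_wide _ sP); apply: eq_bigr => i _.
by rewrite expr1n mulr1.
Qed.

Lemma homZ n P t x y : hom n P (t * x) (t * y) = t ^+ n * hom n P x y.
Proof.
rewrite /hom mulr_sumr; apply: eq_bigr => i _; rewrite !exprMn.
have -> : t ^+ n = t ^+ i * t ^+ (n - i) by rewrite -exprD subnKC // -ltnS.
ring.
Qed.

Lemma hom_div n P x y : (size P <= n.+1)%N -> y != 0 -> hom n P x y = y ^+ n * P.[x / y].
Proof. by move=> sP y0; rewrite -(hom1 _ sP) -homZ mulr1 mulrCA divff // mulr1. Qed.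

Lemma homD n P Q x y : hom n (P + Q) x y = hom n P x y + hom n Q x y.
Proof. by rewrite /hom -big_split /=; apply: eq_bigr => i _; rewrite coefD; ring. Qed.

Lemma homNN n P x y : hom n P (- x) (- y) = (-1) ^+ n * hom n P x y.
Proof. by rewrite -homZ !mulN1r. Qed.

Lemma poly_nat_eq P Q : (forall i, P.[i.+1%:R] = Q.[i.+1%:R]) -> P = Q.
Proof.
move=> H; apply/eqP; rewrite -subr_eq0; apply/eqP.
apply: (@roots_geq_poly_eq0 _ _ [seq i.+1%:R | i <- iota 0 (size (P - Q))]).
- by apply/allP => x /mapP [i _ ->]; rewrite rootE hornerD hornerN H subrr.
- by rewrite map_inj_uniq ?iota_uniq // => i j /eqP; rewrite eqr_nat eqSS => /eqP.
- by rewrite size_map size_iota.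
Qed.

Definition refl P : {poly K} := \poly_(i < size P) ((-1) ^+ i * P`_i).
Lemma refl_coef P i : (refl P)`_i = (-1) ^+ i * P`_i.
Proof. by rewrite coef_poly; case: ltnP => // h; rewrite nth_default ?mulr0. Qed.
Lemma hom_refl n P x y : hom n (refl P) x y = hom n P (- x) y.
Proof.
apply: eq_bigr => i _; rewrite refl_coef [(- x) ^+ i]exprNn; ring.
Qed.
Lemma refl_horner P x : (refl P).[x] = P.[- x].
Proof.
by rewrite -(hom1 (n := size P)) ?hom_refl ?(hom1 (n := size P)) // (leq_trans (size_poly _ _)).
Qed.
Lemma size_refl P : (size (refl P) <= size P)%N.
Proof. exact: size_poly. Qed.

(** * Cocycles, their even and odd parts, and relators *)

Definition cocycle n P := [/\ (size P <= n.+1)%N,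
  forall x y, hom n P (- y) x = - hom n P x y
  & forall x y, hom n P x y = hom n P (x + y) y + hom n P x (x + y)].

Definition even_cocycle n P := [/\ (size P <= n.+1)%N, forall x y, hom n P (- x) y = hom n P x y,
  forall x y, hom n P y x = - hom n P x y
  & forall x y, hom n P x y = hom n P (x + y) y + hom n P x (x + y)].

Definition odd_cocycle n P := [/\ (size P <= n.+1)%N, forall x y, hom n P (- x) y = - hom n P x y,
  forall x y, hom n P y x = hom n P x y
  & forall x y, hom n P x y = hom n P (x + y) y + hom n P x (x + y)].

Lemma size_add_refl n P c : (size P <= n.+1)%N -> (size (P + c *: refl P)%R <= n.+1)%N.
Proof.
move=> sP; apply: leq_trans (size_polyD _ _) _; rewrite geq_max sP.
exact: leq_trans (size_scale_leq _ _) (leq_trans (size_refl _) sP).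
Qed.

Lemma homCZ n c P x y : hom n (c *: P) x y = c * hom n P x y.
Proof. by rewrite /hom mulr_sumr; apply: eq_bigr => i _; rewrite coefZ; ring. Qed.

(** Reflection in X preserves the three-term equation, so the even and odd parts are again cocycles:
    the equation at (-(x+y), y) produces P(-(x+y), -x) = P(x+y, x), which the other relation turns
    into -P(-x, x+y). *)
Lemma refl_Lewis n P x y : ~~ odd n -> cocycle n P ->
  hom n P (- x) y = hom n P (- (x + y)) y + hom n P (- x) (x + y).
Proof.
move=> nE [sP hS hL].
have ev a b : hom n P (- a) (- b) = hom n P a b.
  by rewrite homNN -signr_odd (negbTE nE) mul1r.
rewrite [hom n P (- (x + y)) y]hL.
have -> : - (x + y) + y = - x by ring.
by rewrite ev (hS (x + y) x); ring.
Qed.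

Lemma even_part n P : ~~ odd n -> cocycle n P -> even_cocycle n (P + 1 *: refl P).
Proof.
move=> nE cP; have [sP hS hL] := cP.
have E x y : hom n (P + 1 *: refl P) x y = hom n P x y + hom n P (- x) y.
  by rewrite homD homCZ hom_refl mul1r.
split; first exact: size_add_refl.
- by move=> x y; rewrite !E opprK addrC.
- by move=> x y; rewrite !E (hS x y) (hS y x); ring.
- by move=> x y; rewrite !E {1}hL (refl_Lewis x y nE cP); ring.
Qed.

Lemma odd_part n P : ~~ odd n -> cocycle n P -> odd_cocycle n (P + (-1) *: refl P).
Proof.
move=> nE cP; have [sP hS hL] := cP.
have E x y : hom n (P + (-1) *: refl P) x y = hom n P x y - hom n P (- x) y.
  by rewrite homD homCZ hom_refl mulN1r.
split; first exact: size_add_refl.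
- by move=> x y; rewrite !E opprK opprB.
- by move=> x y; rewrite !E (hS x y) (hS y x); ring.
- by move=> x y; rewrite !E {1}hL (refl_Lewis x y nE cP); ring.
Qed.

(* Partial derivatives of the form of degree [n.+1] defined by [P]. *)
Definition dX n P x y : K := \sum_(i < n.+2) i%:R * P`_i * x ^+ i.-1 * y ^+ (n.+1 - i).
Definition dY n P x y : K := \sum_(i < n.+2) (n.+1 - i)%:R * P`_i * x ^+ i * y ^+ (n - i).

Lemma hom_coef_inj n P Q : (size P <= n.+1)%N -> (size Q <= n.+1)%N ->
  (forall i, hom n P i.+1%:R 1 = hom n Q i.+1%:R 1) -> P = Q.
Proof. by move=> sP sQ H; apply: poly_nat_eq => i; rewrite -(hom1 _ sP) -(hom1 _ sQ). Qed.

Definition rev_poly n P : {poly K} := \poly_(i < n.+1) P`_(n - i).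
Lemma hom_rev n P x y : hom n (rev_poly n P) x y = hom n P y x.
Proof.
rewrite /hom [RHS](reindex_inj rev_ord_inj) /=; apply: eq_bigr => i _.
have hi : (i <= n)%N by rewrite -ltnS.
rewrite coef_poly ltn_ord subSS (subKn hi); ring.
Qed.

Lemma even_cocycle_coef n P : even_cocycle n P ->
  (forall i, odd i -> P`_i = 0) /\ (forall i, (i <= n)%N -> P`_(n - i) = - P`_i).
Proof.
move=> [sP hE hA _]; split.
  have R : refl P = P.
    apply: (@hom_coef_inj n) => // [|i]; first exact: leq_trans (size_refl _) sP.
    by rewrite hom_refl hE.
  move=> i oi; have := refl_coef P i; rewrite R -signr_odd oi expr1 mulN1r => /eqP.
  by rewrite -subr_eq0 opprK -mulr2n mulrn_eq0 => /eqP.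
have R : rev_poly n P = - P.
  apply: (@hom_coef_inj n) => [||i]; rewrite ?size_polyN ?size_poly // hom_rev hA.
  by rewrite -(scaleN1r P) homCZ mulN1r.
by move=> i hi; have := congr1 (fun p : {poly K} => p`_i) R; rewrite /= coef_poly ltnS hi coefN.
Qed.

Lemma odd_cocycle_coef n P : odd_cocycle n P ->
  (forall i, ~~ odd i -> P`_i = 0) /\ (forall i, (i <= n)%N -> P`_(n - i) = P`_i).
Proof.
move=> [sP hE hA _]; split.
  have R : refl P = - P.
    apply: (@hom_coef_inj n) => [||i]; rewrite ?size_polyN //.
      exact: leq_trans (size_refl _) sP.
    by rewrite hom_refl hE -(scaleN1r P) homCZ mulN1r.
  move=> i oi; have := refl_coef P i; rewrite R -signr_odd (negbTE oi) mul1r coefN => /eqP.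
  by rewrite eq_sym -subr_eq0 opprK -mulr2n mulrn_eq0 => /eqP.
have R : rev_poly n P = P.
  by apply: (@hom_coef_inj n) => [||i]; rewrite ?size_poly // hom_rev hA.
by move=> i hi; have := congr1 (fun p : {poly K} => p`_i) R; rewrite /= coef_poly ltnS hi.
Qed.

Lemma dX_dY n P x y : (forall i, (i <= n.+1)%N -> P`_(n.+1 - i) = - P`_i) ->
  dX n P x y = - dY n P y x.
Proof.
move=> H; rewrite /dX (reindex_inj rev_ord_inj) /= /dY -sumrN; apply: eq_bigr => i _.
have hi : (i <= n.+1)%N by rewrite -ltnS.
rewrite subSS H // subKn // (_ : (n.+1 - i).-1 = (n - i)%N); first by ring.
by rewrite -subn1 -subnDA addn1 subSS.
Qed.

Lemma dY_oppr n P x y : odd n -> (forall i, odd i -> P`_i = 0) -> dY n P x (- y) = - dY n P x y.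
Proof.
move=> nO H; rewrite /dY -sumrN; apply: eq_bigr => i _.
case: (boolP (odd i)) => oi; first by rewrite H // mulr0 !mul0r oppr0.
case: (ltnP n i) => hi.
  by rewrite (_ : (n.+1 - i)%N = 0%N) ?mul0r ?oppr0 //; apply/eqP; rewrite subn_eq0.
rewrite [(- y) ^+ _]exprNn -signr_odd oddB // nO (negbTE oi) expr1; ring.
Qed.

(* Differentiating [P(x,y) = P(x-y,y) + P(x,x-y)] with respect to [y]. *)
Lemma dY_Lewis n P : odd n -> even_cocycle n.+1 P -> forall x y,
  dY n P x (x - y) + dY n P y (y - x) + dY n P x y = dY n P (x - y) y.
Proof.
move=> nO ecP x y; have [cE cA] := even_cocycle_coef ecP; have [sP hE hA hL] := ecP.
have hEy u v : hom n.+1 P u (- v) = hom n.+1 P u v.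
  by rewrite -{1}[u]opprK homNN -signr_odd /= nO mul1r hE.
have hL' u v : hom n.+1 P u v = hom n.+1 P (u - v) v + hom n.+1 P u (u - v).
  by rewrite -hEy (hL u (- v)) hEy.
(* The three terms as polynomials in y for fixed x, so that the differentiation is formal. *)
pose h1 : {poly K} := \sum_(i < n.+2) (P`_i * x ^+ i)%:P * 'X ^+ (n.+1 - i).
pose h2 : {poly K} := \sum_(i < n.+2) (P`_i)%:P * (x%:P - 'X) ^+ i * 'X ^+ (n.+1 - i).
pose h3 : {poly K} := \sum_(i < n.+2) (P`_i * x ^+ i)%:P * (x%:P - 'X) ^+ (n.+1 - i).
have e1 t : h1.[t] = hom n.+1 P x t.
  by rewrite horner_sum; apply: eq_bigr => i _; rewrite !hornerE.
have e2 t : h2.[t] = hom n.+1 P (x - t) t.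
  by rewrite horner_sum; apply: eq_bigr => i _; rewrite !hornerE.
have e3 t : h3.[t] = hom n.+1 P x (x - t).
  by rewrite horner_sum; apply: eq_bigr => i _; rewrite !hornerE.
have E : h1 = h2 + h3 by apply: poly_nat_eq => i; rewrite hornerD e1 e2 e3 -hL'.
have sub1 i : (n.+1 - i).-1 = (n - i)%N by rewrite -subn1 -subnDA addn1 subSS.
have d1 : h1^`().[y] = dY n P x y.
  rewrite /h1 raddf_sum horner_sum; apply: eq_bigr => i _ /=.
  by rewrite derivM derivC mul0r add0r derivXn !hornerE hornerMn !hornerE sub1; ring.
have d2 : h2^`().[y] = - dX n P (x - y) y + dY n P (x - y) y.
  rewrite /h2 raddf_sum horner_sum -sumrN -big_split; apply: eq_bigr => i _ /=.
  rewrite !derivM derivC mul0r add0r derivXn deriv_exp derivB derivC derivX !hornerE !hornerMn !hornerE sub1; ring.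
have d3 : h3^`().[y] = - dY n P x (x - y).
  rewrite /h3 raddf_sum horner_sum -sumrN; apply: eq_bigr => i _ /=.
  by rewrite !derivM derivC mul0r add0r deriv_exp derivB derivC derivX !hornerE !hornerMn !hornerE sub1; ring.
have := congr1 (fun p : {poly K} => p^`().[y]) E; rewrite /= derivD hornerD d1 d2 d3 => ->.
rewrite (dX_dY _ _ cA) opprK -[y - x]opprB (dY_oppr _ _ nO cE); ring.
Qed.

(* For odd [m], this is what makes [p(x,y) = q(x,x-y) + q(y,y-x)] satisfy
   [p(x,y) - p(x,x+y) = q(x-y,y) - q(x+y,y)]. *)
Definition relator m q := [/\ (size q <= m.+1)%N, forall i, odd i -> q`_i = 0
  & forall x y, hom m q x (x - y) + hom m q y (y - x) + hom m q x y = hom m q (x - y) y].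

(** Oddness turns the three-term equation into Q(x,x-y) = Q(x-y,y) - Q(x,y), and with the symmetry
    Q(y,y-x) = -Q(x-y,y). With the weights x and y the left-hand side becomes (x-y) Q(x-y,y). *)
Lemma relator_odd n Q : ~~ odd n -> odd_cocycle n Q -> relator n.+1 ('X * Q).
Proof.
move=> nE oc; have [cO _] := odd_cocycle_coef oc; have [sQ hO hS hL] := oc.
split.
- apply: leq_trans (size_polyMleq _ _) _; by rewrite size_polyX add2n.
- by case=> [|i] oi; rewrite coefXM //= cO.
- move=> x y.
  have E u v : hom n.+1 ('X * Q) u v = u * hom n Q u v.
    rewrite /hom big_ord_recl /= coefXM /= mul0r mul0r add0r mulr_sumr.
    by apply: eq_bigr => i _; rewrite coefXM /= /bump /= add1n subSS exprS; ring.
  have hN u v : hom n Q u (- v) = - hom n Q u v.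
    by rewrite -{1}[u]opprK homNN -signr_odd (negbTE nE) mul1r hO.
  have h1 u v : hom n Q u (u - v) = hom n Q (u - v) v - hom n Q u v.
    have := hL u (- v); rewrite !hN => e.
    by apply: (addrI (- hom n Q (u - v) v)); rewrite -e; ring.
  rewrite !E (h1 y x) (hS x y) (hS x (y - x)) -[y - x]opprB hN (h1 x y); ring.
Qed.

(** Dehomogenization of dP/dY, where P stands for a form of degree m+1. *)
Definition dYpoly m P : {poly K} := \poly_(i < m.+1) ((m.+1 - i)%:R * P`_i).

Lemma relator_even m P : odd m -> even_cocycle m.+1 P -> relator m (dYpoly m P).
Proof.
move=> mO ec; have [cE _] := even_cocycle_coef ec; split.
- exact: size_poly.
- by move=> i oi; rewrite coef_poly; case: ifP => // _; rewrite cE // mulr0.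
- move=> x y.
  have E u v : hom m (dYpoly m P) u v = dY m P u v.
    rewrite /dY big_ord_recr /= subnn !mul0r addr0; apply: eq_bigr => i _.
    by rewrite coef_poly ltn_ord.
  by rewrite !E dY_Lewis.
Qed.

(* The dehomogenization of [q(X,X-Y) + q(Y,Y-X)]. *)
Definition symm m q : {poly K} :=
  \sum_(i < m.+1) q`_i *: ('X ^+ i * ('X - 1) ^+ (m - i) + (1 - 'X) ^+ (m - i)).

Lemma symm_horner m q x : (symm m q).[x] = hom m q x (x - 1) + hom m q 1 (1 - x).
Proof.
rewrite /symm horner_sum /hom -big_split; apply: eq_bigr => i _ /=.
by rewrite !hornerE expr1n; ring.
Qed.

Lemma size_symm m q : (size (symm m q) <= m.+1)%N.
Proof.
apply: leq_trans (size_sum _ _ _) _; apply/bigmax_leqP => i _.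
have im : (i <= m)%N by rewrite -ltnS.
apply: leq_trans (size_scale_leq _ _) _; apply: leq_trans (size_polyD _ _) _.
have s1 : (size (('X - 1 : {poly K}) ^+ (m - i)) <= (m - i).+1)%N.
  by rewrite -polyC1 size_exp_XsubC.
have s2 : (size ((1 - 'X : {poly K}) ^+ (m - i)) <= (m - i).+1)%N.
  apply: leq_trans (size_poly_exp_leq _ _) _.
  by rewrite -size_polyN opprB -polyC1 size_XsubC mul1n.
rewrite geq_max (leq_trans s2) ?ltnS ?leq_subr // andbT.
apply: leq_trans (size_polyMleq _ _) _; rewrite size_polyXn /=.
by apply: leq_trans (leq_add (leqnn i) s1) _; rewrite addnS subnKC.
Qed.

Lemma symmD m q r : symm m (q + r) = symm m q + symm m r.
Proof. by rewrite /symm -big_split; apply: eq_bigr => i _ /=; rewrite coefD scalerDl. Qed.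
Lemma symmZ m c q : symm m (c *: q) = c *: symm m q.
Proof. by rewrite /symm scaler_sumr; apply: eq_bigr => i _ /=; rewrite coefZ scalerA. Qed.

(* The coefficient of [X^j Y^(m-j)] in [p(X,Y) - p(X,X+Y)]. *)
Definition stuffle_shuffle m (p : nat -> K) (j : nat) : K :=
  p j - \sum_(i < j.+1) 'C(m - i, j - i)%:R * p i.

Lemma stuffle_shuffle_horner m (p : {poly K}) x : (size p <= m.+1)%N ->
  \sum_(j < m.+1) stuffle_shuffle m (fun i => p`_i) j * x ^+ j = p.[x] - hom m p x (x + 1).
Proof.
move=> sp; rewrite (horner_coef_wide _ sp).
under eq_bigr do rewrite /stuffle_shuffle mulrBl.
rewrite sumrB; congr (_ - _).
under eq_bigr do rewrite mulr_suml.
rewrite (sum_triangle m (fun i j => 'C(m - i, j - i)%:R * p`_i * x ^+ j)).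
apply: eq_bigr => i _; rewrite [x + 1]addrC exprDn mulr_sumr; apply: eq_bigr => l _.
by rewrite addnK expr1n mul1r -mulr_natr exprD; ring.
Qed.

(** * The form attached to a relator *)

Section Relation.
Variables (m : nat) (q : {poly K}).
Hypothesis mO : odd m.
Hypothesis qR : relator m q.
Let p := symm m q.
Let D := stuffle_shuffle m (fun i => p`_i).

Let hy x y : hom m q x (- y) = - hom m q x y.
Proof.
have [_ oq _] := qR; rewrite /hom -sumrN; apply: eq_bigr => i _.
case: (boolP (odd i)) => oi; first by rewrite oq // !mul0r oppr0.
have im : (i <= m)%N by rewrite -ltnS.
by rewrite [(- y) ^+ _]exprNn -signr_odd oddB // mO (negbTE oi) expr1; ring.
Qed.

Let hx x y : hom m q (- x) y = hom m q x y.
Proof. by rewrite -{1}[y]opprK homNN -signr_odd mO expr1 hy mulN1r opprK. Qed.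

Lemma symm_coef j : (j <= m)%N -> p`_(m - j) = p`_j.
Proof.
have sp : (size p <= m.+1)%N := size_symm m q.
have R : rev_poly m p = p.
  apply: (@hom_coef_inj m) => [||i]; rewrite ?size_poly // hom_rev.
  have nz : i.+1%:R != 0 :> K by rewrite pnatr_eq0.
  rewrite (hom1 _ sp) (hom_div _ sp nz) !symm_horner mulrDr -!homZ.
  by rewrite !mulrBr !mulrA !mulr1 mulfV // addrC.
by move=> hj; have := congr1 (fun p : {poly K} => p`_j) R; rewrite /= coef_poly ltnS hj.
Qed.

(** The relator equation at (1, 0), where q(1,0) stands on both sides. *)
Lemma symm_coef0 : p`_0 = 0.
Proof.
have [_ _ hq] := qR; rewrite -horner_coef0 symm_horner.
have := hq 1 0; rewrite !subr0 sub0r => /eqP.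
by rewrite -subr_eq0 addrK addrC => /eqP.
Qed.

(** p(1,1) = 2 q(1,0), and q is odd in its second variable because m is odd and q even in the
    first. *)
Lemma symm_sum : \sum_(j < m.+1) p`_j = 0.
Proof.
have sp : (size p <= m.+1)%N := size_symm m q.
have : p.[1] = 0.
  rewrite symm_horner subrr.
  have : hom m q 1 0 = 0.
    have := hy 1 0; rewrite oppr0 => /eqP; rewrite -subr_eq0 opprK -mulr2n mulrn_eq0 => /eqP //.
  by move=> ->; rewrite addr0.
rewrite (horner_coef_wide _ sp) => h; rewrite -[RHS]h.
by apply: eq_bigr => j _; rewrite expr1n mulr1.
Qed.

(** The relator equation at (x, 1) gives p(x,1) = q(x-1,1) - q(x,1), while p(x,x+1) = q(x,-1) +
    q(x+1,1) by construction; since q(x,-1) = -q(x,1), these terms cancel in the difference. *)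
Lemma D_horner x : \sum_(j < m.+1) D j * x ^+ j = q.[x - 1] - q.[x + 1].
Proof.
have sp : (size p <= m.+1)%N := size_symm m q; have [sq oq hq] := qR.
pose Dp := \poly_(j < m.+1) D j.
have ev t : ((q \Po ('X - 1)) - (q \Po ('X + 1))).[t] = q.[t - 1] - q.[t + 1].
  by rewrite hornerD hornerN !horner_comp !(hornerD, hornerN) hornerX hornerC.
suff E : Dp = (q \Po ('X - 1)) - (q \Po ('X + 1)) by rewrite -ev -E horner_poly.
apply: poly_nat_eq => i; set t := i.+1%:R.
have t1 : t + 1 != 0 by rewrite /t natr1 pnatr_eq0.
rewrite horner_poly ev.
rewrite (stuffle_shuffle_horner _ sp) (hom_div _ sp t1) !symm_horner mulrDr -!homZ.
rewrite !mulrBr !mulr1 [(t + 1) * _]mulrC divfK //.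
have -> : t - (t + 1) = - 1 by ring.
have -> : t + 1 - t = 1 by ring.
rewrite !hy -(hom1 _ sq) -(hom1 _ sq) -(hq t 1) -[1 - t]opprB hy; ring.
Qed.

Let q_even x : q.[- x] = q.[x].
Proof. by have [sq _ _] := qR; rewrite -!(hom1 _ sq) hx. Qed.

(** As q is even, q(x-1) - q(x+1) is odd in x. *)
Lemma D_even j : ~~ odd j -> (j <= m)%N -> D j = 0.
Proof.
move=> jE jm; pose Dp := \poly_(j < m.+1) D j.
have R : refl Dp = - Dp.
  apply: poly_nat_eq => i; rewrite refl_horner hornerN !horner_poly !D_horner opprB.
  by rewrite -[in LHS]q_even -[X in _ - X]q_even; congr (q.[_] - q.[_]); ring.
have := congr1 (fun r : {poly K} => r`_j) R.
rewrite /= refl_coef coefN coef_poly ltnS jm -signr_odd (negbTE jE) mul1r => /eqP.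
by rewrite -subr_eq0 opprK -mulr2n mulrn_eq0 => /eqP.
Qed.

(** The hypothesis gives q the period 2, so q takes the value q(0) at all even naturals and q(2X) is
    constant. *)
Lemma D_inj : (forall j, (j <= m)%N -> D j = 0) -> forall i, (0 < i)%N -> q`_i = 0.
Proof.
move=> D0; have per x : q.[x + 2%:R] = q.[x].
  have := D_horner (x + 1); rewrite big1 => [/eqP|j _]; last by rewrite D0 ?mul0r // -ltnS.
  rewrite eq_sym subr_eq0 addrK => /eqP ->; congr (q.[_]); ring.
have per2 i : q.[i%:R * 2%:R] = q.[0].
  elim: i => [|i IH]; first by rewrite mul0r.
  by rewrite -[i.+1]addn1 natrD mulrDl mul1r per.
have : q \Po (2%:R *: 'X) = (q.[0])%:P.
  apply: poly_nat_eq => i; rewrite horner_comp hornerZ hornerX hornerC mulrC per2 //.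
move=> E i i0; have := congr1 (fun r : {poly K} => r`_i) E.
rewrite /= coefC gtn_eqF // comp_polyE coef_sum.
under eq_bigr do rewrite exprZn scalerA coefZ coefXn.
case: (ltnP i (size q)) => iq; last by rewrite nth_default.
rewrite (bigD1 (Ordinal iq)) //= eqxx mulr1 big1 ?addr0 => [/eqP|j /eqP ji].
  by rewrite mulf_eq0 expf_eq0 pnatr_eq0 andbF orbF => /eqP.
by case: eqP => [e|]; [case: ji; apply/val_inj|rewrite mulr0].
Qed.
End Relation.

(** Coefficients give Q_i = -(m+1-i) P_(i+1). The same at m-i, with Q symmetric and P antisymmetric,
    reads Q_i = (i+1) P_(i+1). Hence (m+2) P_(i+1) = 0, and only the two extreme coefficients of P
    survive. *)
Lemma relator_inj m Q P : odd_cocycle m Q -> even_cocycle m.+2 P ->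
  (forall i, (0 < i)%N -> ('X * Q + dYpoly m.+1 P)`_i = 0) ->
  Q = 0 /\ P = P`_0 *: (1 - 'X^(m.+2)).
Proof.
move=> oQ eP H; have [_ cQ] := odd_cocycle_coef oQ; have [_ cP] := even_cocycle_coef eP.
have [sQ _ _ _] := oQ; have [sP _ _ _] := eP.
have h i : (i <= m)%N -> Q`_i = - ((m.+1 - i)%:R * P`_i.+1).
  move=> im; have := H i.+1 isT; rewrite coefD coefXM /= coef_poly !ltnS im subSS => /eqP.
  by rewrite addr_eq0 => /eqP.
have P0 i : (i <= m)%N -> P`_i.+1 = 0.
  move=> im; have := h (m - i)%N (leq_subr _ _); rewrite cQ // h //.
  have -> : (m.+1 - (m - i))%N = i.+1 by rewrite subSn ?leq_subr // subKn.
  have -> : (m - i).+1 = (m.+2 - i.+1)%N by rewrite subSS subSn.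
  rewrite cP ?ltnS ?(leq_trans im) // mulrN => /eqP.
  rewrite eqr_opp -subr_eq0 opprK -mulrDl -natrD mulf_eq0 pnatr_eq0.
  by rewrite addn_eq0 andbC /= => /eqP.
split; apply/polyP => i.
  rewrite coef0; case: (leqP i m) => im; first by rewrite h // P0 // mulr0 oppr0.
  by rewrite nth_default // (leq_trans sQ).
rewrite coefZ coefB coefXn coef1; case: i => [|i] /=; first by rewrite subr0 mulr1.
rewrite sub0r eqSS; case: (leqP i m) => im; first by rewrite P0 // ltn_eqF // oppr0 mulr0.
case: eqP => [->|/eqP ne].
  by rewrite -[m.+2]subn0 cP // mulrN mulr1.
by rewrite oppr0 mulr0 nth_default // (leq_trans sP) // !ltnS ltn_neqAle eq_sym ne.
Qed.

End Forms.

(** * Double zeta values *)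

Section Zeta.
Variable R : realType.

Definition zN (s N : nat) : R := \sum_(1 <= n < N) n%:R ^- s.
Definition dzN (r s N : nat) : R := \sum_(1 <= m < N) \sum_(1 <= n < m) m%:R ^- r * n%:R ^- s.
(** The product of two zeta sums cut off along a + b < N, with a = m - n and b = n: the truncation
    for which the shuffle identity is exact. *)
Definition triN (r s N : nat) : R := \sum_(1 <= m < N) \sum_(1 <= n < m) (m - n)%:R ^- r * n%:R ^- s.

Lemma zN_S s N : zN s N.+2 = zN s N.+1 + N.+1%:R ^- s.
Proof. by rewrite /zN big_nat_recr. Qed.
Lemma zN1 s : zN s 1 = 0. Proof. by rewrite /zN big_geq. Qed.
Lemma zN0 s : zN s 0 = 0. Proof. by rewrite /zN big_geq. Qed.
Lemma dzNE r s N : dzN r s N = \sum_(1 <= m < N) m%:R ^- r * zN s m.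
Proof. by apply: eq_bigr => m _; rewrite mulr_sumr. Qed.

Lemma stuffleN r s N : zN r N * zN s N = dzN r s N + dzN s r N + zN (r + s) N.
Proof.
rewrite !dzNE; case: N => [|N]; first by rewrite !zN0 !big_geq // mul0r !addr0.
elim: N => [|N IH]; first by rewrite !zN1 !big_geq // mul0r !addr0.
rewrite !zN_S mulrDl !mulrDr IH ![\sum_(1 <= m < N.+2) _]big_nat_recr //=.
rewrite exprD invfM; ring.
Qed.

(* With [A = 1/a], [B = 1/b], [W = 1/(a+b)] this is the partial fraction
   decomposition of [1 / (a^(r+1) b^(s+1))]. *)
Definition pfs (W B : R) (r s : nat) : R :=
  \sum_(i < (r + s).+1) 'C(i, r)%:R * (W ^+ i.+1 * B ^+ ((r + s).+1 - i)).

Lemma pfsSS W B r s : pfs W B r.+1 s.+1 = W * (pfs W B r s.+1 + pfs W B r.+1 s).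
Proof.
rewrite /pfs !addnS !addSn big_ord_recl /= bin0n /= mul0r add0r -big_split mulr_sumr.
by apply: eq_bigr => i _ /=; rewrite /bump /= add1n binS natrD subSS !exprS; ring.
Qed.

Lemma partial_fraction0 W A B s : A * B = W * (A + B) ->
  A * B ^+ s.+1 = pfs W B 0 s + pfs W A s 0.
Proof.
move=> H; have -> : pfs W A s 0 = W ^+ s.+1 * A.
  rewrite /pfs addn0 big_ord_recr /= binn mul1r subSn // subnn expr1 big1 ?add0r // => i _.
  by rewrite bin_small ?mul0r.
elim: s => [|s IH].
  by rewrite /pfs big_ord_recl big_ord0 /= bin0 !expr1 addr0 mul1r H; ring.
rewrite exprS mulrA H mulrDr mulrDl -mulrA IH.
have -> : pfs W B 0 s.+1 = W * B ^+ s.+2 + W * pfs W B 0 s.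
  rewrite /pfs !add0n big_ord_recl /= bin0 mul1r subn0 mulr_sumr; congr (_ + _).
  by apply: eq_bigr => i _; rewrite /bump /= add1n subSS !bin0 !exprS; ring.
rewrite !exprS; ring.
Qed.

(** Both sides obey the same recursion in (r, s): the left one by A B = W (A + B), the right one by
    Pascal's rule in [pfsSS]. *)
Lemma partial_fraction W A B r s : A * B = W * (A + B) ->
  A ^+ r.+1 * B ^+ s.+1 = pfs W B r s + pfs W A s r.
Proof.
move=> H; elim: r s => [|r IHr] s; first by rewrite expr1 (partial_fraction0 _ H).
elim: s => [|s IHs].
  rewrite expr1 mulrC (@partial_fraction0 W B A r.+1); first by rewrite addrC.
  by rewrite mulrC H addrC.
rewrite !pfsSS; transitivity (W * (A ^+ r.+1 * B ^+ s.+2 + A ^+ r.+2 * B ^+ s.+1)).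
  rewrite (exprS A r.+1) (exprS B s.+1).
  transitivity ((A * B) * (A ^+ r.+1 * B ^+ s.+1)); first by ring.
  by rewrite H; ring.
by rewrite IHr IHs; ring.
Qed.

Lemma rev_inner (F : nat -> nat -> R) m : \sum_(1 <= n < m) F (m - n)%N n = \sum_(1 <= n < m) F n (m - n)%N.
Proof.
rewrite big_nat_rev /= add1n; apply: eq_big_nat => n /andP [n1 nm].
by rewrite subSS subKn // ltnW.
Qed.

(** Partial fractions for 1/a = 1/(m-n), 1/b = 1/n, 1/(a+b) = 1/m; reversing the inner sum brings
    the half in powers of 1/a to the shape of the half in powers of 1/b. *)
Lemma shuffleN r s N : triN r.+1 s.+1 N =
  \sum_(i < (r + s).+1) ('C(i, r) + 'C(i, s))%:R * dzN i.+1 ((r + s).+1 - i) N.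
Proof.
rewrite /triN.
transitivity (\sum_(1 <= m < N) \sum_(i < (r + s).+1) ('C(i, r) + 'C(i, s))%:R *
    \sum_(1 <= n < m) (m%:R ^- i.+1 * n%:R ^- ((r + s).+1 - i) : R)); last first.
  rewrite exchange_big /=; apply: eq_bigr => i _; by rewrite mulr_sumr.
apply: eq_big_nat => m /andP [m1 mN].
transitivity (\sum_(1 <= n < m) (pfs m%:R^-1 n%:R^-1 r s + pfs m%:R^-1 (m - n)%:R^-1 s r)).
  apply: eq_big_nat => n /andP [n1 nm]; rewrite -!exprVn; apply: partial_fraction.
  have n0 : n%:R != 0 :> R by rewrite pnatr_eq0 -lt0n.
  have m0 : m%:R != 0 :> R by rewrite pnatr_eq0 -lt0n.
  have mn0 : (m - n)%:R != 0 :> R by rewrite pnatr_eq0 -lt0n subn_gt0.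
  have e : m%:R = (m - n)%:R + n%:R :> R by rewrite -natrD subnK // ltnW.
  by rewrite e; field; rewrite -e m0 n0 mn0.
rewrite big_split /= (rev_inner (fun a n => pfs m%:R^-1 a%:R^-1 s r)) -big_split /=.
transitivity (\sum_(1 <= n < m) \sum_(i < (r + s).+1) ('C(i, r) + 'C(i, s))%:R *
   (m%:R ^- i.+1 * n%:R ^- ((r + s).+1 - i) : R)).
  apply: eq_bigr => n _; rewrite /pfs [(s + r)%N]addnC -big_split /=; apply: eq_bigr => i _.
  by rewrite natrD -!exprVn; ring.
by rewrite exchange_big /=; apply: eq_bigr => i _; rewrite mulr_sumr.
Qed.

Lemma zN_mono s : nondecreasing_seq (zN s).
Proof.
apply/nondecreasing_seqP => -[|n]; first by rewrite zN0 zN1.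
by rewrite zN_S lerDl invr_ge0 exprn_ge0.
Qed.

Lemma zN_ge0 s N : 0 <= zN s N.
Proof. by apply: sumr_ge0 => i _; rewrite invr_ge0 exprn_ge0. Qed.

Lemma dzN_mono r s : nondecreasing_seq (dzN r s).
Proof.
apply/nondecreasing_seqP => -[|n]; first by rewrite /dzN !big_geq.
rewrite !dzNE [leRHS]big_nat_recr //= lerDl mulr_ge0 ?zN_ge0 // invr_ge0 exprn_ge0 //.
Qed.

Lemma inv_exp_le (n a b : nat) : (0 < n)%N -> (a <= b)%N -> n%:R ^- b <= n%:R ^- a :> R.
Proof.
move=> n0 ab; rewrite lef_pV2 ?posrE ?exprn_gt0 ?ltr0n //.
by rewrite ler_weXn2l // ler1n.
Qed.

(* Telescoping: the left-hand side is nonincreasing in [N]. *)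
Lemma dzN21_bound N : dzN 2 1 N.+2 + (zN 1 N.+2 + 1) / N.+1%:R <= 2%:R.
Proof.
elim: N => [|N IH].
  by rewrite dzNE big_nat1 zN_S zN1 mulr0 expr1 invr1 !add0r mulr1.
apply: le_trans IH; rewrite !dzNE [in X in X <= _]big_nat_recr //= -addrA lerD2l (zN_S 1 N.+1) expr1.
set H := zN 1 N.+2; have H0 : 0 <= H := zN_ge0 _ _.
rewrite -[N.+2%:R]natr1; set x := N.+1%:R : R; have x0 : 0 < x by rewrite ltr0n.
rewrite -subr_ge0.
have -> : (H + 1) / x - ((x + 1) ^- 2 * H + (H + (x + 1)^-1 + 1) / (x + 1)) =
   (H + 1) / (x * (x + 1) ^+ 2).
  by field; rewrite lt0r_neq0 // lt0r_neq0 // addr_gt0.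
by rewrite divr_ge0 ?addr_ge0 // mulr_ge0 ?exprn_ge0 ?addr_ge0 ?ltW.
Qed.

(** Termwise comparison with zeta(2,1), whose partial sums are at most 2. *)
Lemma dzN_cvg r s : (2 <= r)%N -> (1 <= s)%N -> cvgn (dzN r s).
Proof.
move=> r2 s1; apply: (nondecreasing_is_cvgn (dzN_mono r s)).
exists 2%:R => _ [N _ <-].
apply: le_trans (dzN_mono r s (leq_addr 2 N)) _; rewrite addn2.
apply: (@le_trans _ _ (dzN 2 1 N.+2)).
  rewrite /dzN ler_sum_nat // => m /andP [m1 _]; rewrite ler_sum_nat // => n /andP [n1 _].
  by rewrite ler_pM ?invr_ge0 ?exprn_ge0 ?inv_exp_le.
apply: le_trans (dzN21_bound N); rewrite lerDl divr_ge0 ?addr_ge0 ?zN_ge0 //.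
Qed.

(** Apart from the term 1 for n = 1, the sum is dominated by that of zeta(2,1), because the inner
    harmonic sums there are at least 1 from m = 2 on; hence 3 = 1 + 2. *)
Lemma zN_cvg s : (2 <= s)%N -> cvgn (zN s).
Proof.
move=> s2; apply: (nondecreasing_is_cvgn (zN_mono s)).
exists 3%:R => _ [N _ <-].
apply: le_trans (zN_mono s (leq_addr 2 N)) _; rewrite addn2.
rewrite /zN big_nat_recl //= expr1n invr1.
apply: (@le_trans _ _ (1 + dzN 2 1 N.+2)); last first.
  rewrite [3%:R]mulrS lerD2l; apply: le_trans (dzN21_bound N).
  by rewrite lerDl divr_ge0 ?addr_ge0 ?zN_ge0.
rewrite lerD2l dzNE [leRHS]big_nat_recl //= zN1 mulr0 add0r ler_sum_nat // => m /andP [m1 _].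
rewrite -[X in X <= _]mulr1 ler_pM ?invr_ge0 ?exprn_ge0 ?ler01 ?inv_exp_le //.
apply: le_trans (zN_mono 1 (_ : 2 <= m.+1)%N) => //.
by rewrite zN_S zN1 expr1 invr1 add0r.
Qed.

Lemma zN_zeta s : (2 <= s)%N -> zN s @ \oo --> zeta R s.
Proof. by move=> /zN_cvg. Qed.
Lemma dzN_zeta r s : (2 <= r)%N -> (1 <= s)%N -> dzN r s @ \oo --> double_zeta R r s.
Proof. exact: dzN_cvg. Qed.

Lemma stuffle r s : (2 <= r)%N -> (2 <= s)%N ->
  zeta R r * zeta R s = double_zeta R r s + double_zeta R s r + zeta R (r + s).
Proof.
move=> r2 s2.
have h1 : (zN r \* zN s) @ \oo --> zeta R r * zeta R s by apply: cvgM; exact: zN_zeta.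
have h2 : ((dzN r s \+ dzN s r) \+ zN (r + s)) @ \oo -->
    double_zeta R r s + double_zeta R s r + zeta R (r + s).
  apply: cvgD; last by apply: zN_zeta; rewrite ltn_addr.
  by apply: cvgD; apply: dzN_zeta => //; exact: ltnW.
have E : (zN r \* zN s) = ((dzN r s \+ dzN s r) \+ zN (r + s)).
  by apply/funext => N; rewrite /= stuffleN.
by rewrite E in h1; rewrite -(cvg_lim _ h1) // (cvg_lim _ h2).
Qed.

Lemma triNE r s N : triN r s N = \sum_(1 <= n < N) zN r (N - n) * n%:R ^- s.
Proof.
case: N => [|N]; first by rewrite /triN !big_geq.
elim: N => [|N IH]; first by rewrite /triN !big_geq.
rewrite /triN big_nat_recr //= -/(triN r s N.+1) IH [RHS]big_nat_recr //=.
rewrite subSnn zN1 mul0r addr0 -big_split; apply: eq_big_nat => n /andP [n1 nN] /=.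
by rewrite (subSn (ltnW nN)) -mulrDl; case: (N.+1 - n)%N (subn_gt0 n N.+1) => [|d]; rewrite nN // zN_S.
Qed.

(** The truncations differ, a triangle a + b < N against a square a, b < N; the square of side N
    lies between the triangles of sides N and 2 N, so the limits agree. *)
Lemma shuffle r s : (1 <= r)%N -> (1 <= s)%N ->
  zeta R r.+1 * zeta R s.+1 =
  \sum_(i < r + s) ('C(i.+1, r) + 'C(i.+1, s))%:R * double_zeta R i.+2 (r + s - i).
Proof.
move=> r1 s1; set L := RHS.
have cL : triN r.+1 s.+1 @ \oo --> L.
  have -> : triN r.+1 s.+1 = (fun N => \sum_(i < r + s)
      ('C(i.+1, r) + 'C(i.+1, s))%:R * dzN i.+2 (r + s - i) N).
    (* The term i = 0 would be the divergent zeta(1, r+s+1); its coefficient is 0 as r and s are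
       positive. *)
    apply/funext => N; rewrite shuffleN big_ord_recl !bin_small // mul0r add0r.
    by apply: eq_bigr => i _; rewrite /bump /= ?add1n subSS.
  apply: cvg_big => //; first exact: add_continuous.
  move=> i _; apply: cvgM; first exact: cvg_cst.
  by apply: dzN_zeta => //; rewrite subn_gt0.
have h1 : (zN r.+1 \* zN s.+1) @ \oo --> zeta R r.+1 * zeta R s.+1.
  by apply: cvgM; exact: zN_zeta.
have mono : nondecreasing_seq (triN r.+1 s.+1).
  apply/nondecreasing_seqP => -[|n]; first by rewrite /triN !big_geq.
  rewrite /triN [leRHS]big_nat_recr //= lerDl; apply: sumr_ge0 => i _.
  by rewrite mulr_ge0 // invr_ge0 exprn_ge0.
apply/le_anti/andP; split.
  have le N : zN r.+1 N * zN s.+1 N <= L.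
    apply: (@le_trans _ _ (triN r.+1 s.+1 (N + N))); last first.
      rewrite -(cvg_lim _ cL) //.
      by apply: nondecreasing_cvgn_le => //; apply/cvg_ex; exists L.
    rewrite triNE; case: N => [|N]; first by rewrite !zN0 mul0r big_geq.
    rewrite (big_cat_nat (n := N.+1)) //= ?leq_addr // ler_wpDr //.
      by apply: sumr_ge0 => i _; rewrite mulr_ge0 ?zN_ge0 // invr_ge0 exprn_ge0.
    rewrite [X in _ * X]/zN mulr_sumr; apply: ler_sum_nat => n /andP [_ nN].
    rewrite ler_wpM2r ?invr_ge0 ?exprn_ge0 //; apply: zN_mono.
    by rewrite leq_subRL ?leq_add2r ltnW // (leq_trans nN) // leq_addr.
  apply: (ler_cvg_to h1 (cvg_cst L)); apply: nearW => N /=; exact: le.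
apply: (ler_cvg_to cL h1); apply: nearW => N /=.
rewrite triNE [X in _ * X]/zN mulr_sumr; apply: ler_sum_nat => n /andP [_ nN].
by rewrite ler_wpM2r ?invr_ge0 ?exprn_ge0 //; apply: zN_mono; rewrite leq_subr.
Qed.

End Zeta.

Lemma bin_mul_bin m i j : (j <= i)%N -> (i <= m)%N ->
  ('C(m, i) * 'C(i, j) = 'C(m, j) * 'C(m - j, i - j))%N.
Proof.
move=> ji im; have jm := leq_trans ji im.
have f0 : (0 < j`! * (i - j)`! * (m - i)`!)%N by rewrite !muln_gt0 !fact_gt0.
apply/eqP; rewrite -(eqn_pmul2r f0); apply/eqP.
transitivity (m`!)%N.
  by rewrite -(bin_fact im) -(bin_fact ji); ring.
have e : (m - j - (i - j) = m - i)%N by rewrite subnBA // subnK.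
by rewrite -(bin_fact jm) -(bin_fact (leq_sub2r j im)) e; ring.
Qed.

(** * The relation given by a symmetric form *)

Section Relation.
Variables (R : realType) (m : nat) (p : nat -> R).
Hypothesis m_gt0 : (0 < m)%N.
Hypothesis p_sym : forall j, (j <= m)%N -> p (m - j)%N = p j.
Hypothesis p0 : p 0%N = 0.

(** In this normalization the substitution of (X, X+Y) acts by the plain binomials C(i,j), which are
    exactly those of the shuffle product. *)
Let e j := p j / 'C(m, j)%:R.
Let Z j := double_zeta R j.+1 (m.+1 - j).

Let e_sym j : (j <= m)%N -> e (m - j)%N = e j.
Proof. by move=> jm; rewrite /e p_sym // bin_sub. Qed.

Let stuffle_shuffle_e i : (i <= m)%N ->
  e i - \sum_(j < m.+1) e j * 'C(i, j)%:R = stuffle_shuffle m p i / 'C(m, i)%:R.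
Proof.
move=> im; rewrite /stuffle_shuffle mulrBl mulr_suml; congr (_ - _).
rewrite (big_ord_widen m.+1 (fun j => 'C(m - j, i - j)%:R * p j / 'C(m, i)%:R)) //.
rewrite [RHS]big_mkcond /=; apply: eq_bigr => j _; rewrite ltnS; case: leqP => ji; last first.
  by rewrite bin_small // mulr0.
have jm := leq_trans ji im.
have c0 l : (l <= m)%N -> 'C(m, l)%:R != 0 :> R by move=> lm; rewrite pnatr_eq0 -lt0n bin_gt0.
rewrite /e; apply: (mulfI (c0 i im)); apply: (mulfI (c0 j jm)).
have := congr1 (fun n => n%:R : R) (bin_mul_bin ji im); rewrite !natrM => h.
transitivity (p j * ('C(m, i)%:R * 'C(i, j)%:R)); first by field; exact: c0.
by rewrite h; field; exact: c0.
Qed.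

(** The products with j = 0 and j = m would involve zeta(1); there e vanishes. *)
Let product_e j : (j <= m)%N ->
  e j * (Z j + Z (m - j) + zeta R m.+2) =
  e j * \sum_(i < m) ('C(i.+1, j) + 'C(i.+1, m - j))%:R * Z i.+1.
Proof.
move=> jm; case: (posnP j) => [->|j0]; first by rewrite /e p0 !mul0r.
move: jm; rewrite leq_eqVlt => /orP [/eqP ->|jm].
  by rewrite -e_sym // subnn /e p0 !mul0r.
have e1 : (j.+1 + (m - j).+1 = m.+2)%N by rewrite addSn addnS subnKC // ltnW.
have e2 : (j + (m - j) = m)%N by rewrite subnKC // ltnW.
have := @stuffle R j.+1 (m - j).+1; rewrite e1 shuffle ?subn_gt0 // e2 !ltnS j0 subn_gt0 jm.
move=> h; congr (_ * _); rewrite /Z (subSn (ltnW jm)).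
rewrite (subSn (leq_subr j m)) (subKn (ltnW jm)); apply: etrans (esym (h isT isT)) _.
by apply: eq_bigr => i _; rewrite subSS.
Qed.

(** Both evaluations of zeta(j+1) zeta(m+1-j) are summed with weights [e j]. By the symmetry of [e]
    the two double zetas of the stuffle, and the two binomials of the shuffle, contribute equally;
    halving leaves the term in zeta(m+2). *)
Lemma stuffle_shuffle_relation :
  \sum_(i < m) stuffle_shuffle m p i.+1 / 'C(m, i.+1)%:R * double_zeta R i.+2 (m - i) =
  - (\sum_(j < m.+1) p j / 'C(m, j)%:R) / 2%:R * zeta R m.+2.
Proof.
have rv (G : nat -> R) : \sum_(j < m.+1) e j * G (m - j)%N = \sum_(j < m.+1) e j * G j.
  rewrite [RHS](reindex_inj rev_ord_inj) /=; apply: eq_bigr => j _.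
  by rewrite subSS e_sym // -ltnS.
have : \sum_(j < m.+1) e j * (Z j + Z (m - j) + zeta R m.+2) =
    \sum_(j < m.+1) e j * \sum_(i < m) ('C(i.+1, j) + 'C(i.+1, m - j))%:R * Z i.+1.
  by apply: eq_bigr => j _; rewrite product_e // -ltnS.
under eq_bigr do rewrite mulrDr mulrDr.
rewrite !big_split /= rv -mulr_suml.
have -> : \sum_(j < m.+1) e j * \sum_(i < m) ('C(i.+1, j) + 'C(i.+1, m - j))%:R * Z i.+1 =
    2%:R * \sum_(i < m) (\sum_(j < m.+1) e j * 'C(i.+1, j)%:R) * Z i.+1.
  under eq_bigr do rewrite mulr_sumr.
  rewrite exchange_big mulr_sumr; apply: eq_bigr => i _ /=.
  rewrite [RHS]mulrA mulr2n mulrDl mul1r -{1}(rv (fun j => 'C(i.+1, j)%:R)) -big_split mulr_suml.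
  by apply: eq_bigr => j _; rewrite /= natrD; ring.
have -> : \sum_(j < m.+1) e j * Z j = \sum_(i < m) e i.+1 * Z i.+1.
  by rewrite big_ord_recl /e p0 !mul0r add0r.
have -> : \sum_(i < m) stuffle_shuffle m p i.+1 / 'C(m, i.+1)%:R * double_zeta R i.+2 (m - i) =
    \sum_(i < m) e i.+1 * Z i.+1 - \sum_(i < m) (\sum_(j < m.+1) e j * 'C(i.+1, j)%:R) * Z i.+1.
  rewrite -sumrB; apply: eq_bigr => i _; rewrite -stuffle_shuffle_e // mulrBl /Z subSS //.
set a := \sum_(i < m) _; set b := \sum_(i < m) _; rewrite -/e.
set c := \sum_(j < m.+1) _; move=> h.
have -> : b = (a + a + c * zeta R m.+2) / 2%:R by rewrite h mulrAC divff ?mul1r // pnatr_eq0.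
by rewrite /c; field.
Qed.
End Relation.

(** The index j belongs to zeta(j+1, m+1-j): the last condition removes the odd first arguments. The
    third one is p(1,1) = 0. *)
Definition constrained (K : numFieldType) m (p : nat -> K) :=
  [/\ forall j, (j <= m)%N -> p (m - j)%N = p j, p 0%N = 0,
  \sum_(j < m.+1) p j = 0
  & forall j, (j <= m)%N -> ~~ odd j -> stuffle_shuffle m p j = 0].

(** Among the odd indices only j = 1 and j = m, that is zeta(2,m) and zeta(m+1,1), lie outside the
    range. The former has coefficient -m p_0 = 0, the latter p_m minus the sum of all p_i, which is
    0. *)
Lemma constrained_eq0 (K : numFieldType) m (p : nat -> K) j : odd m -> constrained m p ->
  (j <= m)%N -> ~~ ((3 < j.+1 <= m - 1)%N && odd j) -> stuffle_shuffle m p j = 0.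
Proof.
move=> mO [psym p0 psum Deven] jm H; case: (boolP (odd j)) => oj; last exact: Deven.
have [->|->] : (j = 1 :> nat) \/ (j = m)%N by move: H jm oj mO; lia.
  rewrite /stuffle_shuffle big_ord_recl big_ord1 /= p0 mulr0 add0r.
  by rewrite /bump /= subnn bin0 mul1r subrr.
rewrite /stuffle_shuffle -[p m]psym // subnn p0 sub0r.
by under eq_bigr do rewrite binn mul1r; rewrite psum oppr0.
Qed.

Lemma stuffle_shuffle_ratr (R : realType) m (p : nat -> rat) j :
  ratr (stuffle_shuffle m p j) = stuffle_shuffle m (fun i => ratr (p i)) j :> R.
Proof.
rewrite /stuffle_shuffle rmorphB rmorph_sum; congr (_ - _).
by apply: eq_bigr => i _; rewrite rmorphM /= ratr_nat.
Qed.

Lemma sum_even_index (R : realType) k (F : 'I_k -> R) :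
  \sum_(r : even_index k) F (val r) = \sum_(r < k | (4 <= r <= k - 3)%N && ~~ odd r) F r.
Proof.
rewrite [RHS](reindex_omap (val : even_index k -> 'I_k) insub); last first.
  by move=> i Pi; rewrite insubT.
by apply: eq_bigl => r; rewrite valK eqxx (valP r).
Qed.

Lemma relation_of_constrained (R : realType) m (p : nat -> rat) : odd m -> constrained m p ->
  double_zeta_relation R ([ffun r : even_index m.+2 =>
    stuffle_shuffle m p (val r).-1 / 'C(m, (val r).-1)%:R] : {ffun even_index m.+2 -> rat^o}).
Proof.
move=> mO cp; have [psym p0 psum Deven] := cp; exists (- (\sum_(j < m.+1) p j / 'C(m, j)%:R) / 2%:R).
pose F (r : nat) := (ratr (stuffle_shuffle m p r.-1 / 'C(m, r.-1)%:R) * double_zeta R r (m.+2 - r) : R).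
transitivity (\sum_(r : even_index m.+2) F (val r)).
  by apply: eq_bigr => r _; rewrite ffunE.
rewrite (sum_even_index (fun i : 'I_m.+2 => F i)) big_mkcond 2!big_ord_recl /= !add0r.
transitivity (\sum_(i < m) stuffle_shuffle m (fun i => ratr (p i) : R) i.+1 / 'C(m, i.+1)%:R * double_zeta R i.+2 (m - i)).
  apply: eq_bigr => i _; rewrite /F /bump /= !add1n /= negbK subSS subSS.
  have -> : ratr (stuffle_shuffle m p i.+1 / 'C(m, i.+1)%:R) =
     stuffle_shuffle m (fun i => ratr (p i) : R) i.+1 / 'C(m, i.+1)%:R.
    by rewrite rmorphM fmorphV /= ratr_nat stuffle_shuffle_ratr.
  case: ifP => // H; rewrite -stuffle_shuffle_ratr.
  suff -> : stuffle_shuffle m p i.+1 = 0 by rewrite rmorph0 !mul0r.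
  by apply: constrained_eq0 => //=; exact/negPf.
rewrite stuffle_shuffle_relation ?p0 ?rmorph0 ?odd_gt0 //; last by move=> j jm; rewrite psym.
by rewrite rmorphM rmorphN rmorph_sum fmorphV /= ratr_nat; congr (- _ / _ * _); apply: eq_bigr => j _; rewrite rmorphM fmorphV /= ratr_nat.
Qed.

(** * Descent to the rationals *)

Definition independent (K : fieldType) (V : lmodType K) d (e : 'I_d -> V) :=
  forall c : 'I_d -> K, \sum_i c i *: e i = 0 -> forall i, c i = 0.

Lemma independent0 (K : fieldType) (V : lmodType K) (e : 'I_0 -> V) : independent e.
Proof. by move=> c _ []. Qed.

(** An independent family in W of maximal size spans W; the bound N makes a maximum exist. *)
Lemma has_dim_of_bounded (K : fieldType) (V : lmodType K) (W : set V) N :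
  W 0 -> (forall a u v, W u -> W v -> W (a *: u + v)) ->
  (forall d (e : 'I_d -> V), independent e -> (forall i, W (e i)) -> (d <= N)%N) ->
  exists d, has_dim W d.
Proof.
move=> W0 Wlin bound.
pose P d := `[< exists e : 'I_d -> V, independent e /\ forall i, W (e i) >].
have P0 : exists d, P d.
  by exists 0%N; apply/asboolP; exists (fun=> 0); split=> [|[]//]; exact: independent0.
have PN d : P d -> (d <= N)%N by move=> /asboolP [e [ie We]]; exact: bound ie We.
case: (ex_maxnP P0 PN) => d /asboolP [e [ie We]] dmax.
exists d, e; split=> //; apply/seteqP; split=> [v Wv|_ [c ->]] /=; last first.
  by elim/big_ind: _ => // [u v Wu Wv|i _]; [rewrite -[u]scale1r|rewrite -[_ *: _]addr0]; exact: Wlin.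
apply: contrapT => nspan.
pose e' (i : 'I_d.+1) := if unlift ord0 i is Some j then e j else v.
suff : P d.+1 by move=> /dmax; rewrite ltnn.
apply/asboolP; exists e'; split=> [c|i]; last by rewrite /e'; case: unlift.
rewrite big_ord_recl /e' unlift_none; under eq_bigr do rewrite liftK.
have [c0|c0] := eqVneq (c ord0) 0.
  rewrite c0 scale0r add0r => /ie h i.
  by case: (unliftP ord0 i) => [j|] -> //; exact: (h j).
move=> E; case: nspan; exists (fun i => - (c ord0)^-1 * c (lift ord0 i)).
under eq_bigr do rewrite -scalerA; rewrite -scaler_sumr.
apply: (scalerI c0); rewrite scalerA mulrN divff // scaleN1r.
by apply/eqP; rewrite -addr_eq0 E.
Qed.

Lemma vspace_of_set (K : fieldType) (V : vectType K) (W : set V) :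
  W 0 -> (forall a u v, W u -> W v -> W (a *: u + v)) ->
  exists U : {vspace V}, forall v, v \in U <-> W v.
Proof.
move=> W0 Wlin.
pose P d := `[< exists U : {vspace V}, (forall v, v \in U -> W v) /\ \dim U = d >].
have P0 : exists d, P d.
  by exists 0%N; apply/asboolP; exists 0%VS; rewrite dimv0; split=> // v; rewrite memv0 => /eqP ->.
have PN d : P d -> (d <= \dim {: V})%N by move=> /asboolP [U [_ <-]]; rewrite dimvS ?subvf.
case: (ex_maxnP P0 PN) => d /asboolP [U [UW dU]] dmax.
exists U => v; split=> [/UW //|Wv].
have : P (\dim (<[v]> + U)).
  apply/asboolP; exists (<[v]> + U)%VS; split=> // w /memv_addP [x /vlineP [a ->] [u uU ->]].
  by apply: Wlin => //; exact: UW.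
move=> /dmax; rewrite -dU => dle.
have := eqEdim U (<[v]> + U); rewrite addvSr dle /= => /eqP ->.
by apply: subvP (addvSl _ _) _ (memv_line v).
Qed.

(** * The constraints as a rational matrix *)

Section Matrices.
Variables (K : numFieldType) (m : nat).

Definition coef_of (v : 'rV[K]_m.+1) (i : nat) : K := v 0 (inord i).

Definition stuffle_shuffle_mx : 'M[K]_m.+1 :=
  \matrix_(i, j) ((i == j)%:R - ((i <= j)%N * 'C(m - i, j - i))%:R).

Lemma stuffle_shuffle_mxE (v : 'rV_m.+1) j :
  (v *m stuffle_shuffle_mx) 0 j = stuffle_shuffle m (coef_of v) j.
Proof.
rewrite mxE /stuffle_shuffle.
transitivity (\sum_i (v 0 i * (i == j)%:R - (if (i <= j)%N then 'C(m - i, j - i)%:R * v 0 i else 0))).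
  by apply: eq_bigr => i _; rewrite mxE mulrBr; case: leqP => _; rewrite ?mul1n ?mul0n; ring.
rewrite sumrB; congr (_ - _).
  rewrite (bigD1 j) //= eqxx mulr1 big1 ?addr0 /coef_of ?inord_val // => i /negbTE ->.
  by rewrite mulr0.
rewrite (big_ord_widen m.+1 (fun i => 'C(m - i, j - i)%:R * coef_of v i)) // [RHS]big_mkcond.
by apply: eq_bigr => i _; rewrite ltnS /coef_of inord_val.
Qed.

Definition symmetric_mx : 'M[K]_m.+1 := \matrix_(i, j) ((i == j)%:R - (i == rev_ord j)%:R).

(** The four conditions of [constrained] side by side, one block of columns each. All entries are
    integers, so the matrix over any numeric field is the image of the one over [rat]. *)
Definition constraint_mx : 'M[K]_(m.+1, _) :=
  row_mx symmetric_mx (row_mx (\col_i (i == ord0)%:R)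
    (row_mx (const_mx 1 : 'cV_m.+1) (\matrix_(i, j) ((~~ odd j)%:R * stuffle_shuffle_mx i j)))).

Lemma sum_delta (F : 'I_m.+1 -> K) j : \sum_i F i * (i == j)%:R = F j.
Proof.
by rewrite (bigD1 j) //= eqxx mulr1 big1 ?addr0 // => i /negbTE ->; rewrite mulr0.
Qed.

Lemma constraint_mxP (v : 'rV_m.+1) : reflect (constrained m (coef_of v)) (v *m constraint_mx == 0).
Proof.
rewrite !mul_mx_row !row_mx_eq0.
have E1 j : (v *m symmetric_mx) 0 j = v 0 j - v 0 (rev_ord j).
  by rewrite mxE; under eq_bigr do rewrite mxE mulrBr; rewrite sumrB !sum_delta.
have E2 : (v *m \col_i (i == ord0)%:R) 0 0 = v 0 ord0.
  by rewrite mxE; under eq_bigr do rewrite mxE; rewrite sum_delta.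
have E3 : (v *m const_mx 1 : 'rV_1) 0 0 = \sum_j v 0 j.
  by rewrite mxE; apply: eq_bigr => i _; rewrite mxE mulr1.
have E4 j : (v *m \matrix_(i, j) ((~~ odd j)%:R * stuffle_shuffle_mx i j)) 0 j =
    (~~ odd j)%:R * stuffle_shuffle m (coef_of v) j.
  by rewrite -stuffle_shuffle_mxE !mxE mulr_sumr; apply: eq_bigr => i _; rewrite mxE; ring.
have E0 i : coef_of v (val i) = v 0 i by rewrite /coef_of inord_val.
have inordE j : (j <= m)%N -> j = (inord j : 'I_m.+1) :> nat by move=> jm; rewrite inordK.
have row0 n (u : 'rV[K]_n) : (forall j, u 0 j = 0) -> u = 0.
  by move=> h; apply/rowP => j; rewrite h mxE.
apply: (iffP and4P) => [[/eqP s /eqP z /eqP o /eqP D]|[s z o D]].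
  split.
  - move=> j /inordE ->; have /eqP := E1 (inord j); rewrite s mxE eq_sym subr_eq0 -!E0 /= subSS.
    by move=> /eqP.
  - by have := E2; rewrite z mxE -E0.
  - by have := E3; rewrite o mxE => e; rewrite [RHS]e; apply: eq_bigr => j _; rewrite E0.
  - by move=> j /inordE e oj; have := E4 (inord j); rewrite D mxE -e oj mul1r.
split; apply/eqP/row0 => j.
- by rewrite E1 -!E0 /= subSS s ?subrr // -ltnS.
- by rewrite ord1 E2 -E0.
- by rewrite ord1 E3 -[RHS]o; apply: eq_bigr => i _; rewrite E0.
- by rewrite E4; case: (boolP (odd j)) => oj; rewrite /= ?mul0r // D ?mulr0 // -ltnS.
Qed.

End Matrices.

Lemma map_stuffle_shuffle_mx (K : numFieldType) m :
  map_mx ratr (stuffle_shuffle_mx rat m) = stuffle_shuffle_mx K m.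
Proof. by apply/matrixP => i j; rewrite !mxE rmorphB /= !ratr_nat. Qed.

Lemma map_constraint_mx (K : numFieldType) m :
  map_mx ratr (constraint_mx rat m) = constraint_mx K m.
Proof.
rewrite !map_row_mx; congr row_mx; last congr row_mx; last congr row_mx.
- by apply/matrixP => i j; rewrite !mxE rmorphB /= !ratr_nat.
- by apply/matrixP => i j; rewrite !mxE /= !ratr_nat.
- by apply/matrixP => i j; rewrite !mxE rmorph1.
- by apply/matrixP => i j; rewrite !mxE rmorphM rmorphB /= !ratr_nat.
Qed.

Section Descent.
Variables (K : numFieldType) (m d : nat) (v : 'M[K]_(d, m.+1)).
Hypothesis v_constrained : forall i, constrained m (coef_of (row i v)).
Hypothesis v_free : row_free (v *m stuffle_shuffle_mx K m).

(** Rank, kernel and product commute with [ratr]; over K the d independent rows lie in the row space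
    of the mapped matrix. *)
Lemma rational_rank : (d <= \rank (kermx (constraint_mx rat m) *m stuffle_shuffle_mx rat m))%N.
Proof.
rewrite -(mxrank_map (@ratr K)) map_mxM map_kermx map_constraint_mx map_stuffle_shuffle_mx.
rewrite -(eqP v_free); apply: mxrankS; apply: submxMr; apply/sub_kermxP.
apply/row_matrixP => i; rewrite row_mul row0; apply/eqP/constraint_mxP; exact: v_constrained.
Qed.

End Descent.

(** A basis of the row space comes from constrained sequences [y i]. Passing to relations forgets
    the entries outside the index range and divides the others by binomials; the forgotten entries
    are 0 by [constrained_eq0], so independence survives. *)
Lemma dim_relations (R : realType) m (V : {vspace {ffun even_index m.+2 -> rat^o}}) :
  odd m -> (forall a, a \in V <-> double_zeta_relation R a) ->
  (\rank (kermx (constraint_mx rat m) *m stuffle_shuffle_mx rat m) <= \dim V)%N.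
Proof.
move=> mO HV; set M := kermx _ *m _.
have /submxP [Y HY] : (row_base M <= M)%MS by rewrite eq_row_base.
pose y i := row i (Y *m kermx (constraint_mx rat m)).
have cy i : constrained m (coef_of (y i)).
  by apply/constraint_mxP; rewrite /y row_mul -mulmxA mulmx_ker mulmx0.
pose rel (p : nat -> rat) := [ffun r : even_index m.+2 =>
  stuffle_shuffle m p (val r).-1 / 'C(m, (val r).-1)%:R] : {ffun even_index m.+2 -> rat^o}.
pose X := [tuple rel (coef_of (y i)) | i < \rank M].
have XV : (<<X>> <= V)%VS.
  apply/span_subvP => a /mapP [i _ ->]; apply/HV.
  exact: relation_of_constrained.
have Xfree : free X.
  apply/freeP => c Hc i.
  pose w := (\row_i c i) *m (Y *m kermx (constraint_mx rat m)).
  have cw : constrained m (coef_of w).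
    by apply/constraint_mxP; rewrite /w -mulmxA -(mulmxA Y) mulmx_ker !mulmx0.
  have wD : w *m stuffle_shuffle_mx rat m = 0.
    apply/rowP => j; rewrite stuffle_shuffle_mxE mxE.
    have jm : (j <= m)%N by rewrite -ltnS.
    case: (boolP ((3 < j.+1 <= m - 1)%N && odd j)) => H; last exact: constrained_eq0.
    have jk : (j.+1 < m.+2)%N by rewrite !ltnS.
    have He : (4 <= Ordinal jk <= m.+2 - 3)%N && ~~ odd (Ordinal jk) by move: H; rewrite /= negbK; lia.
    pose r : even_index m.+2 := Sub (Ordinal jk) He.
    have := congr1 (fun a : {ffun even_index m.+2 -> rat^o} => a r) Hc.
    rewrite sum_ffunE ffunE => E.
    have Dw : stuffle_shuffle m (coef_of w) j = \sum_l c l * stuffle_shuffle m (coef_of (y l)) j.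
      rewrite -stuffle_shuffle_mxE /w -mulmxA mxE; apply: eq_bigr => l _.
      by rewrite -stuffle_shuffle_mxE /y -row_mul !mxE.
    have C0 : 'C(m, j)%:R != 0 :> rat by rewrite pnatr_eq0 -lt0n bin_gt0.
    rewrite Dw; apply: (mulIf (invr_neq0 C0)); rewrite mul0r mulr_suml -[RHS]E.
    apply: eq_bigr => l _; rewrite !ffunE (nth_map l) ?size_enum_ord // nth_ord_enum ffunE.
    by rewrite -mulrA.
  have : (\row_i c i) *m row_base M = 0 by rewrite HY /M (mulmxA Y) mulmxA wD.
  rewrite -[RHS](mul0mx _ (row_base M)) => /(row_free_inj (row_base_free M)) /rowP /(_ i).
  by rewrite !mxE.
by rewrite -[X in (X <= _)%N](size_tuple X) -(eqP Xfree); exact: dimvS.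
Qed.

Section Sums.
Variables (K : numFieldType) (n d : nat) (c : 'I_d -> K) (P : 'I_d -> {poly K}).

Lemma size_sum_scale N : (forall i, (size (P i) <= N)%N) -> (size (\sum_i c i *: P i)%R <= N)%N.
Proof.
move=> h; apply: leq_trans (size_sum _ _ _) _; apply/bigmax_leqP => i _.
exact: leq_trans (size_scale_leq _ _) (h i).
Qed.

Lemma hom_sum x y : hom n (\sum_i c i *: P i) x y = \sum_i c i * hom n (P i) x y.
Proof.
rewrite /hom; under eq_bigr do rewrite coef_sum !mulr_suml.
rewrite exchange_big; apply: eq_bigr => i _; rewrite mulr_sumr; apply: eq_bigr => j _.
by rewrite coefZ !mulrA.
Qed.

Lemma cocycle_sum : (forall i, cocycle n (P i)) -> cocycle n (\sum_i c i *: P i).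
Proof.
move=> h; split=> [|x y|x y].
- by apply: size_sum_scale => i; case: (h i).
- by rewrite !hom_sum -sumrN; apply: eq_bigr => i _; have [_ -> _] := h i; rewrite mulrN.
- rewrite !hom_sum -big_split; apply: eq_bigr => i _ /=.
  by have [_ _ e] := h i; rewrite -mulrDr -e.
Qed.
End Sums.

(** * Lower bounds for the rank *)

Section Relators.
Variables (K : numFieldType) (m : nat).
Implicit Types (q : {poly K}).

Lemma eq_stuffle_shuffle (p p' : nat -> K) j :
  (forall i, (i <= j)%N -> p i = p' i) -> stuffle_shuffle m p j = stuffle_shuffle m p' j.
Proof.
move=> h; rewrite /stuffle_shuffle h //; congr (_ - _).
by apply: eq_bigr => i _; rewrite h // -ltnS.
Qed.

Lemma eq_constrained (p p' : nat -> K) :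
  (forall i, (i <= m)%N -> p i = p' i) -> constrained m p -> constrained m p'.
Proof.
move=> h [s z o D]; split=> [j jm|||j jm oj].
- by rewrite -!h ?leq_subr // s.
- by rewrite -h.
- by rewrite -[RHS]o; apply: eq_bigr => j _; rewrite h // -ltnS.
- by rewrite -[RHS](D j jm oj); apply: eq_stuffle_shuffle => i ij; rewrite h // (leq_trans ij).
Qed.

Lemma symm_constrained q : odd m -> relator m q -> constrained m (fun i => (symm m q)`_i).
Proof.
move=> mO qR; split.
- by move=> j jm; exact: symm_coef.
- exact: symm_coef0.
- exact: symm_sum.
- by move=> j jm oj; exact: D_even.
Qed.

Lemma relator_sum d (c : 'I_d -> K) (q : 'I_d -> {poly K}) :
  (forall i, relator m (q i)) -> relator m (\sum_i c i *: q i).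
Proof.
move=> h; split=> [|j oj|x y].
- by apply: size_sum_scale => i; case: (h i).
- by rewrite coef_sum big1 // => i _; rewrite coefZ; have [_ -> //] := h i; rewrite mulr0.
- rewrite !hom_sum -!big_split; apply: eq_bigr => i _ /=.
  by have [_ _ <-] := h i; rewrite !mulrDr.
Qed.

Lemma symm_sum_scale d (c : 'I_d -> K) (q : 'I_d -> {poly K}) :
  symm m (\sum_i c i *: q i) = \sum_i c i *: symm m (q i).
Proof.
elim/big_ind2: _ => [|p r p' r' <- <-|i _]; [|exact: symmD|exact: symmZ].
by rewrite -[in LHS](scale0r 0) symmZ scale0r.
Qed.

(** Independence is asked modulo constants, the multiples of Y^m, because these are what the map
    from relators to relations kills. *)
Lemma rank_ge_of_relators d (q : 'I_d -> {poly K}) : odd m ->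
  (forall i, relator m (q i)) ->
  (forall c : 'I_d -> K, (forall i, (0 < i)%N -> (\sum_l c l *: q l)`_i = 0) -> forall l, c l = 0) ->
  (d <= \rank (kermx (constraint_mx rat m) *m stuffle_shuffle_mx rat m))%N.
Proof.
move=> mO qR qfree; pose v : 'M[K]_(d, m.+1) := \matrix_(i, j) (symm m (q i))`_j.
apply: (@rational_rank K m d v) => [i|].
  apply: eq_constrained (symm_constrained mO (qR i)) => j jm.
  by rewrite /coef_of !mxE inordK.
apply: inj_row_free => u; rewrite mulmxA => uD.
have QR := relator_sum (fun l => u 0 l) qR.
have {}uD j : (j <= m)%N -> stuffle_shuffle m (fun i => (symm m (\sum_l u 0 l *: q l))`_i) j = 0.
  move=> jm; have := congr1 (fun w : 'rV[K]_m.+1 => w 0 (inord j)) uD.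
  rewrite stuffle_shuffle_mxE mxE inordK // => E; rewrite -[RHS]E.
  apply: eq_stuffle_shuffle => i ij; rewrite /coef_of mxE symm_sum_scale coef_sum.
  by apply: eq_bigr => l _; rewrite coefZ mxE inordK // ltnS (leq_trans ij).
by apply/rowP => l; rewrite mxE (qfree (fun l => u 0 l)) // => i i0; exact: D_inj mO QR uD _ i0.
Qed.

End Relators.

Section Parts.
Variable K : numFieldType.

Lemma refl_sum d (c : 'I_d -> K) (P : 'I_d -> {poly K}) :
  refl (\sum_i c i *: P i) = \sum_i c i *: refl (P i).
Proof.
apply/polyP => j; rewrite refl_coef !coef_sum mulr_sumr.
by apply: eq_bigr => i _; rewrite !coefZ refl_coef mulrCA.
Qed.

Lemma part_sum a d (c : 'I_d -> K) (P : 'I_d -> {poly K}) :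
  (\sum_i c i *: P i) + a *: refl (\sum_i c i *: P i) = \sum_i c i *: (P i + a *: refl (P i)).
Proof.
rewrite refl_sum scaler_sumr -big_split; apply: eq_bigr => i _ /=.
by rewrite scalerDr !scalerA mulrC.
Qed.

Lemma dYpoly_sum m d (c : 'I_d -> K) (P : 'I_d -> {poly K}) :
  dYpoly m (\sum_i c i *: P i) = \sum_i c i *: dYpoly m (P i).
Proof.
apply/polyP => j; rewrite coef_poly !coef_sum.
case: ifP => jm; last by rewrite big1 // => i _; rewrite coefZ coef_poly jm mulr0.
by rewrite mulr_sumr; apply: eq_bigr => i _; rewrite !coefZ coef_poly jm mulrCA.
Qed.

Lemma rank_ge_of_cocycles n d1 d2 (P : 'I_d1 -> {poly K}) (Q : 'I_d2 -> {poly K}) : ~~ odd n ->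
  (forall i, cocycle n (P i)) -> (forall i, cocycle n.+2 (Q i)) ->
  (forall c : 'I_d1 -> K, (forall z, (\sum_i c i *: P i).[z] = (\sum_i c i *: P i).[- z]) ->
    forall i, c i = 0) ->
  (forall (c : 'I_d2 -> K) b, (forall z, (\sum_i c i *: Q i).[z] + (\sum_i c i *: Q i).[- z] =
      b * (z ^+ n.+2 - 1)) -> forall i, c i = 0) ->
  (d1 + d2 <= \rank (kermx (constraint_mx rat n.+1) *m stuffle_shuffle_mx rat n.+1))%N.
Proof.
move=> nE cP cQ freeP freeQ.
(* Multiplication by X raises the degree n, and d/dY lowers the degree n+2: both families land in
   degree n+1. *)
pose q (l : 'I_(d1 + d2)) : {poly K} := match fintype.split l with
  | inl i => 'X * (P i + (-1) *: refl (P i))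
  | inr i => dYpoly n.+1 (Q i + 1 *: refl (Q i)) end.
apply: (@rank_ge_of_relators K n.+1 _ q) => //= [l|c].
  rewrite /q; case: fintype.split => i; first by apply: relator_odd => //; exact: odd_part.
  by apply: relator_even => //; apply: even_part => //; rewrite /= negbK.
rewrite big_split_ord /=.
pose c1 i := c (lshift d2 i); pose c2 i := c (rshift d1 i).
pose P' := \sum_i c1 i *: P i; pose Q' := \sum_i c2 i *: Q i.
have -> : \sum_i c (lshift d2 i) *: q (lshift d2 i) = 'X * (P' + (-1) *: refl P').
  rewrite part_sum mulr_sumr; apply: eq_bigr => i _; rewrite /q.
  by rewrite (unsplitK (inl i)) scalerAr.
have -> : \sum_i c (rshift d1 i) *: q (rshift d1 i) = dYpoly n.+1 (Q' + 1 *: refl Q').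
  rewrite part_sum dYpoly_sum; apply: eq_bigr => i _; rewrite /q.
  by rewrite (unsplitK (inr i)).
have oP : odd_cocycle n (P' + (-1) *: refl P').
  by apply: odd_part => //; exact: cocycle_sum.
have eQ : even_cocycle n.+2 (Q' + 1 *: refl Q').
  by apply: even_part; rewrite /= ?negbK //; exact: cocycle_sum.
move=> /(relator_inj oP eQ) [P0 Q0].
have h1 i : c1 i = 0.
  apply: freeP => z; have := congr1 (fun p : {poly K} => p.[z]) P0.
  by rewrite hornerD hornerZ mulN1r refl_horner horner0 => /eqP; rewrite subr_eq0 => /eqP.
have h2 i : c2 i = 0.
  apply: (freeQ _ (- (Q' + 1 *: refl Q')`_0)) => z; have := congr1 (fun p : {poly K} => p.[z]) Q0.
  rewrite scale1r hornerD refl_horner => ->.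
  by rewrite hornerZ hornerD hornerN hornerXn hornerC; ring.
by move=> l; rewrite -(fintype.splitK l); case: fintype.split => i; [exact: h1|exact: h2].
Qed.
End Parts.

Local Open Scope complex_scope.

(** * Eichler integrals of cusp forms *)

Notation RR := Rdefinitions.R.
Notation CC := (RR[i]).

(* Coquelicot's [C] is the set of pairs of reals; derivatives and integrals are
   transported from it along [toC]. *)
Definition toC (z : CC) : Complex.C := (complex.Re z, complex.Im z).
Definition ofC (p : Complex.C) : CC := Complex (fst p) (snd p).

Lemma toCK : cancel toC ofC. Proof. by case. Qed.
Lemma ofCK : cancel ofC toC. Proof. by case. Qed.
Lemma toC_inj : injective toC. Proof. exact: can_inj toCK. Qed.

Lemma toCD x y : toC (x + y) = Complex.Cplus (toC x) (toC y).
Proof. by case: x y => [a b] [c d]. Qed.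
Lemma toCN x : toC (- x) = Complex.Copp (toC x).
Proof. by case: x. Qed.
Lemma toCM x y : toC (x * y) = Complex.Cmult (toC x) (toC y).
Proof. by case: x y => [a b] [c d]. Qed.
Lemma toC0 : toC 0 = Complex.RtoC Rdefinitions.R0. Proof. by []. Qed.
Lemma toC1 : toC 1 = Complex.RtoC Rdefinitions.R1. Proof. by []. Qed.
Lemma toCB x y : toC (x - y) = Complex.Cminus (toC x) (toC y).
Proof. by rewrite toCD toCN. Qed.
Lemma toCr (t : RR) : toC t%:C = Complex.RtoC t. Proof. by []. Qed.
Lemma toCi : toC 'i = Complex.Ci. Proof. by []. Qed.
Lemma toCV x : x != 0 -> toC x^-1 = Complex.Cinv (toC x).
Proof.
move=> x0; have xn : toC x <> Complex.RtoC Rdefinitions.R0.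
  by move=> /(toC_inj (x2 := 0)) E; rewrite E eqxx in x0.
have := Complex.Cinv_r _ xn.
have : Complex.Cmult (toC x) (toC x^-1) = Complex.RtoC Rdefinitions.R1.
  by rewrite -toCM divff.
move=> <- E.
rewrite -[RHS]Complex.Cmult_1_l -[LHS]Complex.Cmult_1_l -toC1 -(mulVf x0) toCM -!Complex.Cmult_assoc.
by rewrite E.
Qed.

Definition cderiv (f : CC -> CC) (z l : CC) : Prop :=
  HalfPlane.cderiv (fun p => toC (f (ofC p))) (toC z) (toC l).

Lemma cd_const c z : cderiv (fun _ => c) z 0.
Proof. exact: HalfPlane.cderiv_const. Qed.
Lemma cd_id z : cderiv id z 1.
Proof.
move=> e e0; have [d [d0 H]] := HalfPlane.cderiv_id (toC z) e e0; by exists d; split=> // h hd; rewrite !ofCK; apply: H.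
Qed.
Lemma cd_eqf f g z l : f =1 g -> cderiv f z l -> cderiv g z l.
Proof. by move=> /funext ->. Qed.
Lemma cdD f g z l k : cderiv f z l -> cderiv g z k -> cderiv (fun x => f x + g x) z (l + k).
Proof.
move=> Hf Hg; rewrite /cderiv toCD.
have -> : (fun p => toC (f (ofC p) + g (ofC p))) =
  (fun p => Complex.Cplus (toC (f (ofC p))) (toC (g (ofC p)))) by apply/funext => p; rewrite toCD.
exact: HalfPlane.cderiv_plus.
Qed.
Lemma cdM f g z l k : cderiv f z l -> cderiv g z k -> cderiv (fun x => f x * g x) z (l * g z + f z * k).
Proof.
move=> Hf Hg; rewrite /cderiv toCD !toCM.
have -> : (fun p => toC (f (ofC p) * g (ofC p))) =
  (fun p => Complex.Cmult (toC (f (ofC p))) (toC (g (ofC p)))) by apply/funext => p; rewrite toCM.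
have := HalfPlane.cderiv_mult _ _ _ _ _ Hf Hg; by rewrite !toCK.
Qed.
Lemma cdZ c f z l : cderiv f z l -> cderiv (fun x => c * f x) z (c * l).
Proof. by move=> H; have := cdM (cd_const c z) H; rewrite mul0r add0r. Qed.
Lemma cdN f z l : cderiv f z l -> cderiv (fun x => - f x) z (- l).
Proof.
move=> /(cdZ (-1)); rewrite mulN1r; apply: cd_eqf => x; by rewrite mulN1r.
Qed.
Lemma cdB f g z l k : cderiv f z l -> cderiv g z k -> cderiv (fun x => f x - g x) z (l - k).
Proof. by move=> Hf /cdN; apply: cdD. Qed.
Lemma cd_comp f g z l k : cderiv f (g z) l -> cderiv g z k -> cderiv (fun x => f (g x)) z (l * k).
Proof.
move=> Hf Hg; rewrite /cderiv toCM.
have -> : (fun p => toC (f (g (ofC p)))) =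
  (fun p => (fun q => toC (f (ofC q))) ((fun q => toC (g (ofC q))) p)).
  by apply/funext => p /=; rewrite toCK.
have Hf' : HalfPlane.cderiv (fun q => toC (f (ofC q))) (toC (g (ofC (toC z)))) (toC l) by rewrite toCK.
exact: (HalfPlane.cderiv_comp _ (fun q => toC (g (ofC q))) _ _ _ Hf' Hg).
Qed.
Lemma cd_inv z : z != 0 -> cderiv (fun x => x^-1) z (- z ^- 2).
Proof.
move=> z0; have zn : toC z <> Complex.RtoC Rdefinitions.R0.
  by move=> /(toC_inj (x2 := 0)) E; rewrite E eqxx in z0.
have M0 := proj1 (Complex.Cmod_gt_0 _) zn.
rewrite /cderiv toCN expr2 invfM toCM toCV //.
apply: (HalfPlane.cderiv_ext _ _ _ _ _ M0 _ (HalfPlane.cderiv_inv _ zn)) => h hM.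
rewrite toCV ?ofCK // -(ofCK h) -toCD toCK.
apply/eqP => /addr0_eq E; move: hM.
by rewrite -(ofCK h) -E toCN Complex.Cmod_opp => /RIneq.Rlt_irrefl.
Qed.
Lemma cdX f n z l : cderiv f z l -> cderiv (fun x => f x ^+ n) z (n%:R * f z ^+ n.-1 * l).
Proof.
move=> Hf; elim: n => [|n IH].
  by rewrite !mul0r; apply: cd_eqf (cd_const 1 z) => x.
have := cdM Hf IH; rewrite [_ + _](_ : _ = n.+1%:R * f z ^+ n * l).
  by apply: cd_eqf => x; rewrite exprS.
by case: n {IH} => [|n]; rewrite /= ?mul0r ?expr0; [ring|rewrite exprS; ring].
Qed.
Lemma cd_sum m (f : nat -> CC -> CC) (l : nat -> CC) z :
  (forall i, (i < m)%N -> cderiv (f i) z (l i)) ->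
  cderiv (fun x => \sum_(i < m) f i x) z (\sum_(i < m) l i).
Proof.
elim: m => [|m IH] H.
  by rewrite big_ord0; apply: cd_eqf (cd_const 0 z) => x; rewrite big_ord0.
rewrite big_ord_recr /=; apply: (cd_eqf (f := fun x => \sum_(i < m) f i x + f m x)).
  by move=> x; rewrite big_ord_recr.
by apply: cdD; [apply: IH => i im; apply: H; rewrite ltnS ltnW|apply: H].
Qed.
Lemma cd_val f z l k : cderiv f z l -> l = k -> cderiv f z k. Proof. by move=> ? <-. Qed.

Definition cbar (z : CC) : CC := Complex (complex.Re z) (- complex.Im z).

Definition up (z : CC) := 0 < complex.Im z.
Lemma upP z : HalfPlane.up (toC z) <-> up z.
Proof. by rewrite /HalfPlane.up /up; split => [/RltP|H]; [|apply/RltP]. Qed.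
Lemma upCP p : HalfPlane.up p <-> up (ofC p).
Proof. by rewrite -upP ofCK. Qed.

Definition cuspidal (f : CC -> CC) := HalfPlane.cuspidal (fun p => toC (f (ofC p))).

Lemma cuspidal_prim f : cuspidal f -> exists F, cuspidal F /\ forall z, up z -> cderiv F z (f z).
Proof.
move=> /HalfPlane.cuspidal_prim [F [F_cuspidal HF]]; exists (fun z => ofC (F (toC z))).
have E : (fun p => toC (ofC (F (toC (ofC p))))) = F by apply/funext => p; rewrite !ofCK.
split; first by rewrite /cuspidal E.
move=> z /upP /HF; by rewrite /cderiv E toCK.
Qed.

Lemma cuspidal_periodic f z : cuspidal f -> up z -> f (z + 1) = f z.
Proof.
move=> [_ [H _]] /upP /H; rewrite toCK -toC1 -toCD toCK; exact: toC_inj.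
Qed.

Lemma cd0_const f : (forall z, up z -> cderiv f z 0) -> forall z w, up z -> up w -> f z = f w.
Proof.
move=> H z w /upP uz /upP uw; apply: toC_inj; rewrite -{1}(toCK z) -{1}(toCK w).
apply: (HalfPlane.cderiv0_const (fun p => toC (f (ofC p)))) uz uw => p /upCP /H; by rewrite /cderiv ofCK.
Qed.

Lemma up_neg_inv z : up z -> up (- z^-1).
Proof.
case: z => x y; rewrite /up /= => y0.
rewrite opprK divr_gt0 // ltr_wpDl ?sqr_ge0 // exprn_gt0 //.
Qed.

Lemma up_neq0 z : up z -> z != 0.
Proof. by apply: contraTneq => ->; rewrite /up /= ltxx. Qed.

Lemma up_negconj z : up z -> up (- cbar z).
Proof. by case: z => x y; rewrite /up /= opprK. Qed.

Lemma up_add1 z : up z -> up (z + 1).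
Proof. by case: z => x y; rewrite /up /= addr0. Qed.

Lemma bin_ffact_split n i j : (i <= j)%N -> (j <= n)%N ->
  ('C(n, j) * j ^_ i = n ^_ i * 'C(n - i, j - i))%N.
Proof.
by move=> ij jn; rewrite -!bin_ffact mulnA bin_mul_bin // mulnAC.
Qed.

(** * The Eichler integral under z -> -1/z *)

Section Eichler.
Variables (n : nat) (F : nat -> CC -> CC).

(** Integration by parts, j times, of z^j [F 0 z]; it plays the role of the integral from i infinity
    to z. *)
Definition moment (j : nat) (z : CC) : CC :=
  \sum_(i < j.+1) (-1) ^+ i * (j ^_ i)%:R * z ^+ (j - i) * F i.+1 z.

(** As a function of x, the primitive of (z - x)^n [F 0 x] found by n integrations by parts. The
    variable z stays separate because Phi also needs the point (-z, -conj z). *)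
Definition eichler (z x : CC) : CC :=
  \sum_(i < n.+1) (n ^_ i)%:R * (z - x) ^+ (n - i) * F i.+1 x.

Lemma eichler_moment z x : eichler z x =
  \sum_(j < n.+1) 'C(n, j)%:R * (-1) ^+ j * z ^+ (n - j) * moment j x.
Proof.
pose G i j := ('C(n, j) * j ^_ i)%:R * (-1) ^+ (j - i) * z ^+ (n - j) * x ^+ (j - i) * F i.+1 x.
transitivity (\sum_(j < n.+1) \sum_(i < j.+1) G i j); last first.
  apply: eq_bigr => j _; rewrite /moment mulr_sumr; apply: eq_bigr => i _.
  have ij : (i <= j)%N by rewrite -ltnS.
  have s2 : (-1 : CC) ^+ i * (-1) ^+ i = 1 by rewrite -exprMn mulrNN mulr1 expr1n.
  have -> : (-1) ^+ j = (-1) ^+ (j - i) * (-1) ^+ i :> CC by rewrite -exprD subnK.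
  by rewrite /G natrM -[LHS]mulr1 -[X in _ * X = _]s2; ring.
rewrite sum_triangle /eichler; apply: eq_bigr => i _.
have iN : (i <= n)%N by rewrite -ltnS.
rewrite exprBn mulr_sumr mulr_suml; apply: eq_bigr => l _.
have lin : (l + i <= n)%N by rewrite addnC -leq_subRL // -ltnS.
rewrite /G bin_ffact_split ?leq_addl // addnK natrM -mulr_natr.
by rewrite subnDA subnAC; ring.
Qed.

Hypothesis dF : forall j z, up z -> cderiv (F j.+1) z (F j z).

Lemma cd_moment j z : up z -> cderiv (moment j) z (z ^+ j * F 0 z).
Proof.
(* The i-th summand has derivative [u i - u i.+1]; the sum telescopes to [u 0], since [j ^_ j.+1] is
   0. *)
move=> uz; pose u i := (-1) ^+ i * (j ^_ i)%:R * z ^+ (j - i) * F i z.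
have : cderiv (moment j) z (\sum_(i < j.+1) (u i - u i.+1)).
  apply: (cd_sum (f := fun i x => (-1) ^+ i * (j ^_ i)%:R * x ^+ (j - i) * F i.+1 x)
     (l := fun i => u i - u i.+1)) => i _.
  have := cdM (cdZ ((-1) ^+ i * (j ^_ i)%:R) (cdX (j - i) (cd_id z))) (dF i uz).
  move/cd_val; apply; rewrite /u ffactnSr natrM exprS mulr1.
  rewrite -subn1 -subnDA addn1; ring.
move/cd_val; apply.
rewrite -(big_mkord xpredT (fun i => u i - u i.+1)) sumrB big_nat_recl // [X in _ - X]big_nat_recr //=.
have -> : u j.+1 = 0 by rewrite /u ffact_small // mulr0n mulr0 !mul0r.
have -> : u 0%N = z ^+ j * F 0 z by rewrite /u expr0 ffactn0 subn0 !mul1r.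
by rewrite addr0 addrK.
Qed.

Hypothesis n_even : ~~ odd n.
Hypothesis hS : forall z, up z -> F 0 (- z^-1) = z ^+ n.+2 * F 0 z.

(** By modularity of weight n+2 the substitution t = -1/z turns t^j f(t) dt into (-1)^j z^(n-j) f(z)
    dz, so the difference of the two moments has derivative 0. *)
Lemma moment_S j : (j <= n)%N -> exists c, forall z, up z ->
  moment j (- z^-1) = (-1) ^+ j * moment (n - j) z + c.
Proof.
move=> jn; pose h z := moment j (- z^-1) - (-1) ^+ j * moment (n - j) z.
have h0 : forall z, up z -> cderiv h z 0.
  move=> z uz; have z0 := up_neq0 uz.
  have := cdB (cd_comp (g := fun x => - x^-1) (cd_moment j (up_neg_inv uz)) (cdN (cd_inv z0)))
     (cdZ ((-1) ^+ j) (cd_moment (n - j) uz)).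
  move/cd_val; apply; rewrite hS //.
  rewrite -[in X in z ^+ X](subnK jn) -addn2 !exprD [(- z^-1) ^+ j]exprNn.
  have e : z^-1 ^+ j * z ^+ j = 1 by rewrite exprVn mulVf // expf_neq0.
  have e2 : z ^- 2 * z ^+ 2 = 1 by rewrite mulVf // expf_neq0.
  transitivity ((-1) ^+ j * (z ^+ (n - j) * F 0 z) * ((z^-1 ^+ j * z ^+ j) * (z ^- 2 * z ^+ 2) - 1)); first ring.
  by rewrite e e2; ring.
exists (h 'i) => z uz; have ui : up 'i by rewrite /up /= ltr01.
by rewrite -(cd0_const h0 uz ui) /h; ring.
Qed.

(** Expanded in moments, the statement is [moment_S] coefficient by coefficient; the constants there
    are, up to binomials, the coefficients of the period polynomial. One P serves for all x. *)
Lemma eichler_S : exists P : {poly CC}, (size P <= n.+1)%N /\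
  forall z x, z != 0 -> up x ->
    z ^+ n * eichler (- z^-1) (- x^-1) = eichler z x + P.[z].
Proof.
have /choice [c hc] : forall j : nat, exists c, (j <= n)%N -> forall z, up z ->
    moment j (- z^-1) = (-1) ^+ j * moment (n - j) z + c.
  move=> j; case: (leqP j n) => [/moment_S [c H]|]; first by exists c.
  by exists 0.
exists (\poly_(j < n.+1) ('C(n, j)%:R * c j)); split; first exact: size_poly.
move=> z x z0 ux; rewrite horner_poly !eichler_moment mulr_sumr.
rewrite [X in _ = X + _](reindex_inj rev_ord_inj) /= -big_split /=.
apply: eq_bigr => j _; rewrite !subSS.
have jn : (j <= n)%N by rewrite -ltnS.
rewrite !(subKn jn) hc // bin_sub //.
have sn : (-1) ^+ (n - j) = (-1) ^+ j :> CC.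
  by rewrite -signr_odd oddB // (negbTE n_even) signr_odd.
have s2 : (-1 : CC) ^+ j * (-1) ^+ j = 1 by rewrite -exprMn mulrNN mulr1 expr1n.
rewrite [(- z^-1) ^+ (n - j)]exprNn sn -[in z ^+ n](subnK jn) exprD.
have e : z^-1 ^+ (n - j) * z ^+ (n - j) = 1 by rewrite exprVn mulVf // expf_neq0.
set s := (-1) ^+ j in s2 *; set M := moment _ x.
transitivity ((z^-1 ^+ (n - j) * z ^+ (n - j)) * (s * s) * ('C(n, j)%:R * z ^+ j * (s * M + c j))); first by ring.
by rewrite e s2; ring.
Qed.

End Eichler.

Lemma cd_rderiv h (t : RR) l : cderiv h t%:C l -> HalfPlane.rderiv (fun s => toC (h s%:C)) t (toC l).
Proof. exact: HalfPlane.cderiv_real. Qed.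

Definition cont_at (f : CC -> CC) (z : CC) : Prop :=
  HalfPlane.ccont (fun p => toC (f (ofC p))) (complex.Re z) (complex.Im z).

Lemma cont_at_cd f z l : cderiv f z l -> cont_at f z.
Proof. case: z => x y; exact: HalfPlane.ccont_hol. Qed.
Lemma cont_atD f g z : cont_at f z -> cont_at g z -> cont_at (fun x => f x + g x) z.
Proof.
move=> Hf Hg; rewrite /cont_at.
have -> : (fun p => toC (f (ofC p) + g (ofC p))) =
  (fun p => Complex.Cplus (toC (f (ofC p))) (toC (g (ofC p)))) by apply/funext => p; rewrite toCD.
exact: HalfPlane.ccont_plus.
Qed.
Lemma cont_atM f g z : cont_at f z -> cont_at g z -> cont_at (fun x => f x * g x) z.
Proof.
move=> Hf Hg; rewrite /cont_at.
have -> : (fun p => toC (f (ofC p) * g (ofC p))) =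
  (fun p => Complex.Cmult (toC (f (ofC p))) (toC (g (ofC p)))) by apply/funext => p; rewrite toCM.
exact: HalfPlane.ccont_mult.
Qed.
Lemma cont_at_const c z : cont_at (fun _ => c) z.
Proof. exact: cont_at_cd (cd_const c z). Qed.
Lemma cont_at_reflect f z l : cderiv f (- cbar z) l -> cont_at (fun x => f (- cbar x)) z.
Proof.
case: z => x y H; rewrite /cont_at.
have -> : (fun p => toC (f (- cbar (ofC p)))) =
  (fun p => (fun q => toC (f (ofC q))) (Rdefinitions.Ropp (fst p), snd p)).
  apply/funext => -[u v]; congr (toC (f _)).
  by apply/eqP; rewrite eq_complex /= opprK !eqxx.
have H' : HalfPlane.cderiv (fun q => toC (f (ofC q))) (Rdefinitions.Ropp x, y) (toC l).
  by move: H; rewrite /cderiv /toC /= opprK.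
exact: (HalfPlane.ccont_reflect (fun q => toC (f (ofC q))) x y (toC l) H').
Qed.
Lemma cont_atX f n z : cont_at f z -> cont_at (fun x => f x ^+ n) z.
Proof.
move=> H; elim: n => [|n IH].
  have -> : (fun x => f x ^+ 0) = (fun _ => 1) by apply/funext => x.
  exact: cont_at_const.
have -> : (fun x => f x ^+ n.+1) = (fun x => f x * f x ^+ n) by apply/funext => x; rewrite exprS.
exact: cont_atM.
Qed.
Lemma cont_at_sum m (f : nat -> CC -> CC) z : (forall i, cont_at (f i) z) ->
  cont_at (fun x => \sum_(i < m) f i x) z.
Proof.
move=> H; elim: m => [|m IH].
  have -> : (fun x => \sum_(i < 0) f i x) = (fun _ => 0) by apply/funext => x; rewrite big_ord0.
  exact: cont_at_const.
have -> : (fun x => \sum_(i < m.+1) f i x) = (fun x => \sum_(i < m) f i x + f m x).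
  by apply/funext => x; rewrite big_ord_recr.
exact: cont_atD.
Qed.

Definition bdd (f : CC -> CC) : Prop := exists K Y : RR, forall z, Rdefinitions.Rlt Y (complex.Im z) ->
  Rdefinitions.Rle (Complex.Cmod (toC (f z))) K.

Lemma bddD f g : bdd f -> bdd g -> bdd (fun z => f z + g z).
Proof.
move=> [K [Y H]] [K' [Y' H']]; exists (Rdefinitions.Rplus K K'), (Rbasic_fun.Rmax Y Y') => z hz.
rewrite toCD; apply: RIneq.Rle_trans (Complex.Cmod_triangle _ _) _.
apply: RIneq.Rplus_le_compat; [apply: H|apply: H'].
  exact: RIneq.Rle_lt_trans (Rbasic_fun.Rmax_l _ _) hz.
exact: RIneq.Rle_lt_trans (Rbasic_fun.Rmax_r _ _) hz.
Qed.
Lemma bddZ c f : bdd f -> bdd (fun z => c * f z).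
Proof.
move=> [K [Y H]]; exists (Rdefinitions.Rmult (Complex.Cmod (toC c)) K), Y => z hz.
rewrite toCM Complex.Cmod_mult; apply: RIneq.Rmult_le_compat_l; first exact: Complex.Cmod_ge_0.
exact: H.
Qed.
Lemma bdd_const c : bdd (fun _ => c).
Proof. exists (Complex.Cmod (toC c)), Rdefinitions.R0 => z _; exact: RIneq.Rle_refl. Qed.
Lemma bdd_sum m (f : nat -> CC -> CC) : (forall i, (i < m)%N -> bdd (f i)) ->
  bdd (fun x => \sum_(i < m) f i x).
Proof.
elim: m => [|m IH] H.
  have -> : (fun x => \sum_(i < 0) f i x) = (fun _ => 0) by apply/funext => x; rewrite big_ord0.
  exact: bdd_const.
have -> : (fun x => \sum_(i < m.+1) f i x) = (fun x => \sum_(i < m) f i x + f m x).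
  by apply/funext => x; rewrite big_ord_recr.
by apply: bddD; [apply: IH => i im; apply: H; rewrite ltnS ltnW|apply: H].
Qed.

Lemma CmodX z k : Complex.Cmod (toC (z ^+ k)) = Rpow_def.pow (Complex.Cmod (toC z)) k.
Proof.
elim: k => [|k IH]; first by rewrite expr0 toC1 Complex.Cmod_1.
by rewrite exprS toCM Complex.Cmod_mult IH.
Qed.

Lemma Im_bdd_pow f g k : cuspidal f -> cuspidal g -> (forall z, up z -> cderiv f z (g z)) ->
  bdd (fun z => (- z + cbar z) ^+ k * f (- cbar z)).
Proof.
move=> Pf Pg fg.
have [|K [Y H]] := HalfPlane.decay_im _ _ k Pf Pg.
  by move=> z /upCP uz; have := fg _ uz; rewrite /cderiv ofCK.
exists K, Y => -[x y] hy; rewrite toCM Complex.Cmod_mult CmodX.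
have := H x y hy; congr (Rdefinitions.Rle (Rdefinitions.Rmult (Rpow_def.pow (Complex.Cmod _) k) (Complex.Cmod (toC (f _)))) K).
by apply/eqP; rewrite eq_complex /= opprK !eqxx.
Qed.

Lemma ofC_shift_re (w : CC) (u : RR) :
  ofC (Rdefinitions.Rplus (complex.Re w) u, complex.Im w) = w + u%:C.
Proof. by case: w => x y; apply/eqP; rewrite eq_complex /= addr0 !eqxx. Qed.
Lemma ofC_shift_im (w : CC) (u : RR) :
  ofC (complex.Re w, Rdefinitions.Rplus (complex.Im w) u) = w + 'i * u%:C.
Proof.
transitivity (complex.Re w +i* (complex.Im w + u)) => //.
by case: w => x y; apply/eqP; rewrite eq_complex /=; apply/andP; split; apply/eqP; ring.
Qed.
Lemma conj_shift_re (w : CC) (u : RR) : cbar (w + u%:C) = cbar w + u%:C.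
Proof. by case: w => x y; apply/eqP; rewrite eq_complex /= !addr0 !eqxx. Qed.
Lemma conj_shift_im (w : CC) (u : RR) : cbar (w + 'i * u%:C) = cbar w - 'i * u%:C.
Proof.
by case: w => x y; apply/eqP; rewrite eq_complex /=; apply/andP; split; apply/eqP; ring.
Qed.
Lemma Im_shift_re (w : CC) (u : RR) : complex.Im (w + u%:C) = complex.Im w.
Proof. by case: w => x y; rewrite /= addr0. Qed.
Lemma Im_shift_im (w : CC) (u : RR) : complex.Im (w + 'i * u%:C) = complex.Im w + u.
Proof. by case: w => x y; rewrite /= !mul0r mul1r add0r. Qed.
Lemma Im_negconj (w : CC) : complex.Im (- cbar w) = complex.Im w.
Proof. by case: w => x y; rewrite /= opprK. Qed.

(** * The function Phi and its Laplacian *)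

Section Vanishing.
Variables (n : nat) (F : nat -> CC -> CC).
Hypothesis n_even : ~~ odd n.
Hypothesis n_gt0 : (0 < n)%N.
Hypothesis F_cuspidal : forall j, cuspidal (F j).
Hypothesis dF : forall j z, up z -> cderiv (F j.+1) z (F j z).

(** The Eichler sum with k for z - x and [phi i] for the value of [F i.+1], so that k and the
    functions can be differentiated separately. *)
Definition T (k : CC) (phi : nat -> CC) : CC :=
  \sum_(i < n.+1) (n ^_ i)%:R * k ^+ (n - i) * phi i.

(** The falling factorials satisfy [n ^_ i * (n - i) = n ^_ i.+1], so differentiating in k only
    shifts [phi] by one and loses the term of index 0. *)
Lemma T_shift k phi :
  \sum_(i < n.+1) (n ^_ i)%:R * ((n - i)%:R * k ^+ (n - i).-1) * phi i.+1 = T k phi - k ^+ n * phi 0%N.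
Proof.
pose u i := (n ^_ i)%:R * k ^+ (n - i) * phi i.
have -> : k ^+ n * phi 0%N = u 0%N by rewrite /u ffactn0 mul1r subn0.
have un : u n.+1 = 0 by rewrite /u ffact_small // mulr0n !mul0r.
transitivity (\sum_(i < n.+1) u i.+1).
  apply: eq_bigr => i _; rewrite /u ffactnSr natrM -subn1 -subnDA addn1; ring.
have e : \sum_(i < n.+2) u i = u 0%N + \sum_(i < n.+1) u i.+1 by rewrite big_ord_recl.
move: e; rewrite big_ord_recr /= un addr0 => e.
by rewrite (_ : T k phi = \sum_(i < n.+1) u i) // e addrC addKr.
Qed.

Lemma cd_T_const k (phi : nat -> CC -> CC) (dphi : nat -> CC) t :
  (forall i, cderiv (phi i) t (dphi i)) ->
  cderiv (fun x => T k (fun i => phi i x)) t (T k dphi).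
Proof.
move=> H; apply: (cd_sum (f := fun i x => (n ^_ i)%:R * k ^+ (n - i) * phi i x)
  (l := fun i => (n ^_ i)%:R * k ^+ (n - i) * dphi i)) => i _.
exact: cdZ.
Qed.

Lemma cd_T_lin k c (phi : nat -> CC -> CC) (dphi psi : nat -> CC) t :
  (forall i, cderiv (phi i) t (dphi i)) -> (forall i, phi i t = psi i.+1) ->
  cderiv (fun x => T (k + c * x) (fun i => phi i x)) t
     (c * (T (k + c * t) psi - (k + c * t) ^+ n * psi 0%N) + T (k + c * t) dphi).
Proof.
move=> H E; have lin : cderiv (fun x => k + c * x) t c.
  by apply: cd_val (cdD (cd_const k t) (cdZ c (cd_id t))) _; ring.
have := (cd_sum (m := n.+1) (f := fun i x => (n ^_ i)%:R * (k + c * x) ^+ (n - i) * phi i x)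
  (l := fun i => (n ^_ i)%:R * ((n - i)%:R * (k + c * t) ^+ (n - i).-1 * c) * phi i t
       + (n ^_ i)%:R * (k + c * t) ^+ (n - i) * dphi i) (z := t)).
move=> /(_ _)/cd_val; apply.
  by move=> i _; apply: cdM (H i); apply: cdZ; apply: cdX lin.
rewrite big_split /=; congr (_ + _).
rewrite -T_shift mulr_sumr; apply: eq_bigr => i _; rewrite E; ring.
Qed.

Lemma cd_affine a c t : cderiv (fun x => a + c * x) t c.
Proof. by apply: cd_val (cdD (cd_const a t) (cdZ c (cd_id t))) _; ring. Qed.

Lemma cd_F_affine j a c t : up (a + c * t) ->
  cderiv (fun x => F j.+1 (a + c * x)) t (c * F j (a + c * t)).
Proof.
by move=> u; apply: cd_val (cd_comp (g := fun x => a + c * x) (dF j u) (cd_affine a c t)) _; ring.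
Qed.

Variables s K : CC.
(** The two Eichler integrals of Phi written out; on the diagonal only the term n! F_(n+1) is left,
    and k = -z + conj z is -2 i y. *)
Definition Phi (z : CC) : CC :=
  n`!%:R * F n.+1 z + s * T (- z + cbar z) (fun i => F i.+1 (- cbar z)) - K.

(** Along a horizontal line k is constant and -conj z moves by -t; along a vertical line k moves by
    -2 i t and -conj z by i t. The second derivatives add up to 4 n s k^(n-1) f(-conj z), and k = -2
    i y identifies this with the required multiple of b. *)
Lemma Phi_lap z : up z -> HalfPlane.lap_at n (fun p => toC (Phi (ofC p))) (complex.Re z) (complex.Im z)
  (toC (- s * (- z + cbar z) ^+ n * F 0 (- cbar z))).
Proof.
move=> uz; set k := - z + cbar z; set b := - cbar z.
have ub : up b by exact: up_negconj.
(* The tower extended downwards by one storey at the single point -conj z: [D 0] is the derivative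
   of f, which the second derivatives involve and whose terms cancel. *)
have [D [D0 hD]] : exists D : nat -> CC, (forall i, D i.+1 = F i b) /\ forall i, cderiv (F i) b (D i).
  have [l hl] := proj1 (F_cuspidal 0) _ (proj2 (upP b) ub).
  exists (fun i => if i is i'.+1 then F i' b else ofC l); split=> // -[|i]; last exact: dF.
  by rewrite /cderiv ofCK.
pose hX t := n`!%:R * F n.+1 (z + 1 * t) + s * T k (fun i => F i.+1 (b + (-1) * t)) - K.
pose dhX t := n`!%:R * F n (z + 1 * t) - s * T k (fun i => F i (b + (-1) * t)).
pose k' t := k + (- (2%:R * 'i)) * t.
pose hY t := n`!%:R * F n.+1 (z + 'i * t) + s * T (k' t) (fun i => F i.+1 (b + 'i * t)) - K.
pose dhY t := 'i * (n`!%:R * F n (z + 'i * t) + s * (2%:R * k' t ^+ n * F 0 (b + 'i * t)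
   - T (k' t) (fun i => F i (b + 'i * t)))).
have TZ c q phi : T q (fun i => c * phi i) = c * T q phi.
  by rewrite /T mulr_sumr; apply: eq_bigr => i _; ring.
have chX t : up (z + 1 * t) -> up (b + (-1) * t) -> cderiv hX t (dhX t).
  move=> u1 u2.
  have h1 := cdZ n`!%:R (cd_F_affine n u1).
  have h2 := cdZ s (cd_T_const k (fun i => cd_F_affine i u2)).
  apply: cd_val (cdB (cdD h1 h2) (cd_const K t)) _.
  by rewrite TZ /dhX; ring.
have cdhX : cderiv dhX 0 (n`!%:R * F n.-1 z + s * T k D).
  have u1 : up (z + 1 * 0) by rewrite mulr0 addr0.
  have h1 := @cd_F_affine n.-1 z 1 0 u1; rewrite prednK // in h1.
  have h2 : forall i, cderiv (fun x => F i (b + (-1) * x)) 0 ((-1) * D i).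
    move=> i; apply: cd_val (cd_comp (f := F i) (g := fun x => b + (-1) * x) (l := D i) _ (cd_affine b (-1) 0)) _.
      by rewrite mulr0 addr0.
    by ring.
  apply: cd_val (cdB (cdZ n`!%:R h1) (cdZ s (cd_T_const k h2))) _.
  by rewrite TZ mulr0 addr0; ring.
have chY t : up (z + 'i * t) -> up (b + 'i * t) -> cderiv hY t (dhY t).
  move=> u1 u2.
  have h1 := cdZ n`!%:R (cd_F_affine n u1).
  have h2 := cdZ s (@cd_T_lin k (- (2%:R * 'i)) (fun i x => F i.+1 (b + 'i * x))
     (fun i => 'i * F i (b + 'i * t)) (fun i => F i (b + 'i * t)) t
     (fun i => cd_F_affine i u2) (fun i => erefl)).
  apply: cd_val (cdB (cdD h1 h2) (cd_const K t)) _.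
  by rewrite TZ /dhY -/(k' t); ring.
have cdhY : cderiv dhY 0 (- (n`!%:R * F n.-1 z) + s * (4%:R * n%:R * k ^+ n.-1 * F 0 b - T k D)).
  have u1 : up (z + 'i * 0) by rewrite mulr0 addr0.
  have h1 := @cd_F_affine n.-1 z 'i 0 u1; rewrite prednK // in h1.
  have h2 : forall i, cderiv (fun x => F i (b + 'i * x)) 0 ('i * D i).
    move=> i; apply: cd_val (cd_comp (f := F i) (g := fun x => b + 'i * x) (l := D i) _ (cd_affine b 'i 0)) _.
      by rewrite mulr0 addr0.
    by ring.
  have h3 := cdM (cdZ 2%:R (cdX n (cd_affine k (- (2%:R * 'i)) 0))) (h2 0%N).
  have h4 := @cd_T_lin k (- (2%:R * 'i)) (fun i x => F i (b + 'i * x)) (fun i => 'i * D i) D 0 h2 _.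
  have h5 := cdZ 'i (cdD (cdZ n`!%:R h1) (cdZ s (cdB h3 (h4 _)))).
  apply: cd_val (h5 _) _; first by move=> i; rewrite mulr0 addr0 D0.
  rewrite TZ !mulr0 !addr0.
  have i2 : 'i * 'i = -1 :> CC by rewrite -expr2 sqr_i.
  set q := k ^+ n.-1; set p := k ^+ n.
  transitivity (('i * 'i) * (n`!%:R * F n.-1 z) + s * (- ('i * 'i) * (4%:R * n%:R * q * F 0 b) + ('i * 'i) * T k D)).
    ring.
  by rewrite i2; ring.
have y0 : 0 < complex.Im z by [].
have kE : k = - (2%:R * 'i) * (complex.Im z)%:C.
  by rewrite /k; case: (z) => x y; apply/eqP; rewrite eq_complex /=; apply/andP; split; apply/eqP; ring.
(* The radius Im z keeps the vertical line in the half-plane, and the last witness is the derivative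
   in z, obtained as [dhX 0] - b. *)
exists (complex.Im z), (fun t => toC (dhX t%:C)), (fun t => toC (dhY t%:C)),
  (toC (n`!%:R * F n.-1 z + s * T k D)),
  (toC (- (n`!%:R * F n.-1 z) + s * (4%:R * n%:R * k ^+ n.-1 * F 0 b - T k D))),
  (toC (dhX 0 + s * k ^+ n * F 0 b)).
split; first exact/RltP.
split.
  move=> t _; have -> : (fun u => toC (Phi (ofC (Rdefinitions.Rplus (complex.Re z) u, complex.Im z)))) =
     (fun u : RR => toC (hX u%:C)).
    apply/funext => u; congr (toC _).
    have e : - (z + u%:C) + (cbar z + u%:C) = k by rewrite /k; ring.
    by rewrite ofC_shift_re /Phi /hX conj_shift_re mul1r mulN1r e opprD.
  refine (cd_rderiv (h := hX) (t := t) (l := dhX t%:C) _); apply: chX; rewrite /up ?mul1r ?mulN1r.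
    by rewrite Im_shift_re.
  have -> : - t%:C = (- t)%:C by apply/eqP; rewrite eq_complex /= oppr0 !eqxx.
  by rewrite Im_shift_re Im_negconj.
split; first exact: (cd_rderiv (h := dhX) (t := 0) cdhX).
split.
  move=> t ht; have -> : (fun u => toC (Phi (ofC (complex.Re z, Rdefinitions.Rplus (complex.Im z) u)))) =
     (fun u : RR => toC (hY u%:C)).
    apply/funext => u; congr (toC _).
    have e : - (z + 'i * u%:C) + (cbar z - 'i * u%:C) = k' u%:C by rewrite /k' /k; ring.
    by rewrite ofC_shift_im /Phi /hY conj_shift_im e opprB [_ - cbar z]addrC.
  have yt : 0 < complex.Im z + t.
    have [_ h] := Rbasic_fun.Rabs_def2 _ _ ht; move/RltP: h => h.
    by rewrite -ltrBlDl sub0r.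
  refine (cd_rderiv (h := hY) (t := t) (l := dhY t%:C) _); apply: chY; rewrite /up.
    by rewrite Im_shift_im.
  by rewrite Im_shift_im Im_negconj.
split; first exact: (cd_rderiv (h := dhY) (t := 0) cdhY).
split.
  by rewrite -toCD; congr toC; rewrite mulNr mulNr addrK.
split.
  have zz : (Rdefinitions.IZR BinNums.Z0)%:C = 0 :> CC by [].
  rewrite -toCi -toCB -toCM; congr toC; rewrite zz /dhY /dhX /k' !mulr0 !addr0 (_ : 'i%C = 'i%R) //; ring.
rewrite -toCD.
set c := Rdefinitions.Rdiv _ _.
have cE : c%:C * (complex.Im z)%:C = 2%:R * n%:R.
  have -> : c = 2%:R * n%:R / complex.Im z by rewrite /c RdivE RmultE INRE.
  by rewrite -rmorphM /= divfK ?gt_eqF // rmorphM /= !rmorph_nat.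
rewrite -(toCr c) -toCN -toCi -!toCM; congr toC.
rewrite (_ : 'i%C = 'i%R) //.
have kn : k ^+ n = - (2%:R * 'i) * (complex.Im z)%:C * k ^+ n.-1 by rewrite -kE -exprS prednK.
have i2 : 'i * 'i = -1 :> CC by rewrite -expr2 sqr_i.
rewrite kn.
transitivity (- (2%:R * ('i * 'i)) * (c%:C * (complex.Im z)%:C) * s * k ^+ n.-1 * F 0 b); last ring.
by rewrite cE i2; ring.
Qed.

End Vanishing.

Lemma cbarV z : cbar z^-1 = (cbar z)^-1.
Proof.
by case: z => x y; apply/eqP; rewrite eq_complex /= sqrrN mulNr !eqxx.
Qed.
Lemma cbarN z : cbar (- z) = - cbar z.
Proof. by case: z. Qed.
Lemma cbarK z : cbar (cbar z) = z.
Proof. by case: z => x y; rewrite /cbar /= opprK. Qed.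
Lemma cbar_up_subr1 z : - cbar (z + 1) = - cbar z - 1.
Proof.
by case: z => x y; apply/eqP; rewrite eq_complex /= addr0 opprD oppr0 addr0 !eqxx.
Qed.
Lemma cuspidal_bdd f : cuspidal f -> bdd f.
Proof.
move=> [_ [_ /(_ Rdefinitions.R1 RIneq.Rlt_0_1) [Y [_ H]]]].
exists Rdefinitions.R1, Y => -[x y] h; apply: RIneq.Rlt_le; exact: (H (x, y)).
Qed.

(** * Injectivity of the period map *)

Section Injectivity.
Variables (n : nat) (F : nat -> CC -> CC).
Hypothesis n_even : ~~ odd n.
Hypothesis n_gt0 : (0 < n)%N.
Hypothesis F_cuspidal : forall j, cuspidal (F j).
Hypothesis dF : forall j z, up z -> cderiv (F j.+1) z (F j z).
Hypothesis hS : forall z, up z -> F 0 (- z^-1) = z ^+ n.+2 * F 0 z.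

Lemma eichler_diag z : eichler n F z z = n`!%:R * F n.+1 z.
Proof.
rewrite /eichler big_ord_recr /= subnn expr0 mulr1 ffactnn big1 ?add0r // => i _.
by rewrite subrr expr0n subn_eq0 leqNgt ltn_ord mulr0 mul0r.
Qed.

Lemma PhiE s K z : Phi n F s K z = eichler n F z z + s * eichler n F (- z) (- cbar z) - K.
Proof. by rewrite eichler_diag /eichler opprK. Qed.

Lemma Phi_per s K z : up z -> Phi n F s K (z + 1) = Phi n F s K z.
Proof.
move=> uz; rewrite /Phi cuspidal_periodic //; congr (_ + s * _ - K).
have -> : - (z + 1) + cbar (z + 1) = - z + cbar z.
  by rewrite -[cbar (z + 1)]opprK cbar_up_subr1; ring.
apply: eq_bigr => i _; congr (_ * _); rewrite cbar_up_subr1 -[in RHS](subrK 1 (- cbar z)) cuspidal_periodic //.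
rewrite -cbar_up_subr1; exact: up_negconj (up_add1 uz).
Qed.

Lemma cont_at_Phi s K z : up z -> cont_at (Phi n F s K) z.
Proof.
move=> uz; apply: cont_atD; last exact: cont_at_const.
apply: cont_atD; first by apply: cont_atM; [exact: cont_at_const|exact: cont_at_cd (dF n uz)].
apply: cont_atM; first exact: cont_at_const.
apply: (@cont_at_sum n.+1 (fun i z => (n ^_ i)%:R * (- z + cbar z) ^+ (n - i) * F i.+1 (- cbar z)) z) => i.
apply: cont_atM; last exact: cont_at_reflect (dF i (up_negconj uz)).
apply: cont_atM; first exact: cont_at_const.
apply: cont_atX.
have -> : (fun z => - z + cbar z) = (fun z => - z + - (- cbar z)) by apply/funext => w; rewrite opprK.
apply: cont_atD; first exact: cont_at_cd (cdN (cd_id z)).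
exact: (cont_at_reflect (f := fun w => - w) (cdN (cd_id _))).
Qed.

(** The powers of -z + conj z grow like powers of y; the decay of each [F i.+1] compensates for
    them. *)
Lemma bdd_Phi s K : bdd (Phi n F s K).
Proof.
apply: bddD; last exact: bdd_const.
apply: bddD; first exact: bddZ (cuspidal_bdd (F_cuspidal _)).
apply: bddZ.
pose h (i : nat) z := (n ^_ i)%:R * ((- z + cbar z) ^+ (n - i) * F i.+1 (- cbar z)).
have -> : (fun z => T n (- z + cbar z) (fun i => F i.+1 (- cbar z))) =
  (fun z => \sum_(i < n.+1) h i z).
  by apply/funext => z; apply: eq_bigr => i _; rewrite /h mulrA.
apply: (@bdd_sum n.+1 h) => i _; apply: bddZ.
by apply: (Im_bdd_pow (n - i) (F_cuspidal i.+1) (F_cuspidal i)) => z; exact: dF.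
Qed.

Lemma vanishing (P : {poly CC}) s K : s != 0 ->
  (forall z x, z != 0 -> up x ->
    z ^+ n * eichler n F (- z^-1) (- x^-1) = eichler n F z x + P.[z]) ->
  (forall z, P.[z] + s * P.[- z] = K * (z ^+ n - 1)) ->
  forall z, up z -> F 0 z = 0.
Proof.
move=> s0 hP hPK.
have en z : (- z) ^+ n = z ^+ n by rewrite exprNn -signr_odd (negbTE n_even) mul1r.
(* The transformation rule at (z, z) and at (-z, -conj z) contributes P(z) + s P(-z) = K z^n - K,
   which is what subtracting the constant K in Phi absorbs. *)
have inv z : up z -> z ^+ n * Phi n F s K (- z^-1) = Phi n F s K z.
  move=> uz; have z0 := up_neq0 uz; rewrite !PhiE.
  have h1 := hP _ _ z0 uz.
  have nz0 : - z != 0 by rewrite oppr_eq0.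
  have h2 := hP _ _ nz0 (up_negconj uz).
  rewrite en in h2.
  have -> : - cbar (- z^-1) = - (- cbar z)^-1 by rewrite cbarN cbarV invrN.
  have -> : - - z^-1 = - (- z)^-1 by rewrite invrN.
  rewrite mulrBr mulrDr h1 mulrCA h2.
  have := hPK z; rewrite mulrBr mulr1 => /eqP; rewrite -subr_eq0 => /eqP e.
  by rewrite -[RHS]addr0 -e; ring.
have Z z : up z -> Phi n F s K z = 0.
  move=> uz; apply: toC_inj; rewrite -{1}(toCK z).
  apply: (HalfPlane.invariant_zero n (fun p => toC (Phi n F s K (ofC p)))); last exact/upP.
  - by apply/ssrnat.ltP.
  - move=> p /upCP up.
    have -> : ofC (Complex.Cplus p (Complex.RtoC Rdefinitions.R1)) = ofC p + 1.
      by apply: toC_inj; rewrite toCD !ofCK.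
    by rewrite Phi_per.
  - move=> p /upCP up; rewrite -(inv _ up) toCM Complex.Cmod_mult CmodX ofCK.
    do 4 congr (_ _); apply: toC_inj.
    by rewrite toCN toCV ?ofCK // up_neq0.
  - move=> x y y0; have u : up (Complex x y) by apply/RltP.
    exact: (HalfPlane.ccont_dot (fun p => toC (Phi n F s K (ofC p))) x y (cont_at_Phi s K u)).
  - have [B [Y H]] := bdd_Phi s K; exists B, Y => p hp; exact: H.
  - move=> x y y0; have u : up (Complex x y) by apply/RltP.
    by eexists; exact: (Phi_lap n_gt0 F_cuspidal dF s K u).
move=> z uz; have ub := up_negconj uz.
have uy : Rdefinitions.Rlt Rdefinitions.R0 (complex.Im (- cbar z)) by apply/RltP.
(* Taken at -conj z, so that the conjugate derivative contains [F 0] at z itself; its other factor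
   is a power of a nonzero imaginary number. *)
have := HalfPlane.lap_zero n _ _ _ _ uy _ (Phi_lap n_gt0 F_cuspidal dF s K ub).
move=> /(_ _) E; have {}E : toC (- s * (- - cbar z + cbar (- cbar z)) ^+ n * F 0 (- cbar (- cbar z))) = toC 0.
  by apply: E => p /upCP up; rewrite Z.
move/toC_inj: E; rewrite cbarN cbarK opprK => /eqP.
rewrite !mulf_eq0 oppr_eq0 (negbTE s0) expf_eq0 n_gt0 /= => /orP []; last by rewrite opprK => /eqP.
move=> /eqP /(congr1 (fun w : CC => complex.Im w)); case: (z) uz => x y; rewrite /up /= => y0 /eqP.
by rewrite -opprD oppr_eq0 gt_eqF ?addr_gt0.
Qed.
End Injectivity.

(** * From cusp forms to period polynomials *)

Lemma normCmod (z : CC) : `|z| = (Complex.Cmod (toC z))%:C.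
Proof.
by rewrite normc_def /Complex.Cmod RsqrtE !RpowE.
Qed.

Lemma cusp_lim (f : CC -> CC^o) : f z @[z --> at_i_infty RR] --> (0 : CC^o) ->
  forall e, Rdefinitions.Rlt Rdefinitions.R0 e -> exists Y, Rdefinitions.Rlt Rdefinitions.R0 Y /\
   forall z : CC, Rdefinitions.Rlt Y (complex.Im z) -> Rdefinitions.Rlt (Complex.Cmod (toC (f z))) e.
Proof.
move=> H e /RltP e0.
have e0' : 0 < e%:C :> CC by rewrite ltcR.
have B : nbhs (0 : CC^o) (ball (0 : CC^o) e%:C) by exact: nbhsx_ballx.
have [M _ HM] := H _ B.
exists (Num.max M 1); split; first by apply/RltP; rewrite lt_max ltr01 orbT.
move=> z /RltP hz; apply/RltP; rewrite -ltcR -normCmod.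
have : [set z | M < complex.Im z] z by apply: le_lt_trans hz; rewrite le_max lexx.
by move=> /HM; rewrite /= -ball_normE /ball_ /= sub0r normrN.
Qed.

Lemma derivable_cd (f : CC -> CC) (z : CC) : derivable (f : CC^o -> CC^o) z 1 ->
  exists l, cderiv f z l.
Proof.
move=> /cvg_ex [l Hl]; exists l => e /RltP e0.
have e0' : 0 < e%:C :> CC by rewrite ltcR.
have B : nbhs (l : CC^o) (ball (l : CC^o) e%:C) by exact: nbhsx_ballx.
have /nbhs_ballP [d /= d0 Hd] := Hl _ B.
move: (d0); rewrite ltcE /= => /andP [/eqP im0 re0].
have dr : d = (complex.Re d)%:C by apply/eqP; rewrite eq_complex /= im0 !eqxx.
exists (complex.Re d); split; first exact/RltP.
move=> h /RltP hd; apply/RleP; rewrite -lecR.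
set k := ofC h; have hk : h = toC k by rewrite ofCK.
rewrite hk -toCD !toCK -toCM -!toCB -normCmod RmultE rmorphM /= -normCmod.
have [->|k0] := eqVneq k 0; first by rewrite addr0 subrr mulr0 subr0 normr0 mulr0.
have kd : ball (0 : CC^o) d k by rewrite -ball_normE /ball_ /= sub0r normrN dr normCmod ltcR -hk.
have := Hd _ kd k0; rewrite -ball_normE /ball_ /= => H.
have -> : f (z + k) - f z - l * k = - ((l - k^-1 * (f (k + z) - f z)) * k).
  rewrite [k + z]addrC mulrBl [k^-1 * _]mulrC mulfVK //; ring.
rewrite normrN normrM ler_pM2r ?normr_gt0 //; apply: ltW; move: H.
by rewrite /GRing.scale /= mulr1.
Qed.

Lemma cusp_form_cuspidal (w : nat) (f : CC -> CC^o) : cusp_forms RR w f -> cuspidal f.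
Proof.
move=> [_ hd hm hl]; split; last split.
- by move=> p /upCP /hd /derivable_cd [l Hl]; exists (toC l); move: Hl; rewrite /cderiv ofCK.
- move=> p /upCP up.
  have := hm 1 1 0 1 (ofC p); rewrite mulr1 mulr0 subr0 => /(_ erefl up).
  rewrite mul1r mul0r add0r divr1 expr1n mul1r => <-.
  by congr (toC (f _)); apply: toC_inj; rewrite toCD !ofCK.
- move=> e e0; have [Y [Y0 H]] := cusp_lim hl e0; exists Y; split=> // p hp.
  exact: (H (ofC p)).
Qed.

Lemma cusp_S (w : nat) (f : CC -> CC^o) : cusp_forms RR w f ->
  forall z, up z -> f (- z^-1) = z ^+ w * f z.
Proof.
move=> [_ _ hm _] z uz; have := hm 0 (-1) 1 0 z; rewrite mulr0 mulr1 sub0r opprK => /(_ erefl uz).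
by rewrite mul0r add0r mul1r addr0 mulN1r.
Qed.

Lemma tower (f : CC -> CC) : cuspidal f -> exists F : nat -> CC -> CC,
  [/\ F 0%N = f, forall j, cuspidal (F j) & forall j z, up z -> cderiv (F j.+1) z (F j z)].
Proof.
move=> Pf.
have /choice [g hg] : forall u : {h | cuspidal h}, exists v : {h | cuspidal h},
    forall z, up z -> cderiv (sval v) z (sval u z).
  by move=> [h Ph]; have [H [PH HH]] := cuspidal_prim Ph; exists (exist _ H PH).
exists (fun j => sval (iter j g (exist _ f Pf))); split=> // [j|j z uz]; first exact: svalP.
exact: hg.
Qed.

(** Only the transformation of n! F_(n+1), the diagonal Eichler integral, is recorded, together with
    a tower: this is visibly linear in (f, P) and suffices for the cocycle relations. *)
Definition period_poly (n : nat) (f : CC -> CC) (P : {poly CC}) : Prop :=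
  (size P <= n.+1)%N /\ exists F : nat -> CC -> CC,
    [/\ F 0%N = f, forall j, cuspidal (F j), forall j z, up z -> cderiv (F j.+1) z (F j z)
      & forall z, up z ->
        z ^+ n * (n`!%:R * F n.+1 (- z^-1)) = n`!%:R * F n.+1 z + P.[z]].

Lemma period_poly_ex (n : nat) (f : CC -> CC^o) : ~~ odd n -> cusp_forms RR n.+2 f ->
  exists P, period_poly n f P.
Proof.
move=> n_even cf; have [F [F0 F_cuspidal dF]] := tower (cusp_form_cuspidal cf).
have hS z : up z -> F 0 (- z^-1) = z ^+ n.+2 * F 0 z.
  by rewrite F0; exact: cusp_S.
have [P [sP hP]] := eichler_S dF n_even hS.
exists P; split=> //; exists F; split=> // z uz.
by have := hP _ _ (up_neq0 uz) uz; rewrite !eichler_diag.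
Qed.

Lemma cuspidal_lin a f g : cuspidal f -> cuspidal g -> cuspidal (fun z => a * f z + g z).
Proof.
move=> Pf Pg; have := HalfPlane.cuspidal_lin (toC a) _ _ Pf Pg.
congr HalfPlane.cuspidal; apply/funext => p; by rewrite toCD toCM.
Qed.

Lemma cuspidal0 : cuspidal (fun _ => 0).
Proof.
split; last split.
- by move=> p _; exists (toC 0); exact: HalfPlane.cderiv_const.
- by [].
- move=> e e0; exists Rdefinitions.R1; split; first exact: RIneq.Rlt_0_1.
  by move=> p _; rewrite toC0 Complex.Cmod_0.
Qed.

Lemma period_poly_lin n a f g P Q : period_poly n f P -> period_poly n g Q ->
  period_poly n (fun z => a * f z + g z) (a *: P + Q).
Proof.
move=> [sP [F [F0 F_cuspidal dF hF]]] [sQ [G [G0 PG dG hG]]]; split.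
  apply: leq_trans (size_polyD _ _) _; rewrite geq_max sQ andbT.
  exact: leq_trans (size_scale_leq _ _) sP.
exists (fun j z => a * F j z + G j z); split.
- by rewrite F0 G0.
- by move=> j; exact: cuspidal_lin.
- by move=> j z uz; apply: cdD; [apply: cdZ; exact: dF|exact: dG].
- move=> z uz; rewrite hornerD hornerZ.
  transitivity (a * (z ^+ n * (n`!%:R * F n.+1 (- z^-1))) + z ^+ n * (n`!%:R * G n.+1 (- z^-1))).
    ring.
  by rewrite hF // hG //; ring.
Qed.

Lemma period_poly_zero n : period_poly n (fun _ => 0) 0.
Proof.
split; first by rewrite size_poly0.
exists (fun _ _ => 0); split=> //.
- by move=> j; exact: cuspidal0.
- by move=> j z _; exact: cd_const.
- by move=> z _; rewrite horner0 !mulr0 addr0.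
Qed.

Lemma period_poly_sum n d (f : 'I_d -> CC -> CC) (P : 'I_d -> {poly CC}) (c : 'I_d -> CC) :
  (forall i, period_poly n (f i) (P i)) ->
  period_poly n (fun z => \sum_i c i * f i z) (\sum_i c i *: P i).
Proof.
move=> H.
suff : forall s : seq 'I_d, period_poly n (fun z => \sum_(i <- s) c i * f i z) (\sum_(i <- s) c i *: P i).
  exact.
elim=> [|i s IH].
  rewrite big_nil; have -> : (fun z => \sum_(i <- [::]) c i * f i z) = (fun _ => 0).
    by apply/funext => z; rewrite big_nil.
  exact: period_poly_zero.
rewrite big_cons; have -> : (fun z => \sum_(i0 <- i :: s) c i0 * f i0 z) =
    (fun z => c i * f i z + \sum_(i0 <- s) c i0 * f i0 z).
  by apply/funext => z; rewrite big_cons.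
exact: period_poly_lin.
Qed.

Lemma poly_up_eq (P Q : {poly CC}) : (forall z, up z -> P.[z] = Q.[z]) -> P = Q.
Proof.
move=> H; apply/eqP; rewrite -subr_eq0; apply/eqP.
pose rs := [seq (0 +i* i.+1%:R : CC) | i <- iota 0 (size (P - Q))].
apply: (@roots_geq_poly_eq0 _ _ rs).
- apply/allP => x /mapP [i _ ->]; rewrite rootE hornerD hornerN H ?subrr //.
  by rewrite /up /= ltr0Sn.
- by rewrite map_inj_uniq ?iota_uniq // => i j [] /eqP; rewrite eqr_nat eqSS => /eqP.
- by rewrite size_map size_iota.
Qed.

(** * Period polynomials are cocycles *)

Section Cocycle.
Variables (n : nat) (f : CC -> CC) (P : {poly CC}).
Hypothesis n_even : ~~ odd n.
Hypothesis fP : period_poly n f P.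

(** The map z -> -1/z is an involution: the rule at z and at -1/z, combined, leave only the two
    values of P. *)
Lemma cocycle_S z : up z -> hom n P (- 1) z = - P.[z].
Proof.
move=> uz; have z0 := up_neq0 uz; have [_ [F [_ _ _ hF]]] := fP.
rewrite hom_div ?(proj1 fP) // mulN1r.
have e1 := hF _ uz; have e2 := hF _ (up_neg_inv uz).
have en : (- z^-1) ^+ n = z ^- n by rewrite exprNn -signr_odd (negbTE n_even) mul1r exprVn.
rewrite invrN invrK opprK en in e2.
have zn : z ^+ n != 0 by rewrite expf_neq0.
have e3 : n`!%:R * F n.+1 z = z ^+ n * (n`!%:R * F n.+1 (- z^-1)) + z ^+ n * P.[- z^-1].
  by rewrite -mulrDr -e2 mulVKf.
by rewrite e1 in e3; apply/eqP; rewrite -addr_eq0; apply/eqP; apply: (addrI (n`!%:R * F n.+1 z)); rewrite addr0 [RHS]e3; ring.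
Qed.

(** The rule is applied at z, z+1 and z/(z+1) = 1 - 1/(z+1). Periodicity identifies the values of
    F_(n+1) at points differing by 1, and then all of them cancel. *)
Lemma cocycle_Lewis z : up z -> P.[z] = P.[z + 1] + hom n P z (z + 1).
Proof.
move=> uz; have z0 := up_neq0 uz; have [_ [F [_ F_cuspidal _ hF]]] := fP.
have u1 := up_add1 uz; have z1 := up_neq0 u1.
rewrite hom_div ?(proj1 fP) //.
have u2 : up (- (z + 1)^-1) := up_neg_inv u1.
have e0 := hF _ uz; have e1 := hF _ u1.
have zE : - (z + 1)^-1 + 1 = z / (z + 1) by apply: (mulIf z1); rewrite mulfVK // mulrDl mulNr mulVf //; ring.
have u3 : up (z / (z + 1)) by rewrite -zE; exact: up_add1.
have e2 := hF _ u3.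
have p1 : F n.+1 (z + 1) = F n.+1 z by rewrite cuspidal_periodic.
have p2 : F n.+1 (z / (z + 1)) = F n.+1 (- (z + 1)^-1) by rewrite -zE; exact: cuspidal_periodic.
have e4 : - (z / (z + 1))^-1 + 1 = - z^-1.
  by rewrite invf_div; apply: (mulIf z0); rewrite mulrDl !mulNr mulfVK // mulVf //; ring.
have p3 : F n.+1 (- (z / (z + 1))^-1) = F n.+1 (- z^-1).
  by rewrite -e4; apply/esym/cuspidal_periodic => //; exact: up_neg_inv.
rewrite p1 in e1; rewrite p2 p3 in e2.
have zn : (z + 1) ^+ n != 0 by rewrite expf_neq0.
have e5 : (z + 1) ^+ n * P.[z / (z + 1)] = z ^+ n * (n`!%:R * F n.+1 (- z^-1)) - (z + 1) ^+ n * (n`!%:R * F n.+1 (- (z + 1)^-1)).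
  have -> : z ^+ n = (z + 1) ^+ n * (z / (z + 1)) ^+ n by rewrite -exprMn mulrC mulfVK.
  by rewrite -mulrA e2; ring.
rewrite e5 e1 e0; ring.
Qed.

(** The form with polynomials substituted, so that an identity known on the half-plane extends to
    the whole plane in one variable at a time by [poly_up_eq]. *)
Let homp (a b : {poly CC}) : {poly CC} := \sum_(i < n.+1) (P`_i)%:P * a ^+ i * b ^+ (n - i).

Let hompE a b z : (homp a b).[z] = hom n P a.[z] b.[z].
Proof. by rewrite horner_sum; apply: eq_bigr => i _; rewrite !hornerE. Qed.

Lemma period_poly_cocycle : cocycle n P.
Proof.
have sP := proj1 fP; split=> // [x y|x y].
  have S z : hom n P (- 1) z = - hom n P z 1.
    have /(congr1 (fun p : {poly CC} => p.[z])) : homp (- 1) 'X = - homp 'X 1.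
      by apply: poly_up_eq => w uw; rewrite hornerN !hompE !hornerE (hom1 _ sP) cocycle_S.
    by rewrite hornerN !hompE !hornerE.
  have /(congr1 (fun p : {poly CC} => p.[y])) : homp (- 'X) x%:P = - homp x%:P 'X.
    apply: poly_up_eq => w /up_neq0 w0; rewrite hornerN !hompE !hornerE.
    have := congr1 ( *%R (w ^+ n)) (S (x / w)).
    by rewrite mulrN -!homZ !mulr1 mulrN1 mulrC mulfVK.
  by rewrite hornerN !hompE !hornerE.
have S z : hom n P z 1 = hom n P (z + 1) 1 + hom n P z (z + 1).
  have /(congr1 (fun p : {poly CC} => p.[z])) : homp 'X 1 = homp ('X + 1) 1 + homp 'X ('X + 1).
    by apply: poly_up_eq => w uw; rewrite hornerD !hompE !hornerE !(hom1 _ sP) -cocycle_Lewis.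
  by rewrite hornerD !hompE !hornerE.
have /(congr1 (fun p : {poly CC} => p.[y])) :
    homp x%:P 'X = homp (x%:P + 'X) 'X + homp x%:P (x%:P + 'X).
  apply: poly_up_eq => w /up_neq0 w0; rewrite hornerD !hompE !hornerE.
  have := congr1 ( *%R (w ^+ n)) (S (x / w)).
  by rewrite mulrDr -!homZ !mulrDr !mulr1 [w * (x / w)]mulrC mulfVK.
by rewrite hornerD !hompE !hornerE.
Qed.

End Cocycle.

(** [vanishing] needs the rule in two variables. [eichler_S] gives it for the tower inside
    [period_poly] with some polynomial, which agrees with P on the diagonal x = z and therefore
    equals P. *)
Lemma period_poly_eq0 n (f : CC -> CC^o) P s b : (0 < n)%N -> ~~ odd n ->
  cusp_forms RR n.+2 f -> period_poly n f P -> s != 0 ->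
  (forall z, P.[z] + s * P.[- z] = b * (z ^+ n - 1)) -> f = 0.
Proof.
move=> n0 nE cf [sP [F [F0 F_cuspidal dF hF]]] s0 hP.
have hS z : up z -> F 0 (- z^-1) = z ^+ n.+2 * F 0 z by rewrite F0; exact: cusp_S.
have [P' [sP' hP']] := eichler_S dF nE hS.
have E : P' = P.
  apply: poly_up_eq => z uz; apply: (addrI (n`!%:R * F n.+1 z)).
  by rewrite -hF // -!(eichler_diag n F) hP' // up_neq0.
subst P'; apply/funext => z; have [f0 _ _ _] := cf.
case: (leP (complex.Im z) 0) => [/f0 //|uz].
by rewrite -F0 (vanishing nE n0 F_cuspidal dF s0 hP' hP).
Qed.

Lemma at_i_infty_filter : Filter (at_i_infty RR).
Proof.
apply: filter_from_filter; first by exists 0.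
move=> M N _ _; exists (Num.max M N) => // z /=.
by rewrite gt_max => /andP [].
Qed.

Lemma cusp_forms_lin w a (f g : CC -> CC^o) :
  cusp_forms RR w f -> cusp_forms RR w g -> cusp_forms RR w (a *: f + g).
Proof.
move=> [f0 fd fm fl] [g0 gd gm gl]; split.
- by move=> z hz; rewrite !fctE f0 ?g0 // scaler0 addr0.
- move=> z hz; apply: derivableD; [apply: derivableZ; exact: fd|exact: gd].
- move=> x y c d z h hz; rewrite !fctE fm // gm // mulrDr; congr (_ + _).
  by rewrite -[_ *: _]/(_ * _) -[_ *: f z]/(_ * _) mulrCA.
- rewrite -[X in _ --> X](_ : a *: (0 : CC^o) + 0 = 0); last by rewrite scaler0 addr0.
  have FF := at_i_infty_filter.
  by apply: (cvgD _ gl); exact: cvgZl_tmp.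
Qed.

Lemma cusp_forms0 w : cusp_forms RR w 0.
Proof.
split=> //.
- by move=> x y c d z _ _; rewrite mulr0.
- by have FF := at_i_infty_filter; exact: (@cvg_cst CC^o).
Qed.

(** * The dimension bound *)

Lemma rank_ge_of_cusp_forms m d1 d2 (f : 'I_d1 -> CC -> CC^o) (g : 'I_d2 -> CC -> CC^o) :
  odd m -> (1 < m)%N ->
  independent f -> (forall i, cusp_forms RR m.+1 (f i)) ->
  independent g -> (forall i, cusp_forms RR m.+3 (g i)) ->
  (d1 + d2 <= \rank (kermx (constraint_mx rat m) *m stuffle_shuffle_mx rat m))%N.
Proof.
case: m => // n /= nE n0 indf cf indg cg; rewrite ltnS in n0.
have nE2 : ~~ odd n.+2 by rewrite /= negbK.
have /choice [P hP] : forall i, exists P, period_poly n (f i) P by move=> i; exact: period_poly_ex.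
have /choice [Q hQ] : forall i, exists Q, period_poly n.+2 (g i) Q by move=> i; exact: period_poly_ex.
have sumE d (c : 'I_d -> CC) (h : 'I_d -> CC -> CC^o) :
    \sum_i c i *: h i = (fun z => \sum_i c i * h i z).
  by apply/funext => z; rewrite fct_sumE.
have csum w d (c : 'I_d -> CC) (h : 'I_d -> CC -> CC^o) :
    (forall i, cusp_forms RR w (h i)) -> cusp_forms RR w (fun z => \sum_i c i * h i z).
  move=> ch; rewrite -sumE; elim/big_ind: _ => [|u v hu hv|i _].
  - exact: cusp_forms0.
  - by rewrite -[u]scale1r; exact: cusp_forms_lin.
  - by rewrite -[_ *: _]addr0; apply: cusp_forms_lin => //; exact: cusp_forms0.
apply: (rank_ge_of_cocycles (P := P) (Q := Q)) => //.
- by move=> i; exact: period_poly_cocycle (hP i).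
- by move=> i; exact: period_poly_cocycle (hQ i).
- move=> c hc; apply: indf; rewrite sumE.
  (* A vanishing odd part is the case s = -1 with constant 0; the second family uses s = 1 with an
     arbitrary constant b. *)
  apply: (@period_poly_eq0 n _ _ (-1) 0 n0 nE (csum _ _ c _ cf) (period_poly_sum c hP)).
    by rewrite oppr_eq0 oner_eq0.
  by move=> z; rewrite mul0r mulN1r hc subrr.
- move=> c b hc; apply: indg; rewrite sumE.
  apply: (@period_poly_eq0 n.+2 _ _ 1 b _ _ (csum _ _ c _ cg) (period_poly_sum c hQ)) => //.
  by move=> z; rewrite mul1r hc.
Qed.

Lemma double_zeta_relation_lin k a (u v : {ffun even_index k -> rat^o}) :
  double_zeta_relation RR u -> double_zeta_relation RR v ->
  double_zeta_relation RR (a *: u + v).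
Proof.
move=> [q hq] [q' hq']; exists (a * q + q').
rewrite rmorphD rmorphM /= mulrDl -mulrA -hq -hq' mulr_sumr -big_split.
by apply: eq_bigr => r _; rewrite !ffunE rmorphD rmorphM /=; ring.
Qed.

Lemma double_zeta_relation0 k : double_zeta_relation RR (0 : {ffun even_index k -> rat^o}).
Proof.
exists 0; rewrite rmorph0 mul0r big1 // => r _; by rewrite ffunE rmorph0 mul0r.
Qed.

Theorem theorem4 (k : nat) (hk : (7 <= k)%N) (hodd : odd k) :
  exists (d1 d2 : nat) (V : {vspace {ffun even_index k -> rat^o}}),
    [/\ has_dim (cusp_forms Rdefinitions.R k.-1) d1,
        has_dim (cusp_forms Rdefinitions.R k.+1) d2,
        forall a : {ffun even_index k -> rat^o},
          a \in V <-> double_zeta_relation Rdefinitions.R a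
      & (d1 + d2 <= \dim V)%N].
Proof.
case: k hk hodd => [|[|m]] //; rewrite /= negbK => hk mO.
have m1 : (1 < m)%N by move: hk; lia.
(* Finite dimension: the rank inequality, with the other family empty, bounds every independent
   family of cusp forms. *)
have [d1 D1] : exists d, has_dim (cusp_forms RR m.+1) d.
  apply: (has_dim_of_bounded (cusp_forms0 _)) => [a u v|d e ie we]; first exact: cusp_forms_lin.
  have h0 : forall i : 'I_0, cusp_forms RR m.+3 ((fun=> 0) i) by case.
  have := rank_ge_of_cusp_forms mO m1 ie we (@independent0 _ _ _) h0.
  by rewrite addn0; exact.
have [d2 D2] : exists d, has_dim (cusp_forms RR m.+3) d.
  apply: (has_dim_of_bounded (cusp_forms0 _)) => [a u v|d e ie we]; first exact: cusp_forms_lin.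
  have h0 : forall i : 'I_0, cusp_forms RR m.+1 ((fun=> 0) i) by case.
  by have := rank_ge_of_cusp_forms mO m1 (@independent0 _ _ _) h0 ie we; rewrite add0n; exact.
have [V HV] := vspace_of_set (double_zeta_relation0 m.+2) (@double_zeta_relation_lin m.+2).
exists d1, d2, V; split=> //.
have [e [ie We]] := D1; have [e' [ie' We']] := D2.
have span w d (h : 'I_d -> CC -> CC^o) i :
    cusp_forms RR w = [set v | exists c, v = \sum_i c i *: h i] -> cusp_forms RR w (h i).
  move=> ->; exists (fun j => (j == i)%:R).
  rewrite (bigD1 i) //= eqxx scale1r big1 ?addr0 // => j /negbTE ->; exact: scale0r.
apply: leq_trans (dim_relations mO HV).
by apply: (@rank_ge_of_cusp_forms m d1 d2 e e') => // i; exact: span.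
Qed.
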